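(* Let $y(t)=\begin{bmatrix}y_1(t)\\ y_2(t)\end{bmatrix}$ be an $(m+p)$-dimensional low-rank stationary process with rational spectral density $\Phi(z)$ of rank $m$, with $y_1$ of dimension $m$ and $\Phi_{11}(z)$ (the spectral density of $y_1$) full-rank, and innovation model $$y(t)=W(z)e(t)=\begin{bmatrix}W_1(z)\\ W_2(z)\end{bmatrix}e(t),$$ where $W$ is a minimum-phase $(m+p)\times m$ spectral factor of $\Phi$ with $W_1$ of size $m\times m$ and full-rank, and $e(t)$ is the $m$-dimensional normalized innovation process. Let $W_2(z)=G_2(z)Q_2(z)$ be an outer-inner factorization, with $G_2$ a $p\times r$ outer matrix (a minimum-phase full-rank spectral factor of the spectral density $\Phi_{22}(z)$ of $y_2$), $Q_2$ an $r\times m$ inner matrix satisfying $Q_2Q_2^*=I$, and $r=\operatorname{rank}(W_2)$. Then a forward loop of the feedback model $$y_1(t)=F(z)y_2(t)+K(z)e(t),\qquad y_2(t)=H(z)y_1(t)$$ can be given as $$y_1(t)=F_+\,y_2(t-1)+K_+\,e(t),$$ where $$F_+=[zW_1Q_2^*]_+\,G_2^{-L}$$ denotes all solutions to the one-step ahead Wiener filter from $y_2$ to $y_1$, and $$K_+=W_1-z^{-1}[zW_1Q_2^*]_+\,Q_2 .$$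
   Context: Here $m>0$, $p\ge 0$ are integers and $z$ acts as the forward shift, $z^{-1}y(t)=y(t-1)$. For a rational matrix function, $W(z)^*=\overline{W(\bar z^{-1})}^{\top}$ (the conjugate transpose on the unit circle); a spectral factor of $\Phi$ is a $W$ with $\Phi=WW^*$. A rational matrix function is minimum-phase (equivalently, outer) if it has all its poles in the open unit disc and all its zeros in the closed unit disc; $\alpha$ in the region of analyticity of $W$ is a zero if $W(\alpha)v=0$ for some nonzero vector $v$. The normalized innovation $e(t)$ is the white noise process with identity covariance driving the minimum-phase model of $y$. In the feedback model, the forward loop is the first equation; $K(z)$ is a minimum-phase function, and $H(z)=\Phi_{21}(z)\Phi_{11}(z)^{-1}$ is the deterministic relation satisfying $W_2=HW_1$. $G_2^{-L}$ denotes a left inverse of $G_2$, and $[\cdot]_+$ denotes the orthogonal projection onto the Hardy space $H^2$ of functions that are causal and stable (analytic outside the unit disc, i.e. expansions in nonpositive powers of $z$), giving the causal stable part (constant term included). $\mathbf H^-_{t-1}(y_2)$ is the closed linear span of the components of $y_2(s)$, $s\le t-1$; a one-step ahead Wiener filter from $y_2$ to $y_1$ is a transfer function $F_+$ with $F_+(z)y_2(t-1)=\mathbb{E}\{y_1(t)\mid \mathbf H^-_{t-1}(y_2)\}$, the (linear) projection of $y_1(t)$ on $\mathbf H^-_{t-1}(y_2)$.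
   Formalization: ''All solutions'' is meant up to equality as filters on y_2 (exact for F whose columns lie in the column space of [zW_1Q_2^*]_+), and K_+ is shown to be stable, not minimum-phase as the feedback model asks (W_1=z^{-1}, W_2=1 gives K_+=0). *)

(* Defs.v *)
From HB Require Import structures.
From mathcomp Require Export all_boot all_order all_algebra complex.
From mathcomp Require Export all_classical all_reals all_analysis.

Set Implicit Arguments.
Unset Strict Implicit.
Unset Printing Implicit Defensive.

Import Order.TTheory GRing.Theory Num.Theory.

Local Open Scope complex_scope.
Local Open Scope classical_set_scope.
Local Open Scope ring_scope.

Notation ratfun R := {fraction {poly R[i]}}.

Definition ratX {R : realType} : ratfun R := tofrac 'X.

Definition ratC {R : realType} (c : R[i]) : ratfun R := tofrac c%:P.

(** The representative of a fraction is not in lowest terms in general; the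
    common factor must be removed before evaluating. *)
Definition rnum {R : realType} (f : ratfun R) : {poly R[i]} :=
  let nd := fraction.frac (repr f) in nd.1 %/ gcdp nd.1 nd.2.

Definition rden {R : realType} (f : ratfun R) : {poly R[i]} :=
  let nd := fraction.frac (repr f) in nd.2 %/ gcdp nd.1 nd.2.

(** Points of the Riemann sphere are [Some a], or [None] for infinity.  At
    infinity the value is the ratio of the coefficients of degree [deg rden].
    At a pole in the plane [value_at] is [0]. *)
Definition analytic_at {R : realType} (f : ratfun R) (a : option R[i]) : bool :=
  match a with
  | Some c => (rden f).[c] != 0
  | None => (size (rnum f) <= size (rden f))%N
  end.

Definition value_at {R : realType} (f : ratfun R) (a : option R[i]) : R[i] :=
  match a with
  | Some c => (rnum f).[c] / (rden f).[c]
  | None => (rnum f)`_(size (rden f)).-1 / lead_coef (rden f)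
  end.

Definition in_open_disc {R : realType} (a : option R[i]) : bool :=
  if a is Some c then `|c| < 1 else false.

Definition in_closed_disc {R : realType} (a : option R[i]) : bool :=
  if a is Some c then `|c| <= 1 else false.

Definition is_pole {R : realType} {m n : nat} (M : 'M[ratfun R]_(m, n))
    (a : option R[i]) : Prop :=
  exists i j, ~~ analytic_at (M i j) a.

Definition is_zero {R : realType} {m n : nat} (M : 'M[ratfun R]_(m, n))
    (a : option R[i]) : Prop :=
  ~ is_pole M a /\
  exists2 v : 'cV[R[i]]_n, v != 0 & map_mx (fun f => value_at f a) M *m v = 0.

Definition stable {R : realType} {m n : nat} (M : 'M[ratfun R]_(m, n)) : Prop :=
  forall a, is_pole M a -> in_open_disc a.

Definition minimum_phase {R : realType} {m n : nat}
    (M : 'M[ratfun R]_(m, n)) : Prop :=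
  stable M /\ forall a, is_zero M a -> in_closed_disc a.

(** [rstar f z = conj (f (1 / conj z))]. *)
Definition rstar {R : realType} (f : ratfun R) : ratfun R :=
  (map_poly (fun c => ratC (conjc c)) (rnum f)).[ratX^-1] /
  (map_poly (fun c => ratC (conjc c)) (rden f)).[ratX^-1].

Definition mxstar {R : realType} {m n : nat} (M : 'M[ratfun R]_(m, n)) :
    'M[ratfun R]_(n, m) :=
  (map_mx rstar M)^T.

Definition spectral_factor {R : realType} {n m : nat} (Phi : 'M[ratfun R]_n)
    (W : 'M[ratfun R]_(n, m)) : Prop :=
  Phi = W *m mxstar W.

Definition inner {R : realType} {m n : nat} (Q : 'M[ratfun R]_(m, n)) : Prop :=
  stable Q /\ Q *m mxstar Q = 1%:M.

(** Functions on the unit circle are functions of the angle, in [[-pi, pi]]. *)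

Definition expi {R : realType} (th : R) : R[i] := cos th +i* sin th.

Definition sqabs {R : realType} (z : R[i]) : R :=
  complex.Re z ^+ 2 + complex.Im z ^+ 2.

Definition boundary {R : realType} (f : ratfun R) (th : R) : R[i] :=
  value_at f (Some (expi th)).

Definition circle {R : realType} : set R := [set` `[- pi, pi]%R].

Definition circle_integral {R : realType} (f : R -> R[i]) : R[i] :=
  ((pi *+ 2)^-1 * Rintegral lebesgue_measure circle (fun th => complex.Re (f th)))
  +i* ((pi *+ 2)^-1 * Rintegral lebesgue_measure circle (fun th => complex.Im (f th))).

Definition circle_integrable {R : realType} (f : R -> R[i]) : Prop :=
  lebesgue_measure.-integrable circle (fun th => (complex.Re (f th))%:E) /\
  lebesgue_measure.-integrable circle (fun th => (complex.Im (f th))%:E).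

(** [hardy2] is the space of boundary values of functions analytic outside the
    closed disc: no Fourier coefficient on a positive power [z^k]. *)
Definition hardy2 {R : realType} (f : R -> R[i]) : Prop :=
  [/\ measurable_fun circle (fun th => complex.Re (f th)),
      measurable_fun circle (fun th => complex.Im (f th)),
      (\int[lebesgue_measure]_(th in circle) (sqabs (f th))%:E < +oo)%E &
      forall k : nat, (0 < k)%N ->
        circle_integral (fun th => f th * conjc (expi (k%:R * th))) = 0].

Definition is_hardy_proj {R : realType} (f g : ratfun R) : Prop :=
  hardy2 (boundary g) /\
  forall h : R -> R[i], hardy2 h ->
    circle_integral (fun th => (boundary f th - boundary g th) * conjc (h th)) = 0.

(** The operator [[.]_+], entrywise.  The projection of a rational function
    without poles on the circle is rational and unique as a rational function;
    the default value [0] of [xget] is not used for such functions. *)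
Definition hardy_proj {R : realType} {m n : nat} (M : 'M[ratfun R]_(m, n)) :
    'M[ratfun R]_(m, n) :=
  map_mx (fun f => xget 0 [set g | is_hardy_proj f g]) M.

Definition cE {d : measure_display} {T : measurableType d} {R : realType}
    (P : probability T R) (X : T -> R[i]) : R[i] :=
  fine ('E_P[fun w => complex.Re (X w)])%E
  +i* fine ('E_P[fun w => complex.Im (X w)])%E.

Definition L2 {d : measure_display} {T : measurableType d} {R : realType}
    (P : probability T R) (X : T -> R[i]) : Prop :=
  (fun w => complex.Re (X w)) \in Lfun P 2%:E /\
  (fun w => complex.Im (X w)) \in Lfun P 2%:E.

Definition L2vec {d : measure_display} {T : measurableType d} {R : realType}
    {n : nat} (P : probability T R) (X : T -> 'cV[R[i]]_n) : Prop :=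
  forall i, L2 P (fun w => X w i 0).

Definition mean_square {d : measure_display} {T : measurableType d}
    {R : realType} {n : nat} (P : probability T R) (X : T -> 'cV[R[i]]_n) :
    \bar R :=
  (\int[P]_w (\sum_i sqabs (X w i 0))%:E)%E.

(** [cov P X Y = E (X Y^* )]; all processes have zero mean. *)
Definition cov {d : measure_display} {T : measurableType d} {R : realType}
    {m n : nat} (P : probability T R) (X : T -> 'cV[R[i]]_m)
    (Y : T -> 'cV[R[i]]_n) : 'M[R[i]]_(m, n) :=
  \matrix_(i, j) cE P (fun w => X w i 0 * conjc (Y w j 0)).

Definition zero_mean_L2 {d : measure_display} {T : measurableType d}
    {R : realType} {n : nat} (P : probability T R)
    (y : int -> T -> 'cV[R[i]]_n) : Prop :=
  forall t, L2vec P (y t) /\ forall i, cE P (fun w => y t w i 0) = 0.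

Definition stationary {d : measure_display} {T : measurableType d}
    {R : realType} {n : nat} (P : probability T R)
    (y : int -> T -> 'cV[R[i]]_n) : Prop :=
  zero_mean_L2 P y /\
  forall s t k : int, cov P (y (s + k)) (y s) = cov P (y (t + k)) (y t).

Definition has_spectral_density {d : measure_display} {T : measurableType d}
    {R : realType} {n : nat} (P : probability T R)
    (y : int -> T -> 'cV[R[i]]_n) (Phi : 'M[ratfun R]_n) : Prop :=
  (forall i j, circle_integrable (boundary (Phi i j))) /\
  forall t k : int, cov P (y (t + k)) (y t) =
    \matrix_(i, j) circle_integral
      (fun th => expi (k%:~R * th) * boundary (Phi i j) th).

Definition normalized_white_noise {d : measure_display} {T : measurableType d}
    {R : realType} {n : nat} (P : probability T R)
    (e : int -> T -> 'cV[R[i]]_n) : Prop :=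
  zero_mean_L2 P e /\
  forall s t : int, cov P (e s) (e t) = if s == t then 1%:M else 0.

(** The list [s] of pairs [(k, A)] is the matrix Laurent polynomial
    [sum A z^-k], which acts on [y] as [sum A y(t - k)]. *)
Definition laurent {R : realType} {q n : nat} (s : seq (int * 'M[R[i]]_(q, n))) :
    'M[ratfun R]_(q, n) :=
  \sum_(a <- s) (ratX ^ (- a.1)) *: map_mx ratC a.2.

Definition laurent_apply {T : Type} {R : realType} {q n : nat}
    (s : seq (int * 'M[R[i]]_(q, n))) (y : int -> T -> 'cV[R[i]]_n) (t : int)
    (w : T) : 'cV[R[i]]_q :=
  \sum_(a <- s) a.2 *m y (t - a.1) w.

(** Squared norm in [L2(Phi)]. *)
Definition spectral_norm2 {R : realType} {q n : nat} (Phi : 'M[ratfun R]_n)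
    (F : 'M[ratfun R]_(q, n)) : \bar R :=
  (((pi *+ 2)^-1)%:E * \int[lebesgue_measure]_(th in circle)
     (complex.Re (boundary (\tr (F *m Phi *m mxstar F)) th))%:E)%E.

(** [filter_output P y Phi F t xi]: [xi = F(z) y(t)] almost surely, for [y]
    stationary with spectral density [Phi].  This is the spectral (Kolmogorov)
    isomorphism: the isometry from [L2(Phi)] to the closed span of [y] that sends
    [z^-k] to [y(t - k)], given by mean-square limits of Laurent polynomials.
    For [F] stable and [y] white it is [sum_k F_k y(t - k)]; it does not require
    [F] to be stable or bounded on the circle: a left inverse of an outer [G]
    may have poles on or outside it, and only [F Phi F^*] has to be integrable. *)
Definition filter_output {d : measure_display} {T : measurableType d}
    {R : realType} {q n : nat} (P : probability T R)
    (y : int -> T -> 'cV[R[i]]_n) (Phi : 'M[ratfun R]_n)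
    (F : 'M[ratfun R]_(q, n)) (t : int) (xi : T -> 'cV[R[i]]_q) : Prop :=
  L2vec P xi /\
  forall eps : R, 0 < eps ->
    exists s : seq (int * 'M[R[i]]_(q, n)),
      (mean_square P (fun w => xi w - laurent_apply s y t w)%R < eps%:E)%E /\
      (spectral_norm2 Phi (F - laurent s)%R < eps%:E)%E.

(** The closed span of the components of [y(s)], [s <= t]. *)
Definition past {d : measure_display} {T : measurableType d} {R : realType}
    {n : nat} (P : probability T R) (y : int -> T -> 'cV[R[i]]_n) (t : int) :
    set (T -> R[i]) :=
  [set eta | L2 P eta /\ forall eps : R, 0 < eps ->
     exists2 s : seq (int * 'rV[R[i]]_n), all (fun a => a.1 <= t) s &
       (\int[P]_w (sqabs (eta w - \sum_(a <- s) (a.2 *m y a.1 w) 0 0))%:E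
          < eps%:E)%E].

Definition is_projection {d : measure_display} {T : measurableType d}
    {R : realType} (P : probability T R) (S : set (T -> R[i]))
    (x xi : T -> R[i]) : Prop :=
  S xi /\ forall eta, S eta -> cE P (fun w => (x w - xi w) * conjc (eta w)) = 0.

(** [F] is a one-step ahead Wiener filter from [y2], with density [Phi2], to
    [y1]; [F] is not assumed stable, only [F(z) y2(t-1)] has to make sense. *)
Definition wiener_filter {d : measure_display} {T : measurableType d}
    {R : realType} {m p : nat} (P : probability T R)
    (y1 : int -> T -> 'cV[R[i]]_m) (y2 : int -> T -> 'cV[R[i]]_p)
    (Phi2 : 'M[ratfun R]_p) (F : 'M[ratfun R]_(m, p)) : Prop :=
  forall t : int, exists2 xi : T -> 'cV[R[i]]_m,
    filter_output P y2 Phi2 F (t - 1) xi &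
    forall i, is_projection P (past P y2 (t - 1))
                (fun w => y1 t w i 0) (fun w => xi w i 0).

(** [y1(t) = F(z) y2(t - k) + K(z) e(t)]. *)
Definition forward_loop {d : measure_display} {T : measurableType d}
    {R : realType} {m p q : nat} (P : probability T R)
    (y1 : int -> T -> 'cV[R[i]]_m) (y2 : int -> T -> 'cV[R[i]]_p)
    (e : int -> T -> 'cV[R[i]]_q) (Phi2 : 'M[ratfun R]_p)
    (F : 'M[ratfun R]_(m, p)) (K : 'M[ratfun R]_(m, q)) (k : int) : Prop :=
  forall t : int, exists xi zeta : T -> 'cV[R[i]]_m,
    [/\ filter_output P y2 Phi2 F (t - k) xi,
        filter_output P e 1%:M K t zeta &
        {ae P, forall w, y1 t w = xi w + zeta w}].

Definition feedback_model {d : measure_display} {T : measurableType d}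
    {R : realType} {m p q : nat} (P : probability T R)
    (y1 : int -> T -> 'cV[R[i]]_m) (y2 : int -> T -> 'cV[R[i]]_p)
    (e : int -> T -> 'cV[R[i]]_q) (Phi1 : 'M[ratfun R]_m)
    (Phi2 : 'M[ratfun R]_p) (F : 'M[ratfun R]_(m, p))
    (K : 'M[ratfun R]_(m, q)) (H : 'M[ratfun R]_(p, m)) : Prop :=
  forward_loop P y1 y2 e Phi2 F K 0 /\
  forall t : int, filter_output P y1 Phi1 H t (y2 t).

(** [F] and [F'] are the same element of [L2(Phi)], that is, the same filter on
    a process with spectral density [Phi]. *)
Definition same_filter {R : realType} {q n : nat} (Phi : 'M[ratfun R]_n)
    (F F' : 'M[ratfun R]_(q, n)) : Prop :=
  (F - F') *m Phi = 0.

Definition left_inverse {R : realType} {n r : nat} (G : 'M[ratfun R]_(n, r))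
    (L : 'M[ratfun R]_(r, n)) : Prop :=
  L *m G = 1%:M.

(* Main.v *)
From HB Require Import structures.
From mathcomp Require Import ring lra measurable_realfun.
Require Import Defs.

(** The theorem is an orthogonal projection computed on the unit circle.

    A rational matrix V without poles on the circle acts on the white noise e,
    and the covariance of two outputs is the integral of V U^* over the circle
    ([noise_output_isometry]).  Statements about y therefore become statements about
    rational matrices: y_1(t) corresponds to W_1 and y_2(t) to W_2 = G_2 Q_2.

    The candidate for the projection of y_1(t) on the past of y_2 is
    z^-1 X Q_2 with X = [z W_1 Q_2^*]_+, and K is the error.  Since
    Q_2 Q_2^* = 1, the product K W_2^* is z^-1 (z W_1 Q_2^* - X) G_2^*, in which
    the projection has left only the strictly anticausal part of z W_1 Q_2^*;
    this is orthogonal to every stable function, hence the error is orthogonal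
    to y_2(s) for s < t ([error_orth_past]).

    The candidate lies in the past of y_2 because G_2 is outer: X is an L2 limit
    of products s G_2 with s a causal matrix Laurent polynomial, and
    multiplication by Q_2 is isometric.  This is the rational case of Beurling's
    theorem ([beurling]).  One takes a polynomial left inverse L G_2 = delta I
    in the variable u = 1/z for which delta has minimal degree; a root of delta
    where G_2 has independent columns could be divided out
    ([poly_left_inverse]), so minimum phase puts every root in |u| >= 1.  For
    such a delta, Fejer means provide polynomials g with delta g close to 1,
    also when delta has roots on the circle ([approx_inv_fejer]), and x g L G_2 is
    close to x.

    A filter F sends y_2(t-1) to the projection exactly when F W_2 = X Q_2,
    that is F G_2 = X ([solution_wiener], [wiener_solution]).  Every F = X L with
    L a left inverse satisfies this.  Conversely F G_2 = X determines F in
    L2(Phi_22), and if moreover F = X D for some D, then D + (1 - D G_2) L_0 is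
    a left inverse with the same product ([left_inverse_rowspace]).

    The projection [.]_+ of a rational function exists by partial fractions
    ([hardy_decomposition]), and the outputs exist by completeness of L2
    ([riesz_fischer_real]). *)

Set Implicit Arguments.
Unset Strict Implicit.
Unset Printing Implicit Defensive.
Import Order.TTheory GRing.Theory Num.Theory.
Import numFieldNormedType.Exports.
Local Open Scope complex_scope.
Local Open Scope classical_set_scope.
Local Open Scope ring_scope.

(** * Complex numbers and square-integrable functions *)

Section Complex.
Context {R : realType}.
Implicit Types z w : R[i].

Lemma complexP z w : complex.Re z = complex.Re w -> complex.Im z = complex.Im w -> z = w.
Proof. by case: z => a b; case: w => c d /= -> ->. Qed.

Lemma ReD z w : complex.Re (z + w) = complex.Re z + complex.Re w.
Proof. by case: z; case: w. Qed.
Lemma ImD z w : complex.Im (z + w) = complex.Im z + complex.Im w.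
Proof. by case: z; case: w. Qed.
Lemma ReN z : complex.Re (- z) = - complex.Re z.
Proof. by case: z. Qed.
Lemma ImN z : complex.Im (- z) = - complex.Im z.
Proof. by case: z. Qed.
Lemma ReM z w : complex.Re (z * w) =
  complex.Re z * complex.Re w - complex.Im z * complex.Im w.
Proof. by case: z; case: w. Qed.
Lemma ImM z w : complex.Im (z * w) =
  complex.Re z * complex.Im w + complex.Im z * complex.Re w.
Proof. by case: z; case: w. Qed.
Lemma ReJ z : complex.Re (conjc z) = complex.Re z.
Proof. by case: z. Qed.
Lemma ImJ z : complex.Im (conjc z) = - complex.Im z.
Proof. by case: z. Qed.
Definition ReImE := (ReD, ImD, ReN, ImN, ReM, ImM, ReJ, ImJ).

Lemma conjc_mul z w : conjc (z * w) = conjc z * conjc w.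
Proof. by apply: complexP; rewrite !ReImE; ring. Qed.
Lemma conjc_add z w : conjc (z + w) = conjc z + conjc w.
Proof. by apply: complexP; rewrite !ReImE; ring. Qed.
Lemma conjc_opp z : conjc (- z) = - conjc z.
Proof. by apply: complexP; rewrite !ReImE; ring. Qed.
Lemma conjc_sum (I : Type) (s : seq I) (P : pred I) (f : I -> R[i]) :
  conjc (\sum_(i <- s | P i) f i) = \sum_(i <- s | P i) conjc (f i).
Proof. by apply: (big_morph (@conjc R) conjc_add); exact: conjc0. Qed.

Lemma Re_sum (I : Type) (s : seq I) (P : pred I) (f : I -> R[i]) :
  complex.Re (\sum_(i <- s | P i) f i) = \sum_(i <- s | P i) complex.Re (f i).
Proof. by elim/big_rec2: _ => // i x y _ <-; rewrite ReD. Qed.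

Lemma sqabs_ge0 z : 0 <= sqabs z.
Proof. by rewrite addr_ge0 // sqr_ge0. Qed.
Lemma sqabsM z w : sqabs (z * w) = sqabs z * sqabs w.
Proof. by rewrite /sqabs !ReImE; ring. Qed.
Lemma sqabsJ z : sqabs (conjc z) = sqabs z.
Proof. by rewrite /sqabs !ReImE; ring. Qed.
Lemma sqabsN z : sqabs (- z) = sqabs z.
Proof. by rewrite /sqabs !ReImE; ring. Qed.
Lemma sqabs0 : sqabs (0 : R[i]) = 0.
Proof. by rewrite /sqabs /= expr0n /= addr0. Qed.
Lemma sqabs1 : sqabs (1 : R[i]) = 1.
Proof. by rewrite /sqabs /= expr0n /= expr1n addr0. Qed.
Lemma sqabsC (a : R) : sqabs a%:C = a ^+ 2.
Proof. by rewrite /sqabs /= expr0n /= addr0. Qed.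
Lemma sqabs_eq0 z : (sqabs z == 0) = (z == 0).
Proof.
apply/eqP/eqP => [/eqP|->]; last exact: sqabs0.
rewrite /sqabs paddr_eq0 ?sqr_ge0 // !sqrf_eq0 => /andP[/eqP a /eqP b].
exact: complexP.
Qed.
Lemma sqabsX z n : sqabs (z ^+ n) = sqabs z ^+ n.
Proof. by elim: n => [|n IH]; rewrite ?expr0 ?sqabs1 // !exprS sqabsM IH. Qed.
Lemma sqabsV z : sqabs z^-1 = (sqabs z)^-1.
Proof.
have [->|z0] := eqVneq z 0; first by rewrite invr0 sqabs0 invr0.
have s0 : sqabs z != 0 by rewrite sqabs_eq0.
by apply: (mulIf s0); rewrite -sqabsM !mulVf ?sqabs1.
Qed.
Lemma sqabsD_le z w : sqabs (z + w) <= 2 * sqabs z + 2 * sqabs w.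
Proof.
rewrite /sqabs !ReImE.
have := sqr_ge0 (complex.Re z - complex.Re w).
have := sqr_ge0 (complex.Im z - complex.Im w); lra.
Qed.
Lemma sqabsB_le z w : sqabs (z - w) <= 2 * sqabs z + 2 * sqabs w.
Proof. by have := sqabsD_le z (- w); rewrite sqabsN. Qed.
Lemma mulcJ z : z * conjc z = (sqabs z)%:C.
Proof. by apply: complexP; rewrite /sqabs !ReImE /=; ring. Qed.
End Complex.

Section L2space.
Context d (T : measurableType d) (R : realType).
Variables (mu : {measure set T -> \bar R}) (D : set T).
Hypothesis mD : measurable D.
Implicit Types f g h : T -> R[i].

Definition cmeas f := measurable_fun D (fun x => complex.Re (f x)) /\
  measurable_fun D (fun x => complex.Im (f x)).
Definition cintegrable f := mu.-integrable D (fun x => (complex.Re (f x))%:E) /\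
  mu.-integrable D (fun x => (complex.Im (f x))%:E).
Definition cintegral f : R[i] := Rintegral mu D (fun x => complex.Re (f x)) +i*
  Rintegral mu D (fun x => complex.Im (f x)).
Definition sqnorm f : \bar R := (\int[mu]_(x in D) (sqabs (f x))%:E)%E.
Definition l2 f := cmeas f /\ (sqnorm f < +oo)%E.

Lemma cmeas_ext f g : {in D, f =1 g} -> cmeas f -> cmeas g.
Proof.
move=> fg [mr mi]; split.
  by apply: eq_measurable_fun mr => x xD; rewrite fg.
by apply: eq_measurable_fun mi => x xD; rewrite fg.
Qed.
Lemma cmeas_cst (c : R[i]) : cmeas (fun=> c).
Proof. by split; exact: measurable_cst. Qed.
Lemma cmeasD f g : cmeas f -> cmeas g -> cmeas (fun x => f x + g x).
Proof.
move=> [fr fi] [gr gi]; split.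
  under eq_fun do rewrite ReD; exact: measurable_funD.
under eq_fun do rewrite ImD; exact: measurable_funD.
Qed.
Lemma cmeasM f g : cmeas f -> cmeas g -> cmeas (fun x => f x * g x).
Proof.
move=> [fr fi] [gr gi]; split.
  by under eq_fun do rewrite ReM; apply: measurable_funB; exact: measurable_funM.
by under eq_fun do rewrite ImM; apply: measurable_funD; exact: measurable_funM.
Qed.
Lemma cmeasJ f : cmeas f -> cmeas (fun x => conjc (f x)).
Proof.
move=> [fr fi]; split; first by under eq_fun do rewrite ReJ.
by under eq_fun do rewrite ImJ; exact: measurable_funN.
Qed.
Lemma cmeas_sum (I : Type) (s : seq I) (F : I -> T -> R[i]) :
  (forall i, cmeas (F i)) -> cmeas (fun x => \sum_(i <- s) F i x).
Proof.
move=> mF; elim: s => [|i s IH].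
  by under eq_fun do rewrite big_nil; exact: cmeas_cst.
by under eq_fun do rewrite big_cons; exact: cmeasD.
Qed.
Lemma cmeas_sq f : cmeas f -> measurable_fun D (fun x => sqabs (f x)).
Proof. by move=> [fr fi]; apply: measurable_funD; exact: measurable_funX. Qed.
Lemma cmeas_sqe f : cmeas f -> measurable_fun D (fun x => (sqabs (f x))%:E).
Proof. by move=> mf; apply/measurable_EFinP; exact: cmeas_sq. Qed.

Lemma sqnorm_ge0 f : (0 <= sqnorm f)%E.
Proof. by apply: integral_ge0 => x _; rewrite lee_fin sqabs_ge0. Qed.
Lemma sqnorm_eq f g : {in D, f =1 g} -> sqnorm f = sqnorm g.
Proof. by move=> fg; apply: eq_integral => x xD; rewrite fg. Qed.
Lemma sqnorm_le f g (c : R) : 0 <= c -> cmeas f -> cmeas g ->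
  (forall x, D x -> sqabs (f x) <= c * sqabs (g x)) -> (sqnorm f <= c%:E * sqnorm g)%E.
Proof.
move=> c0 mf mg fg; rewrite -ge0_integralZl//; first last.
- by move=> x _; rewrite lee_fin sqabs_ge0.
- exact: cmeas_sqe.
apply: ge0_le_integral => //.
- by move=> x _; rewrite lee_fin sqabs_ge0.
- exact: cmeas_sqe.
- by apply: measurable_funeM; exact: cmeas_sqe.
Qed.
Lemma sqnormZ (c : R[i]) f : cmeas f -> sqnorm (fun x => c * f x) = ((sqabs c)%:E * sqnorm f)%E.
Proof.
move=> mf; rewrite -ge0_integralZl//; first last.
- by rewrite lee_fin sqabs_ge0.
- by move=> x _; rewrite lee_fin sqabs_ge0.
- exact: cmeas_sqe.
by apply: eq_integral => x _; rewrite sqabsM EFinM.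
Qed.
Lemma sqnormD_le f g : cmeas f -> cmeas g ->
  (sqnorm (fun x => f x + g x)%R <= 2%:E * sqnorm f + 2%:E * sqnorm g)%E.
Proof.
move=> mf mg; rewrite -!ge0_integralZl//; do ?[exact: cmeas_sqe|
  by move=> x _; rewrite lee_fin sqabs_ge0].
rewrite -ge0_integralD//; do ?[by apply: measurable_funeM; exact: cmeas_sqe|
  by move=> x _; rewrite -EFinM lee_fin mulr_ge0 // sqabs_ge0].
apply: ge0_le_integral => //.
- by move=> x _; rewrite lee_fin sqabs_ge0.
- by apply: cmeas_sqe; exact: cmeasD.
- by apply: emeasurable_funD; apply: measurable_funeM; exact: cmeas_sqe.
- by move=> x Dx; rewrite -!EFinM -EFinD lee_fin sqabsD_le.
Qed.

Lemma l2_ext f g : {in D, f =1 g} -> l2 f -> l2 g.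
Proof. by move=> fg [mf sf]; split; [exact: cmeas_ext mf|rewrite -(sqnorm_eq fg)]. Qed.
Lemma l2D f g : l2 f -> l2 g -> l2 (fun x => f x + g x).
Proof.
move=> [mf sf] [mg sg]; split; first exact: cmeasD.
apply: le_lt_trans (sqnormD_le mf mg) _.
by rewrite lte_add_pinfty // lte_mul_pinfty// ?lee_fin//.
Qed.
Lemma l2Z (c : R[i]) f : l2 f -> l2 (fun x => c * f x).
Proof.
move=> [mf sf]; split; first by apply: cmeasM => //; exact: cmeas_cst.
by rewrite sqnormZ // lte_mul_pinfty// lee_fin sqabs_ge0.
Qed.
Lemma l2N f : l2 f -> l2 (fun x => - f x).
Proof.
by move=> /(l2Z (-1)); apply: l2_ext => x _; rewrite mulN1r.
Qed.
Lemma l2B f g : l2 f -> l2 g -> l2 (fun x => f x - g x).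
Proof. by move=> lf lg; apply: l2D => //; exact: l2N. Qed.
Lemma l20 : l2 (fun=> 0).
Proof.
split; first exact: cmeas_cst.
by rewrite /sqnorm integral0_eq // => x _; rewrite sqabs0.
Qed.
Lemma l2_sum (I : Type) (s : seq I) (F : I -> T -> R[i]) :
  (forall i, l2 (F i)) -> l2 (fun x => \sum_(i <- s) F i x).
Proof.
move=> mF; elim: s => [|i s IH].
  by under eq_fun do rewrite big_nil; exact: l20.
by under eq_fun do rewrite big_cons; exact: l2D.
Qed.
Lemma l2_fin f : l2 f -> sqnorm f \is a fin_num.
Proof. by case=> _ sf; rewrite ge0_fin_numE // sqnorm_ge0. Qed.

Lemma l2_integrable_sqabs f : l2 f -> mu.-integrable D (fun x => (sqabs (f x))%:E).
Proof.
move=> [mf sf]; apply/integrableP; split; first exact: cmeas_sqe.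
have -> // : (\int[mu]_(x in D) `|(sqabs (f x))%:E| = sqnorm f)%E.
by apply: eq_integral => x _; rewrite gee0_abs ?lee_fin ?sqabs_ge0.
Qed.

(** Both components of f conj(g) are bounded by |f|^2 + |g|^2. *)
Lemma l2M_cintegrable f g : l2 f -> l2 g -> cintegrable (fun x => f x * conjc (g x)).
Proof.
move=> lf lg.
have iS : mu.-integrable D (fun x => (sqabs (f x))%:E + (sqabs (g x))%:E)%E.
  by apply: integrableD => //; exact: l2_integrable_sqabs.
have [mr mi] : cmeas (fun x => f x * conjc (g x)).
  by case: lf lg => [? _] [? _]; apply: cmeasM => //; exact: cmeasJ.
split; apply: le_integrable iS => //; do ?exact/measurable_EFinP.
- move=> x _; rewrite -EFinD !abse_EFin lee_fin [leRHS]ger0_norm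
  ?(addr_ge0 (sqabs_ge0 _) (sqabs_ge0 _)) //.
  rewrite ler_norml /sqabs !ReImE; move: (complex.Re _) (complex.Im _) (complex.Re _)
    (complex.Im _) => a b c e.
  have := sqr_ge0 (a - c); have := sqr_ge0 (b - e).
  have := sqr_ge0 (a + c); have := sqr_ge0 (b + e).
  by move=> *; apply/andP; split; nra.
- move=> x _; rewrite -EFinD !abse_EFin lee_fin [leRHS]ger0_norm
  ?(addr_ge0 (sqabs_ge0 _) (sqabs_ge0 _)) //.
  rewrite ler_norml /sqabs !ReImE; move: (complex.Re _) (complex.Im _) (complex.Re _)
    (complex.Im _) => a b c e.
  have := sqr_ge0 (a - e); have := sqr_ge0 (b - c).
  have := sqr_ge0 (a + e); have := sqr_ge0 (b + c).
  by move=> *; apply/andP; split; nra.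
Qed.

Lemma cintegrableD f g : cintegrable f -> cintegrable g ->
  cintegrable (fun x => f x + g x).
Proof.
move=> [fr fi] [gr gi]; split.
  by under eq_fun do rewrite ReD EFinD; exact: integrableD.
by under eq_fun do rewrite ImD EFinD; exact: integrableD.
Qed.
Lemma cintegrableZ (c : R[i]) f : cintegrable f -> cintegrable (fun x => c * f x).
Proof.
move=> [fr fi]; split.
  under eq_fun do rewrite ReM EFinB !EFinM.
  by apply: integrableB => //; exact: integrableZl.
under eq_fun do rewrite ImM EFinD !EFinM.
by apply: integrableD => //; exact: integrableZl.
Qed.
Lemma cintegrable0 : cintegrable (fun=> 0).
Proof. by split; exact: integrable0. Qed.
Lemma cintegrable_sum (I : Type) (s : seq I) (F : I -> T -> R[i]) :
  (forall i, cintegrable (F i)) -> cintegrable (fun x => \sum_(i <- s) F i x).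
Proof.
move=> mF; elim: s => [|i s IH].
  by under eq_fun do rewrite big_nil; exact: cintegrable0.
by under eq_fun do rewrite big_cons; exact: cintegrableD.
Qed.

Lemma cintegral_eq f g : {in D, f =1 g} -> cintegral f = cintegral g.
Proof.
by move=> fg; congr (_ +i* _); apply: eq_Rintegral => x xD; rewrite fg.
Qed.
Lemma eq_cintegrable f g : {in D, f =1 g} -> cintegrable f -> cintegrable g.
Proof.
move=> fg [ir ii]; split.
  by apply: eq_integrable ir => // x xD; rewrite fg.
by apply: eq_integrable ii => // x xD; rewrite fg.
Qed.
Lemma cintegralD f g : cintegrable f -> cintegrable g ->
  cintegral (fun x => f x + g x) = cintegral f + cintegral g.
Proof.
move=> [fr fi] [gr gi]; apply: complexP; rewrite ReImE /=.
  by under eq_Rintegral do rewrite ReD; rewrite RintegralD.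
by under eq_Rintegral do rewrite ImD; rewrite RintegralD.
Qed.
Lemma cintegralZ (c : R[i]) f : cintegrable f -> cintegral (fun x => c * f x) = c * cintegral f.
Proof.
move=> [fr fi]; apply: complexP; rewrite ReImE /=.
  under eq_Rintegral do rewrite ReM; rewrite RintegralB //.
  - by rewrite !RintegralZl.
  - exact: (integrableZl mD _ fr).
  - exact: (integrableZl mD _ fi).
under eq_Rintegral do rewrite ImM; rewrite RintegralD //.
- by rewrite !RintegralZl.
- exact: (integrableZl mD _ fi).
- exact: (integrableZl mD _ fr).
Qed.
Lemma cintegral0 : cintegral (fun=> 0) = 0.
Proof. by rewrite /cintegral /Rintegral !integral0_eq. Qed.
Lemma cintegral_sum (I : Type) (s : seq I) (F : I -> T -> R[i]) :
  (forall i, cintegrable (F i)) ->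
  cintegral (fun x => \sum_(i <- s) F i x) = \sum_(i <- s) cintegral (F i).
Proof.
move=> mF; elim: s => [|i s IH].
  by rewrite big_nil; under cintegral_eq do rewrite big_nil; exact: cintegral0.
rewrite big_cons -IH -cintegralD //; last exact: cintegrable_sum.
by apply: cintegral_eq => x _; rewrite big_cons.
Qed.
Lemma cintegralJ f : cintegrable f -> cintegral (fun x => conjc (f x)) = conjc (cintegral f).
Proof.
move=> [fr fi]; apply: complexP; rewrite ?ReImE /=.
  by apply: eq_Rintegral => x _; rewrite ReJ.
under eq_Rintegral do rewrite ImJ -mulN1r.
by rewrite RintegralZl // mulN1r.
Qed.
Lemma cintegral_sqE f : l2 f -> cintegral (fun x => f x * conjc (f x)) = (fine (sqnorm f))%:C.
Proof.
move=> lf; apply: complexP => /=; last first.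
  rewrite /Rintegral integral0_eq // => x _.
  by rewrite mulcJ.
rewrite /Rintegral /sqnorm; congr fine; apply: eq_integral => x _.
by rewrite mulcJ.
Qed.
End L2space.

(** The inequality |f + g|^2 <= 2 |f|^2 + 2 |g|^2 as it is used in
    approximation arguments, where working with squares avoids square roots. *)
Lemma lt_double_sum (R : realType) (a b c : \bar R) (x y z : R) :
  (c <= 2%:E * a + 2%:E * b)%E -> (0 <= a)%E -> (0 <= b)%E ->
  (a < x%:E)%E -> (b < y%:E)%E -> 2 * x + 2 * y <= z -> (c < z%:E)%E.
Proof.
move=> h a0 b0 ha hb xyz; apply: le_lt_trans h _.
have fa : a \is a fin_num by rewrite ge0_fin_numE // (lt_trans ha) ?ltry.
have fb : b \is a fin_num by rewrite ge0_fin_numE // (lt_trans hb) ?ltry.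
by move: ha hb; rewrite -(fineK fa) -(fineK fb) -!EFinM -EFinD !lte_fin; lra.
Qed.

(** * Inner products of finite families of functions *)

Section Vip.
Context d (T : measurableType d) (R : realType).
Variables (mu : {measure set T -> \bar R}) (D : set T).
Hypothesis mD : measurable D.
Variable I : finType.
Implicit Types f g h : I -> T -> R[i].

(** One component of a random vector (a family indexed by [unit]) is
    compared with one row of a rational matrix on the circle; both are finite
    families of functions. *)
Definition fam_inner f g : R[i] := \sum_l cintegral mu D (fun x => f l x * conjc (g l x)).
Definition fam_sqnorm f : R := \sum_l fine (sqnorm mu D (f l)).
Definition fam_l2 f := forall l, l2 mu D (f l).

Lemma fam_sqnorm_ge0 f : 0 <= fam_sqnorm f.
Proof. by apply: sumr_ge0 => l _; rewrite fine_ge0 // sqnorm_ge0. Qed.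
Lemma fam_l2B f g : fam_l2 f -> fam_l2 g -> fam_l2 (fun l x => f l x - g l x).
Proof. by move=> lf lg l; apply: l2B. Qed.
Lemma fam_l2Z c f : fam_l2 f -> fam_l2 (fun l x => c * f l x).
Proof. by move=> lf l; apply: l2Z. Qed.
Lemma fam_inner_sq f : fam_l2 f -> fam_inner f f = (fam_sqnorm f)%:C.
Proof. by move=> lf; rewrite /fam_inner /fam_sqnorm rmorph_sum; apply: eq_bigr => l _;
  exact: cintegral_sqE. Qed.
Lemma fam_innerDl f g h : fam_l2 f -> fam_l2 g -> fam_l2 h ->
  fam_inner (fun l x => f l x + g l x) h = fam_inner f h + fam_inner g h.
Proof.
move=> lf lg lh; rewrite /fam_inner -big_split; apply: eq_bigr => l _ /=.
rewrite -cintegralD //; [|exact: l2M_cintegrable..].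
by apply: cintegral_eq => x _; rewrite mulrDl.
Qed.
Lemma fam_innerZl c f h : fam_l2 f -> fam_l2 h ->
  fam_inner (fun l x => c * f l x) h = c * fam_inner f h.
Proof.
move=> lf lh; rewrite /fam_inner mulr_sumr; apply: eq_bigr => l _ /=.
rewrite -cintegralZ //; last exact: l2M_cintegrable.
by apply: cintegral_eq => x _; rewrite mulrA.
Qed.
Lemma fam_innerJ f h : fam_l2 f -> fam_l2 h -> fam_inner h f = conjc (fam_inner f h).
Proof.
move=> lf lh; rewrite /fam_inner rmorph_sum; apply: eq_bigr => l _ /=.
apply: etrans (cintegralJ mD (l2M_cintegrable mD (lf l) (lh l))).
by apply: cintegral_eq => x _; rewrite rmorphM /= conjcK mulrC.
Qed.
Lemma fam_innerBl f g h : fam_l2 f -> fam_l2 g -> fam_l2 h ->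
  fam_inner (fun l x => f l x - g l x) h = fam_inner f h - fam_inner g h.
Proof.
move=> lf lg lh; rewrite -mulN1r -fam_innerZl // -fam_innerDl //; last exact: fam_l2Z.
by rewrite /fam_inner; apply: eq_bigr => l _; apply: cintegral_eq => x _; rewrite mulN1r.
Qed.
Lemma fam_innerBr f g h : fam_l2 f -> fam_l2 g -> fam_l2 h ->
  fam_inner h (fun l x => f l x - g l x) = fam_inner h f - fam_inner h g.
Proof.
move=> lf lg lh; rewrite fam_innerJ ?fam_innerBl ?rmorphB /=; do ?by [|exact: fam_l2B].
by rewrite -!fam_innerJ.
Qed.
Lemma fam_innerZr c f h : fam_l2 f -> fam_l2 h ->
  fam_inner h (fun l x => c * f l x) = conjc c * fam_inner h f.
Proof. by move=> lf lh; rewrite fam_innerJ ?fam_innerZl ?rmorphM /= -?fam_innerJ //;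
  exact: fam_l2Z. Qed.

(** The squared norm of f - t <f, g> g is a real quadratic in t.
    Take t = 1 / <g, g>; if <g, g> = 0, a large t forces <f, g> = 0. *)
Lemma cauchy_schwarz f g : fam_l2 f -> fam_l2 g ->
  sqabs (fam_inner f g) <= fam_sqnorm f * fam_sqnorm g.
Proof.
move=> lf lg.
pose F := fam_sqnorm f; pose G := fam_sqnorm g; pose A := sqabs (fam_inner f g).
have key (t : R) : 0 <= F - 2 * t * A + t ^+ 2 * A * G.
  pose c := t%:C * fam_inner f g.
  have lc := fam_l2Z c lg.
  have e : (fam_sqnorm (fun l x => f l x - c * g l x))%:C = (F - 2 * t * A + t ^+ 2 * A * G)%:C.
    rewrite -fam_inner_sq; last exact: fam_l2B.
    rewrite fam_innerBl ?fam_innerBr ?fam_innerZl ?fam_innerZr //; do ?exact: fam_l2B.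
    rewrite !fam_inner_sq // [fam_inner g f]fam_innerJ // /c -/F -/G.
    have -> : conjc (t%:C * fam_inner f g) = t%:C * conjc (fam_inner f g).
      by apply: complexP; rewrite !ReImE /=; ring.
    by apply: complexP; rewrite /A /sqabs !ReImE /=; ring.
  by rewrite -[leRHS](complexI e) //= fam_sqnorm_ge0.
have A0 : 0 <= A by exact: sqabs_ge0.
have F0 : 0 <= F by exact: fam_sqnorm_ge0.
have : 0 <= G by exact: fam_sqnorm_ge0.
rewrite -/F -/G -/A le_eqVlt => /orP[/eqP G0|G0].
  rewrite -G0 mulr0 leNgt; apply/negP => Apos.
  have := key ((F + 1) / (2 * A)); rewrite -G0 mulr0 addr0.
  have -> : 2 * ((F + 1) / (2 * A)) * A = F + 1 by field; rewrite gt_eqF.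
  lra.
have := key G^-1.
have -> : F - 2 * G^-1 * A + G^-1 ^+ 2 * A * G = (F * G - A) / G.
  by field; rewrite gt_eqF.
by rewrite pmulr_lge0 ?invr_gt0 // subr_ge0.
Qed.

(** With increments df and dg, the difference of the inner
    products is <df, g> + <f, dg> - <df, dg>, and each term is small by the
    Cauchy-Schwarz inequality. *)
Lemma fam_inner_continuous f g (eta : R) : fam_l2 f -> fam_l2 g -> 0 < eta ->
  exists2 eps : R, 0 < eps & forall f' g', fam_l2 f' -> fam_l2 g' ->
    fam_sqnorm (fun l x => f l x - f' l x) < eps -> fam_sqnorm (fun l x => g l x - g' l x) < eps ->
    sqabs (fam_inner f g - fam_inner f' g') < eta.
Proof.
move=> lf lg eta0.
(* the three terms are bounded by eps * M and enter with weights 2, 4 and 4 *)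
pose M := fam_sqnorm f + fam_sqnorm g + 1.
have M1 : 1 <= M by have := fam_sqnorm_ge0 f; have := fam_sqnorm_ge0 g; rewrite /M; lra.
have e0 : 0 < Num.min 1 (eta / (12 * M)).
  by rewrite lt_min ltr01 divr_gt0 //; lra.
exists (Num.min 1 (eta / (12 * M))) => // f' g' lf' lg'.
set eps := Num.min _ _; move=> ff' gg'.
have lF := fam_l2B lf lf'; have lG := fam_l2B lg lg'.
set a := fam_inner (fun l x => f l x - f' l x) g.
set b := fam_inner f (fun l x => g l x - g' l x).
set c := fam_inner (fun l x => f l x - f' l x) (fun l x => g l x - g' l x).
have -> : fam_inner f g - fam_inner f' g' = a + (b - c).
  by rewrite /a /b /c fam_innerBl ?fam_innerBr ?fam_innerBl //; ring.
have ea : sqabs a <= eps * M.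
  apply: le_trans (cauchy_schwarz lF lg) _.
  apply: ler_pM; rewrite ?fam_sqnorm_ge0 ?(ltW ff') //.
  by have := fam_sqnorm_ge0 f; rewrite /M; lra.
have eb : sqabs b <= eps * M.
  apply: le_trans (cauchy_schwarz lf lG) _; rewrite mulrC.
  apply: ler_pM; rewrite ?fam_sqnorm_ge0 ?(ltW gg') //.
  by have := fam_sqnorm_ge0 g; rewrite /M; lra.
have ec : sqabs c <= eps * M.
  apply: le_trans (cauchy_schwarz lF lG) _.
  apply: ler_pM; rewrite ?fam_sqnorm_ge0 ?(ltW ff') //.
  have : eps <= 1 by rewrite /eps ge_min lexx.
  lra.
have e1 := sqabsD_le a (b - c); have e2 := sqabsB_le b c.
have e3 : eps * (12 * M) <= eta.
  by rewrite -ler_pdivlMr; [rewrite /eps ge_min lexx orbT|lra].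
have : 0 < eps * M by rewrite mulr_gt0 //; lra.
have e4 : eps * (12 * M) = 12 * (eps * M) by ring.
by rewrite e4 in e3; move: e1 e2 e3 ea eb ec; lra.
Qed.
End Vip.

(** * Limits of inner products, completeness of L2 *)

Section Transfer.
Context (R : realType) d (T : measurableType d) d' (T' : measurableType d').
Variables (mu : {measure set T -> \bar R}) (D : set T).
Variables (mu' : {measure set T' -> \bar R}) (D' : set T').
Hypothesis mD : measurable D.
Hypothesis mD' : measurable D'.
Variables I I' : finType.

Lemma sqabs_small_eq0 (z : R[i]) : (forall eta : R, 0 < eta -> sqabs z < eta) -> z = 0.
Proof.
move=> H; apply/eqP; rewrite -sqabs_eq0 eq_le sqabs_ge0 andbT leNgt.
by apply/negP => /H; rewrite ltxx.
Qed.

(** An isometry up to the factor kap extends to limits; it carries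
    the equality of inner products from Laurent polynomials to all filters. *)
Lemma fam_inner_transfer (kap : R) (f g : I -> T -> R[i]) (f' g' : I' -> T' -> R[i]) :
  fam_l2 mu D f -> fam_l2 mu D g -> fam_l2 mu' D' f' -> fam_l2 mu' D' g' ->
  (forall eps : R, 0 < eps -> exists fn gn fn' gn',
    [/\ [/\ fam_l2 mu D fn, fam_l2 mu D gn, fam_l2 mu' D' fn' & fam_l2 mu' D' gn'],
        fam_sqnorm mu D (fun l x => f l x - fn l x) < eps /\
        fam_sqnorm mu D (fun l x => g l x - gn l x) < eps,
        fam_sqnorm mu' D' (fun l x => f' l x - fn' l x) < eps /\
        fam_sqnorm mu' D' (fun l x => g' l x - gn' l x) < eps &
        fam_inner mu D fn gn = kap%:C * fam_inner mu' D' fn' gn']) ->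
  fam_inner mu D f g = kap%:C * fam_inner mu' D' f' g'.
Proof.
move=> lf lg lf' lg' H; apply/subr0_eq/sqabs_small_eq0 => eta eta0.
have K0 : 0 < 4 * (1 + kap ^+ 2) by have := sqr_ge0 kap; lra.
have h0 : 0 < eta / (4 * (1 + kap ^+ 2)) by rewrite divr_gt0.
have [e1 e10 H1] := fam_inner_continuous mD lf lg h0.
have [e2 e20 H2] := fam_inner_continuous mD' lf' lg' h0.
have e0 : 0 < Num.min e1 e2 by rewrite lt_min e10.
have [fn [gn [fn' [gn' [[lfn lgn lfn' lgn'] [a b] [c e] E]]]]] := H _ e0.
rewrite !lt_min in a b c e.
move/andP: a b c e => [a _] /andP[b _] /andP[_ c] /andP[_ e].
have X1 := H1 _ _ lfn lgn a b; have X2 := H2 _ _ lfn' lgn' c e.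
have -> : fam_inner mu D f g - kap%:C * fam_inner mu' D' f' g' =
  (fam_inner mu D f g - fam_inner mu D fn gn) - kap%:C * (fam_inner mu' D' f' g'
    - fam_inner mu' D' fn' gn').
  by rewrite mulrBr -E; ring.
apply: le_lt_trans (sqabsB_le _ _) _; rewrite sqabsM sqabsC.
set h := eta / _ in X1 X2 *.
have -> : eta = 4 * h + 4 * (kap ^+ 2 * h).
  by rewrite /h; field; rewrite gt_eqF //; have := sqr_ge0 kap; lra.
have X3 : kap ^+ 2 * sqabs (fam_inner mu' D' f' g' - fam_inner mu' D' fn' gn') <= kap ^+ 2 * h.
  by rewrite ler_wpM2l ?sqr_ge0 // ltW.
have X4 : 0 <= kap ^+ 2 * h by rewrite mulr_ge0 ?sqr_ge0 // ltW.
by move: X1 X3 X4 h0; rewrite -/h; lra.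
Qed.

(** Reduces an orthogonality relation to finite sums: it passes to
    limits in mean square. *)
Lemma orth_closed (f g : T -> R[i]) : l2 mu D f -> l2 mu D g ->
  (forall eps : R, 0 < eps -> exists gn, [/\ l2 mu D gn,
    (sqnorm mu D (fun x => g x - gn x)%R < eps%:E)%E &
    cintegral mu D (fun x => f x * conjc (gn x)) = 0]) ->
  cintegral mu D (fun x => f x * conjc (g x)) = 0.
Proof.
move=> lf lg H; apply: sqabs_small_eq0 => eta eta0.
have := @fam_inner_continuous _ _ _ mu D mD unit (fun=> f) (fun=> g) eta
  (fun=> lf) (fun=> lg) eta0.
case=> eps eps0 H1.
have [gn [lgn gg E]] := H _ eps0.
have := H1 (fun=> f) (fun=> gn) (fun=> lf) (fun=> lgn).
have bu (F : unit -> R) : \sum_l F l = F tt.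
  by rewrite (big_pred1 tt) // => -[].
have bc (F : unit -> R[i]) : \sum_l F l = F tt.
  by rewrite (big_pred1 tt) // => -[].
rewrite /fam_inner /fam_sqnorm !bu !bc E subr0; apply.
  rewrite (_ : sqnorm _ _ _ = 0) //= /sqnorm integral0_eq // => x _.
  by rewrite subrr sqabs0.
by rewrite -lte_fin fineK // (@l2_fin _ _ _ mu D) //; exact: l2B.
Qed.
End Transfer.

Section RieszFischer.
Context d (T : measurableType d) (R : realType).
Variables (mu : {measure set T -> \bar R}) (D : set T).
Hypothesis mD : measurable D.

Lemma cvgn_fast (u : nat -> R) (C : R) :
  (forall n, `|u n.+1 - u n| <= C * 2^-1 ^+ n) -> cvgn u.
Proof.
move=> H.
have -> : u = (fun n => u 0%N + series (telescope u) n).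
  by apply/funext => n; exact: eq_sum_telescope.
have C0 : 0 <= C by have := H 0%N; rewrite expr0 mulr1; apply: le_trans.
apply: is_cvgD; first exact: is_cvg_cst.
apply: normed_cvg; apply: (@series_le_cvg _ _ (geometric C 2^-1)).
- by move=> n; exact: normr_ge0.
- by move=> n; rewrite /geometric /= mulr_ge0 // exprn_ge0 // invr_ge0.
- by move=> n; exact: H.
- by apply: is_cvg_geometric_series; rewrite ger0_norm // invf_lt1 // ltr1n.
Qed.

(** A sequence that is Cauchy at this rate converges almost
    everywhere, because the sum of 4^n (u_(n+1) - u_n)^2 has integral at most
    2; Fatou's lemma gives the rate of convergence to the limit. *)
Lemma riesz_fischer_real (u : nat -> T -> R) :
  (forall n, measurable_fun D (u n)) ->
  (forall n k, (n <= k)%N ->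
    (\int[mu]_(x in D) ((u k x - u n x) ^+ 2)%:E <= (8^-1 ^+ n)%:E)%E) ->
  exists2 v : T -> R, measurable_fun D v & forall n,
    (\int[mu]_(x in D) ((v x - u n x) ^+ 2)%:E <= (8^-1 ^+ n)%:E)%E.
Proof.
move=> mu_ H.
have mean_sq (f g : T -> R) : measurable_fun D f -> measurable_fun D g ->
    measurable_fun D (fun x => ((f x - g x) ^+ 2)%:E).
  move=> mf mg; apply/measurable_EFinP; apply: measurable_funX.
  exact: measurable_funB.
pose h n x := ((4 ^+ n)%:E * ((u n.+1 x - u n x) ^+ 2)%:E)%E.
have h0 n x : D x -> (0 <= h n x)%E.
  by move=> _; rewrite /h -EFinM lee_fin mulr_ge0 ?sqr_ge0 ?exprn_ge0.
have mh n : measurable_fun D (h n).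
  by apply: measurable_funeM; exact: mean_sq.
pose S x := (\sum_(0 <= n <oo) h n x)%E.
have mS : measurable_fun D S.
  by apply: ge0_emeasurable_sum => // n x Dx _; exact: h0.
have iS : (\int[mu]_(x in D) S x <= 2%:E)%E.
  rewrite integral_nneseries //.
  apply: lime_le.
    by apply: is_cvg_nneseries => n _ _; apply: integral_ge0 => x Dx; exact: h0.
  apply: nearW => n.
  apply: (@le_trans _ _ (\sum_(0 <= i < n) (2^-1 ^+ i)%:E)%E).
    apply: lee_sum => i _.
    rewrite ge0_integralZl ?lee_fin ?exprn_ge0 //; last first.
      by move=> x _; rewrite lee_fin sqr_ge0.
      exact: mean_sq.
    apply: (@le_trans _ _ ((4 ^+ i)%:E * (8^-1 ^+ i)%:E)%E).
      by apply: lee_wpmul2l; [rewrite lee_fin exprn_ge0|exact: H].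
    rewrite -EFinM lee_fin -exprMn (_ : 4 * 8^-1 = 2^-1) //; lra.
  rewrite sumEFin lee_fin.
  have -> : \sum_(0 <= i < n) 2^-1 ^+ i = 2 - 2 * 2^-1 ^+ n :> R.
    elim: n => [|n IH]; first by rewrite big_geq // expr0; ring.
    by rewrite big_nat_recr //= IH exprS; field.
  by have := @exprn_ge0 R n 2^-1; rewrite invr_ge0 ler0n => /(_ isT); lra.
have intS : mu.-integrable D S.
  apply/integrableP; split => //.
  have -> : (\int[mu]_(x in D) `|S x| = \int[mu]_(x in D) S x)%E.
    apply: eq_integral => x /set_mem Dx; rewrite gee0_abs //.
    by apply: nneseries_ge0 => n _ _; exact: h0.
  exact: le_lt_trans iS (ltry _).
have aeS := integrable_ae mD intS.
(* a superior limit, which is measurable even where the sequence diverges *)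
pose v x := fine (limn_esup (fun n => (u n x)%:E)).
have mv : measurable_fun D v.
  apply: (@measurableT_comp _ _ _ _ _ _ fine) => //.
  by apply: measurable_fun_limn_esup => n; exact/measurable_EFinP.
have aev : \forall x \ae mu, D x -> u n x @[n --> \oo] --> v x.
  apply: filterS aeS => x Sx Dx; have {}Sx := Sx Dx.
  have cu : cvgn (fun n => u n x).
    apply: (@cvgn_fast _ (1 + fine (S x))) => n.
    have hS : (h n x <= S x)%E.
      have := @nneseries_lim_ge _ (fun n => h n x) xpredT 0 n.+1
        (fun n _ _ => h0 n x Dx).
      rewrite big_nat_recr //=; apply: le_trans; rewrite leeDr //.
      by apply: sume_ge0 => i _; exact: h0.
    have S0 : 0 <= fine (S x) by apply: fine_ge0; apply: nneseries_ge0 => i _ _; exact: h0.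
    move: hS; rewrite -(fineK Sx) /h -EFinM lee_fin => hS.
    rewrite -ler_pdivrMr ?exprn_gt0 ?invr_gt0 // exprVn invrK.
    rewrite -(@ler_pXn2r _ 2) ?nnegrE ?mulr_ge0 ?exprn_ge0 //; last lra.
    rewrite exprMn -normrX ger0_norm ?sqr_ge0 // -exprM mulnC exprM.
    rewrite (_ : 2 ^+ 2 = 4); last ring.
    by move: hS; rewrite mulrC; nra.
  have [l cl] : exists l : R, u n x @[n --> \oo] --> l by exists (limn (fun n => u n x)).
  suff -> : v x = l by [].
  have /cvg_limn_einf_sup [_] : (u n x)%:E @[n --> \oo] --> l%:E.
    by apply: cvg_EFin; [exact: nearW|exact: cl].
  by rewrite /v => ->.
exists v => // n.
apply: (@le_trans _ _ (\int[mu]_(x in D)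
    limn_einf (fun k => ((u k x - u n x) ^+ 2)%:E))%E).
  apply: ae_ge0_le_integral => //.
  - by move=> x _; rewrite lee_fin sqr_ge0.
  - exact: mean_sq.
  - move=> x _; rewrite limn_einf_lim; apply: lime_ge; first exact: is_cvg_einfs.
    apply: nearW => k; apply: le_ereal_inf_tmp => _ [j _ <-].
    by rewrite lee_fin sqr_ge0.
  - have -> : (fun x => limn_einf (fun k => ((u k x - u n x) ^+ 2)%:E)) =
        (fun x => - limn_esup (fun k => - ((u k x - u n x) ^+ 2)%:E))%E.
      by apply/funext => x;
        rewrite (limn_esupN (fun k => ((u k x - u n x) ^+ 2)%:E)) oppeK.
    apply: measurableT_comp => //; apply: measurable_fun_limn_esup => k.
    by apply: measurableT_comp => //; exact: mean_sq.
  - apply: filterS aev => x cx Dx.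
    have /cvg_limn_einf_sup [-> _] // :
      (((u k x - u n x) ^+ 2)%:E @[k --> \oo] --> ((v x - u n x) ^+ 2)%:E)%E.
    apply: cvg_EFin; first exact: nearW.
    have cd : u k x - u n x @[k --> \oo] --> v x - u n x.
      exact: (cvgB (cx Dx) (cvg_cst _)).
    have -> : fine \o (fun k => ((u k x - u n x) ^+ 2)%:E) =
        (fun k => (u k x - u n x) * (u k x - u n x)).
      by apply/funext => k; rewrite /= expr2.
    by rewrite expr2; exact: cvgM.
have sq0 k x : D x -> (0 <= ((u k x - u n x) ^+ 2)%:E)%E.
  by rewrite lee_fin sqr_ge0.
apply: le_trans (fatou mu mD (fun k => mean_sq _ _ (mu_ k) (mu_ n)) sq0) _.
rewrite limn_einf_lim; apply: lime_le; first exact: is_cvg_einfs.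
apply: nearW => k.
apply: (@le_trans _ _ (\int[mu]_(x in D) ((u (maxn k n) x - u n x) ^+ 2)%:E)%E).
  by apply: ereal_inf_lbound; exists (maxn k n) => //=; rewrite leq_maxl.
by apply: H; rewrite leq_maxr.
Qed.
End RieszFischer.

(** * Integration on the unit circle *)

Section AeOn.
Context d (T : measurableType d) (R : realType).
Variables (mu : {measure set T -> \bar R}) (D : set T).
Implicit Types Q : T -> Prop.
Definition ae_on Q := \forall x \ae mu, D x -> Q x.
Lemma ae_onS Q1 Q2 : (forall x, D x -> Q1 x -> Q2 x) -> ae_on Q1 -> ae_on Q2.
Proof. by rewrite /ae_on => H h; apply: filterS h => x H1 Dx; exact: H (H1 Dx). Qed.
Lemma ae_onI Q1 Q2 : ae_on Q1 -> ae_on Q2 -> ae_on (fun x => Q1 x /\ Q2 x).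
Proof.
by rewrite /ae_on => h1 h2; apply: filterS2 h1 h2 => x H1 H2 Dx; split; [exact: H1|exact: H2].
Qed.
Lemma ae_on_forall (I : finType) (Q : I -> T -> Prop) :
  (forall i, ae_on (Q i)) -> ae_on (fun x => forall i, Q i x).
Proof.
move=> H; have h : \forall x \ae mu, forall i, D x -> Q i x by exact: filter_forall.
by rewrite /ae_on; apply: filterS h => x H1 Dx i; exact: H1.
Qed.
End AeOn.

Local Notation mu := lebesgue_measure.
Local Notation bdsqnorm f := (sqnorm mu circle (boundary f)).

Section Circle.
Context {R : realType}.
Implicit Types (th a b : R) (k : int).

Lemma expi0 : expi (0 : R) = 1.
Proof. by apply: complexP; rewrite /= ?cos0 ?sin0. Qed.
Lemma expiD a b : expi (a + b) = expi a * expi b.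
Proof. by apply: complexP; rewrite ReImE /= ?cosD ?sinD; ring. Qed.
Lemma expiJ a : conjc (expi a) = expi (- a).
Proof. by apply: complexP; rewrite /= ?cosN ?sinN. Qed.
Lemma sqabs_expi a : sqabs (expi a) = 1.
Proof. by rewrite /sqabs /= cos2Dsin2. Qed.
Lemma expi_neq0 a : expi a != 0.
Proof. by rewrite -sqabs_eq0 sqabs_expi oner_eq0. Qed.
Lemma expiV a : (expi a)^-1 = expi (- a).
Proof.
apply: (mulIf (expi_neq0 a)); rewrite mulVf ?expi_neq0 // -expiD addNr.
by rewrite expi0.
Qed.
Lemma expi_natX a (n : nat) : expi a ^+ n = expi (n%:R * a).
Proof.
elim: n => [|n IH]; first by rewrite expr0 mul0r expi0.
by rewrite exprS IH -expiD -[in RHS]natr1 mulrDl mul1r addrC.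
Qed.
Lemma expi_intX a k : expi a ^ k = expi (k%:~R * a).
Proof.
case: k => n; first by rewrite -exprnP expi_natX.
by rewrite NegzE -exprnN expi_natX expiV mulrNz mulNr.
Qed.

Lemma measurable_circle : measurable (@circle R : set (measurableTypeR R)).
Proof. exact: measurable_itv. Qed.
Hint Resolve measurable_circle : core.

Lemma lebesgue_circle : mu (@circle R) = (pi *+ 2)%:E.
Proof.
rewrite /circle lebesgue_measure_itv /= lte_fin.
have := @pi_gt0 R => p0; rewrite ifT; last lra.
by rewrite -EFinB opprK mulr2n.
Qed.

Lemma circle_integralE (f : R -> R[i]) :
  circle_integral f = ((pi *+ 2)^-1)%:C * cintegral mu (@circle R) f.
Proof. by apply: complexP; rewrite ReImE /=; ring. Qed.

Lemma cmeas_expi (c : R) (D : set R) : cmeas D (fun th => expi (c * th)).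
Proof.
have m1 : measurable_fun D (fun th : R => c * th).
  exact: (measurable_funS measurableT _ (mulrl_measurable _)).
split => /=.
  apply: (measurableT_comp _ m1).
  by apply: continuous_measurable_fun; exact: continuous_cos.
apply: (measurableT_comp _ m1).
by apply: continuous_measurable_fun; exact: continuous_sin.
Qed.

Lemma sqnorm_bounded (f : R -> R[i]) (B : R) : 0 <= B -> cmeas circle f ->
  (forall th, circle th -> sqabs (f th) <= B) ->
  (sqnorm mu circle f <= (B * (pi *+ 2))%:E)%E.
Proof.
move=> B0 mf H; rewrite EFinM -lebesgue_circle.
have /= <- := @integral_cst _ _ _ mu _ measurable_circle B%:E.
apply: ge0_le_integral => //.
- by move=> x _; rewrite lee_fin sqabs_ge0.
- exact: cmeas_sqe.
Qed.
Lemma l2_bounded (f : R -> R[i]) (B : R) : cmeas circle f ->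
  (forall th, circle th -> sqabs (f th) <= B) -> l2 mu circle f.
Proof.
move=> mf H; split => //.
have p0 := @pi_gt0 R.
have B0 : 0 <= B.
  by apply: le_trans (sqabs_ge0 _) (H 0 _); rewrite /circle /= in_itv /=; lra.
exact: le_lt_trans (sqnorm_bounded B0 mf H) (ltry _).
Qed.
Lemma l2_expi (c : R) : l2 mu circle (fun th => expi (c * th)).
Proof. by apply: l2_bounded (cmeas_expi _ _) _ => th _; rewrite sqabs_expi. Qed.

Lemma FTC_circle (f F : R -> R) : continuous f ->
  (forall x : R, is_derive x (1 : R) F (f x)) ->
  Rintegral mu circle f = F pi - F (- pi).
Proof.
move=> cf dF; have p0 := @pi_gt0 R.
have cF : continuous F.
  by move=> x; apply/differentiable_continuous/derivable1_diffP; case: (dF x).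
rewrite /Rintegral /circle (@continuous_FTC2 _ f F) //.
- lra.
- exact: continuous_subspaceT.
- split; first by move=> x _; case: (dF x).
    by apply: cvg_at_right_filter; exact: cF.
  by apply: cvg_at_left_filter; exact: cF.
- by move=> x _; rewrite derive1E; case: (dF x).
Qed.

Lemma sin_natpi (n : nat) : sin (n%:R * pi) = 0 :> R.
Proof.
elim: n => [|n IH]; first by rewrite mul0r sin0.
by rewrite -natr1 mulrDl mul1r sinDpi IH oppr0.
Qed.
Lemma sin_intpi k : sin (k%:~R * pi) = 0 :> R.
Proof.
by case: k => n; [exact: sin_natpi|rewrite NegzE mulrNz mulNr sinN sin_natpi oppr0].
Qed.

Lemma cintegral_expi k : cintegral mu (@circle R) (fun th => expi (k%:~R * th)) =
  if k == 0 then (pi *+ 2)%:C else 0.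
Proof.
have [->|k0] := eqVneq k 0.
  under cintegral_eq do rewrite mul0r expi0.
  apply: complexP => /=.
    by rewrite Rintegral_cst // mul1r -[RHS]/(fine (pi *+ 2)%:E) -lebesgue_circle.
  by rewrite Rintegral_cst // mul0r.
have c0 : (k%:~R : R) != 0 by rewrite intr_eq0.
set c : R := k%:~R in c0 *.
have cont (g : R -> R) : continuous g -> continuous (fun th => g (c * th)).
  move=> cg x; apply: (@continuous_comp _ _ _ (fun th => c * th) g); last exact: cg.
  by apply: mulrl_continuous.
apply: complexP => /=.
  have dF (x : R) : is_derive x (1 : R) (fun th : R => c^-1 * sin (c * th)) (cos (c * x)).
    by apply: trigger_derive; rewrite /GRing.scale /=; field.
  rewrite (FTC_circle (cont _ (@continuous_cos R)) dF).
  by rewrite mulrN sinN sin_intpi oppr0 subrr.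
have dF (x : R) : is_derive x (1 : R) (fun th : R => - c^-1 * cos (c * th)) (sin (c * x)).
  by apply: trigger_derive; rewrite /GRing.scale /=; field.
rewrite (FTC_circle (cont _ (@continuous_sin R)) dF).
by rewrite mulrN cosN subrr.
Qed.

Definition ae_circle (Q : R -> Prop) := ae_on mu circle Q.
Lemma ae_circle_false : ~ ae_circle (fun=> False).
Proof.
move=> [N [mN N0 sub]].
have : (mu (@circle R) <= mu N)%E.
  by apply: le_measure; rewrite ?inE // => th ct; apply: sub => /(_ ct).
rewrite N0 lebesgue_circle lee_fin; have := @pi_gt0 R; lra.
Qed.
(** On [-pi, pi] an angle is plus or minus the arc cosine of its
    cosine, so finitely many points of the circle come from finitely many
    angles. *)
Lemma ae_expi_notin (s : seq R[i]) : ae_circle (fun th => expi th \notin s).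
Proof.
have p0 := @pi_gt0 R.
set l := [seq acos (complex.Re c) | c <- s] ++ [seq - acos (complex.Re c) | c <- s].
exists [set` l]; split.
- apply: countable_measurable; first by move=> t; exact: measurable_set1.
  exact/finite_set_countable/finite_seq.
- by apply: countable_lebesgue_measure0; exact/finite_set_countable/finite_seq.
- move=> th /= /not_implyP [hc /negP]; rewrite negbK => hs.
  move: hc; rewrite /circle /= in_itv /= => /andP[h1 h2].
  rewrite mem_cat; have [t0|t0] := leP 0 th.
    apply/orP; left; apply/mapP; exists (expi th) => //=.
    by rewrite cosK // in_itv /= t0.
  apply/orP; right; apply/mapP; exists (expi th) => //=.
  by rewrite cosKN ?opprK // h1 ltW.
Qed.
End Circle.
#[global] Hint Resolve measurable_circle : core.

(** * Rational functions: lowest terms and values *)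

Section Norms.
Context {R : realType}.
Implicit Types z : R[i].
Lemma norm_sqabs z : `|z| ^+ 2 = (sqabs z)%:C.
Proof. by rewrite -add_Re2_Im2. Qed.
Lemma norm_lt1 z : (`|z| < 1) = (sqabs z < 1).
Proof. by rewrite -(@expr_lt1 _ 2) ?normr_ge0 // norm_sqabs -[1]/(1%:C) ltcR. Qed.
Lemma norm_le1 z : (`|z| <= 1) = (sqabs z <= 1).
Proof. by rewrite -(@expr_le1 _ 2) ?normr_ge0 // norm_sqabs -[1]/(1%:C) lecR. Qed.
End Norms.

Section RatC.
Context {R : realType}.
Local Notation F := (ratfun R).
Lemma ratC_zmod : zmod_morphism (@ratC R).
Proof. by move=> a b; rewrite /ratC !rmorphB. Qed.
Lemma ratC_monoid : monoid_morphism (@ratC R).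
Proof. by split => [|a b]; rewrite /ratC ?rmorph1 // !rmorphM. Qed.
HB.instance Definition _ := GRing.isZmodMorphism.Build R[i] F (@ratC R) ratC_zmod.
HB.instance Definition _ := GRing.isMonoidMorphism.Build R[i] F (@ratC R) ratC_monoid.
End RatC.

Section Rational.
Context {R : realType}.
Local Notation C := R[i].
Local Notation P := {poly R[i]}.
Local Notation F := (ratfun R).
Implicit Types (f g : F) (p q : P) (c b : C).

Lemma ratX_neq0 : (ratX : F) != 0.
Proof. by rewrite /ratX tofrac_eq0 polyX_eq0. Qed.

(** The only place where the construction of the field of fractions
    as a quotient is opened. *)
Lemma frac_repr f :
  f = tofrac (fraction.frac (repr f)).1 / tofrac (fraction.frac (repr f)).2 /\
  (fraction.frac (repr f)).2 != 0.
Proof.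
split; last exact: denom_ratioP.
rewrite -{1}[f]reprK; case: (repr f) => [[n d] /= d0].
have d0' : tofrac d != 0 :> F by rewrite tofrac_eq0.
apply: (mulIf d0'); rewrite mulfVK //.
unlock FracField.tofrac.
rewrite -[LHS]FracField.pi_mul; apply/eqmodP.
by rewrite /= FracField.equivfE /FracField.mulf !numden_Ratio ?oner_eq0 //= ?mulf_neq0
  ?oner_eq0 // !mulr1 mulrC.
Qed.

Lemma rden_neq0 f : rden f != 0.
Proof.
have [_ d0] := frac_repr f; rewrite /rden; set d := _.2 in d0 *.
by rewrite dvdp_div_eq0 ?dvdp_gcdr.
Qed.

Lemma rfracE f : f = tofrac (rnum f) / tofrac (rden f).
Proof.
have [e d0] := frac_repr f; rewrite {1}e /rnum /rden.
set n := (fraction.frac _).1; set d := (fraction.frac _).2; rewrite -/d in d0.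
have g0 : gcdp n d != 0 by rewrite gcdp_eq0 negb_and d0 orbT.
have g0' : tofrac (gcdp n d) != 0 :> F by rewrite tofrac_eq0.
have en : tofrac n = tofrac (n %/ gcdp n d) * tofrac (gcdp n d) :> F.
  by rewrite -tofracM divpK // dvdp_gcdl.
have ed : tofrac d = tofrac (d %/ gcdp n d) * tofrac (gcdp n d) :> F.
  by rewrite -tofracM divpK // dvdp_gcdr.
by rewrite {1}en {1}ed -mulf_div divff // mulr1.
Qed.

Lemma rcoprime f : coprimep (rnum f) (rden f).
Proof.
have [_ d0] := frac_repr f.
by apply: coprimep_div_gcd; rewrite d0 orbT.
Qed.

(** By the Gauss lemma, as numerator and denominator of f are coprime. *)
Lemma rfrac_uniq f N D : D != 0 -> f = tofrac N / tofrac D ->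
  exists2 q, N = rnum f * q & D = rden f * q.
Proof.
move=> D0 e.
have E : rnum f * D = N * rden f.
  apply/eqP; rewrite -tofrac_eq !tofracM.
  have D0' : tofrac D != 0 :> F by rewrite tofrac_eq0.
  have r0' : tofrac (rden f) != 0 :> F by rewrite tofrac_eq0 rden_neq0.
  have e1 : f * tofrac D = tofrac N by rewrite e -mulrA (mulVf D0') mulr1.
  have e2 : f * tofrac (rden f) = tofrac (rnum f) 
    by rewrite {1}[f]rfracE -mulrA (mulVf r0') mulr1.
  by rewrite -e1 -e2 mulrAC.
have /dvdpP [q eq] : rden f %| D.
  have cop : coprimep (rden f) (rnum f) by rewrite coprimep_sym rcoprime.
  by rewrite -(Gauss_dvdpr D cop) E dvdp_mull.
exists q; last by rewrite mulrC.
apply: (mulIf (rden_neq0 f)); rewrite -E eq; ring.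
Qed.

Definition reg f c := (rden f).[c] != 0.
Definition ev f c := value_at f (Some c).

(** Poles and values may be read off any representation whose denominator
    does not vanish at the point. *)
Lemma regP f N D c : D.[c] != 0 -> f = tofrac N / tofrac D ->
  reg f c /\ ev f c = N.[c] / D.[c].
Proof.
move=> Dc e; have D0 : D != 0 by apply: contraNneq Dc => ->; rewrite horner0.
have [q eN eD] := rfrac_uniq D0 e.
move: Dc; rewrite eD hornerM mulf_eq0 negb_or => /andP[rc qc].
by split=> //; rewrite eN hornerM /ev /=; field; rewrite rc qc.
Qed.
Lemma reg_poly p c : reg (tofrac p) c /\ ev (tofrac p) c = p.[c].
Proof.
have [||r e] := @regP (tofrac p) p 1 c; first by rewrite hornerC oner_eq0.
  by rewrite tofrac1 divr1.
by split=> //; rewrite e hornerC divr1.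
Qed.
Lemma regC (a : C) c : reg (ratC a) c /\ ev (ratC a) c = a.
Proof. by have [r e] := reg_poly a%:P c; rewrite e hornerC. Qed.
Lemma regX c : reg ratX c /\ ev ratX c = c.
Proof. by have [r e] := reg_poly 'X c; rewrite e hornerX. Qed.
Lemma reg0 c : reg 0 c /\ ev 0 c = 0.
Proof. by have := regC 0 c; rewrite rmorph0. Qed.
Lemma reg1 c : reg 1 c /\ ev 1 c = 1.
Proof. by have := regC 1 c; rewrite rmorph1. Qed.
Lemma regD f g c : reg f c -> reg g c -> reg (f + g) c /\ ev (f + g) c = ev f c + ev g c.
Proof.
move=> rf rg.
have [||r e] := @regP (f + g) (rnum f * rden g + rnum g * rden f) (rden f * rden g) c.
- by rewrite hornerM mulf_neq0.
- rewrite {1}[f]rfracE {1}[g]rfracE tofracD !tofracM addf_div ?tofrac_eq0 ?rden_neq0 //.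
split=> //; rewrite e /ev /= hornerD !hornerM; field.
by move: rf rg; rewrite /reg => -> ->.
Qed.
Lemma regM f g c : reg f c -> reg g c -> reg (f * g) c /\ ev (f * g) c = ev f c * ev g c.
Proof.
move=> rf rg.
have [||r e] := @regP (f * g) (rnum f * rnum g) (rden f * rden g) c.
- by rewrite hornerM mulf_neq0.
- by rewrite {1}[f]rfracE {1}[g]rfracE !tofracM mulf_div.
split=> //; rewrite e /ev /= !hornerM; field.
by move: rf rg; rewrite /reg => -> ->.
Qed.
Lemma regN f c : reg f c -> reg (- f) c /\ ev (- f) c = - ev f c.
Proof.
move=> rf; have [r e] := regC (-1) c; have [r1 e1] := regM r rf.
by move: r1 e1; rewrite e rmorphN1 !mulN1r.
Qed.
Lemma regB f g c : reg f c -> reg g c -> reg (f - g) c /\ ev (f - g) c = ev f c - ev g c.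
Proof. by move=> rf /regN [rg e]; have [r er] := regD rf rg; rewrite er e. Qed.
Lemma regV f c : reg f c -> ev f c != 0 -> reg f^-1 c /\ ev f^-1 c = (ev f c)^-1.
Proof.
move=> rf ef.
have nf : (rnum f).[c] != 0 by move: ef; rewrite /ev /= mulf_eq0 negb_or => /andP[].
have [||r e] := @regP f^-1 (rden f) (rnum f) c => //.
  by rewrite {1}[f]rfracE invfM invrK mulrC.
by split=> //; rewrite e /ev /= invfM invrK mulrC.
Qed.
Lemma reg_sum (I : Type) (s : seq I) (G : I -> F) c : (forall i, reg (G i) c) ->
  reg (\sum_(i <- s) G i) c /\ ev (\sum_(i <- s) G i) c = \sum_(i <- s) ev (G i) c.
Proof.
move=> rG; elim: s => [|i s [r e]]; first by rewrite !big_nil; exact: reg0.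
by have [r' e'] := regD (rG i) r; rewrite !big_cons e' e.
Qed.
Lemma regXn f n c : reg f c -> reg (f ^+ n) c /\ ev (f ^+ n) c = ev f c ^+ n.
Proof.
move=> rf; elim: n => [|n [r e]]; first by rewrite !expr0; exact: reg1.
by have [r' e'] := regM rf r; rewrite !exprS e' e.
Qed.

(** p(1/z).  The delay u = 1/z turns infinity into 0 and the exterior of
    the unit disc into its interior; polynomials in u are the causal Laurent
    polynomials. *)
Definition pu p : F := (map_poly ratC p).[ratX^-1].
Lemma pu_zmod : zmod_morphism pu.
Proof. by move=> p q; rewrite /pu rmorphB hornerD hornerN. Qed.
Lemma pu_monoid : monoid_morphism pu.
Proof. by split => [|p q]; rewrite /pu ?rmorph1 ?hornerC // rmorphM hornerM. Qed.
HB.instance Definition _ := GRing.isZmodMorphism.Build P F pu pu_zmod.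
HB.instance Definition _ := GRing.isMonoidMorphism.Build P F pu pu_monoid.
Lemma puC (a : C) : pu a%:P = ratC a.
Proof. by rewrite /pu map_polyC hornerC. Qed.
Lemma puX : pu 'X = ratX^-1.
Proof. by rewrite /pu map_polyX hornerX. Qed.

Lemma regXV c : c != 0 -> reg ratX^-1 c /\ ev ratX^-1 c = c^-1.
Proof. by move=> c0; have [r e] := regX c; rewrite -[in RHS]e; apply: regV; rewrite ?e. Qed.
Lemma reg_pu p c : c != 0 -> reg (pu p) c /\ ev (pu p) c = p.[c^-1].
Proof.
move=> c0; elim/poly_ind: p => [|p a [r e]].
  by rewrite rmorph0 horner0; exact: reg0.
rewrite rmorphD rmorphM /= puC puX hornerMXaddC.
have [rX eX] := regXV c0; have [r1 e1] := regM r rX; have [r2 e2] := regC a c.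
by have [r3 e3] := regD r1 r2; rewrite e3 e1 e2 e eX.
Qed.
Lemma poly_eq0_inf p : (forall c, c != 0 -> p.[c] = 0) -> p = 0.
Proof.
move=> H; apply/eqP; apply: contraT => p0.
have := @max_poly_roots _ p [seq n.+1%:R | n <- iota 0 (size p)] p0.
rewrite size_map size_iota ltnn; apply.
  by apply/allP => x /mapP [n _ ->]; apply/eqP/H; rewrite pnatr_eq0.
rewrite map_inj_uniq ?iota_uniq // => a b /eqP.
by rewrite eqr_nat => /eqP [].
Qed.
Lemma pu_eq0 p : (pu p == 0) = (p == 0).
Proof.
apply/eqP/eqP => [e|->]; last by rewrite rmorph0.
apply: poly_eq0_inf => c c0; have [_] := reg_pu p (c := c^-1) (invr_neq0 c0).
by rewrite invrK e => <-; have [_ ->] := reg0 c^-1.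
Qed.

(** The polynomial X^k p(1/X), which exchanges the variables z and 1/z. *)
Definition revp (k : nat) p : P := \poly_(i < k.+1) p`_(k - i).
Lemma revpK k p : (size p <= k.+1)%N -> revp k (revp k p) = p.
Proof.
move=> sp; apply/polyP => i; rewrite coef_poly; case: ltnP => ik.
  by rewrite coef_poly ltnS leq_subr subKn.
by rewrite nth_default // (leq_trans sp).
Qed.
Lemma pu_rev k p : (size p <= k.+1)%N -> pu p * ratX ^+ k = tofrac (revp k p).
Proof.
move=> sp; rewrite /pu (horner_coef_wide _ (n := k.+1)); last first.
  by rewrite size_map_poly.
rewrite mulr_suml /revp poly_def rmorph_sum /= (reindex_inj rev_ord_inj) /=.
apply: eq_bigr => i _; rewrite subSS coef_map /= -mul_polyC tofracM -/(ratC _).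
have ik : (i <= k)%N by rewrite -ltnS.
rewrite -mulrA; congr (_ * _).
rewrite -[X in ratX ^+ X](subnK ik) exprD mulrA -exprMn mulVf ?ratX_neq0 // expr1n mul1r.
by rewrite tofracXn.
Qed.
Lemma tofrac_rev k p : (size p <= k.+1)%N -> tofrac p = pu (revp k p) * ratX ^+ k.
Proof.
move=> sp; rewrite pu_rev ?revpK // /revp; exact: size_poly.
Qed.
Lemma size_revp k p : (size (revp k p) <= k.+1)%N.
Proof. exact: size_poly. Qed.
Lemma horner_rev k p c : (size p <= k.+1)%N -> c != 0 -> p.[c] = (revp k p).[c^-1] * c ^+ k.
Proof.
move=> sp c0; have [_ <-] := reg_poly p c; rewrite (tofrac_rev sp).
have [r1 e1] := reg_pu (revp k p) c0; have [rX eX] := regX c.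
have [r2 e2] := regXn k rX.
by have [_ ->] := regM r1 r2; rewrite e1 e2 eX.
Qed.

(** In the variable u = 1/z infinity becomes an ordinary point:
    analyticity there is a denominator that does not vanish at u = 0. *)
Lemma pu_rep f : exists N D, [/\ D != 0, f = pu N / pu D,
  forall c, c != 0 -> reg f c -> D.[c^-1] != 0 &
  analytic_at f None -> D.[0] != 0 /\ value_at f None = N.[0] / D.[0]].
Proof.
have r0 := rden_neq0 f.
have [an|nan] := boolP (analytic_at f None).
  pose k := (size (rden f)).-1.
  have sk : size (rden f) = k.+1 by rewrite /k prednK // lt0n size_poly_eq0.
  have s1 : (size (rnum f) <= k.+1)%N by rewrite -sk.
  have s2 : (size (rden f) <= k.+1)%N by rewrite -sk.
  exists (revp k (rnum f)), (revp k (rden f)).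
  have c0 p : (revp k p).[0] = p`_k by rewrite horner_coef0 coef_poly /= subn0.
  have l0 : (rden f)`_k != 0 by rewrite /k -lead_coefE lead_coef_eq0.
  split.
  - by apply: contraNneq l0 => e; rewrite -c0 e horner0.
  - rewrite {1}[f]rfracE (tofrac_rev s1) (tofrac_rev s2) -mulf_div divff ?mulr1 //.
    by rewrite expf_neq0 ?ratX_neq0.
  - move=> c c0' ; rewrite /reg (horner_rev s2 c0') mulf_eq0 negb_or => /andP[] //.
  - by move=> _; rewrite !c0; split.
pose k := maxn (size (rden f)) (size (rnum f)).
have s1 : (size (rnum f) <= k.+1)%N by rewrite leqW // leq_maxr.
have s2 : (size (rden f) <= k.+1)%N by rewrite leqW // leq_maxl.
exists (revp k (rnum f)), (revp k (rden f)); split => //.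
- by apply: contraNneq r0 => e; rewrite -(revpK s2) e; apply/eqP/polyP => i;
  rewrite coef_poly !coef0; case: ltnP.
- rewrite {1}[f]rfracE (tofrac_rev s1) (tofrac_rev s2) -mulf_div divff ?mulr1 //.
  by rewrite expf_neq0 ?ratX_neq0.
- move=> c c0' ; rewrite /reg (horner_rev s2 c0') mulf_eq0 negb_or => /andP[] //.
Qed.
End Rational.

(** * Stable functions, para-conjugation, boundary values *)

Section Stab.
Context {R : realType}.
Local Notation C := R[i].
Local Notation P := {poly R[i]}.
Local Notation F := (ratfun R).
Implicit Types (f g : F) (p q : P) (c b : C).

(** Stability of a scalar function in the variable u = 1/z, where the
    forbidden poles |z| >= 1 and infinity are the closed disc |u| <= 1. *)
Definition stab f := exists N D,
  (forall b, sqabs b <= 1 -> D.[b] != 0) /\ f = pu N / pu D.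
Definition bdreg f := forall c, sqabs c = 1 -> reg f c.

Lemma pu_neq0_disc p : (forall b, sqabs b <= 1 -> p.[b] != 0) -> pu p != 0.
Proof.
move=> H; rewrite pu_eq0; apply: contraTneq isT => e.
by have := H 0; rewrite sqabs0 ler01 e horner0 eqxx => /(_ isT).
Qed.
(** From left to right, D(0) <> 0 makes the denominator in the variable z
    of full degree, which excludes a pole at infinity; from right to left, a
    representation in u is obtained by [pu_rep]. *)
Lemma stabP f : stab f <-> forall a, ~~ analytic_at f a -> in_open_disc a.
Proof.
split=> [[N [D [H e]]] [c|]|H].
- move=> nr /=; rewrite norm_lt1 ltNge; apply/negP => c1.
  have c0 : c != 0 by rewrite -sqabs_eq0 gt_eqF // (lt_le_trans ltr01).
  have [r1 e1] := reg_pu N c0; have [r2 e2] := reg_pu D c0.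
  have [|r3 e3] := regV r2.
    by rewrite e2 H // sqabsV invf_le1 // (lt_le_trans ltr01).
  by case: (regM r1 r3) => r4 _; move/negP: nr; apply; rewrite e; exact: r4.
- move=> /negP nr; exfalso; apply: nr => /=.
  pose k := maxn (size N) (size D).
  have s1 : (size N <= k.+1)%N by rewrite leqW // leq_maxl.
  have s2 : (size D <= k.+1)%N by rewrite leqW // leq_maxr.
  have e' : f = tofrac (revp k N) / tofrac (revp k D).
    rewrite e -(pu_rev s1) -(pu_rev s2) -mulf_div divff ?mulr1 //.
    by rewrite expf_neq0 ?ratX_neq0.
  have Dk : (revp k D)`_k != 0.
    by rewrite coef_poly ltnSn subnn -horner_coef0 H // sqabs0 ler01.
  have sD : size (revp k D) = k.+1.
    apply/eqP; rewrite eqn_leq size_revp; rewrite ltnNge; apply/negP => le.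
    by rewrite nth_default ?eqxx in Dk.
  have D0 : revp k D != 0 by rewrite -size_poly_eq0 sD.
  have [q eN eD] := rfrac_uniq D0 e'.
  have q0 : q != 0 by apply: contraNneq D0 => q0; rewrite eD q0 mulr0.
  have [->|n0] := eqVneq (rnum f) 0; first by rewrite size_poly0.
  have := size_revp k N; rewrite -sD eN eD !size_mul ?rden_neq0 //.
  have : (0 < size q)%N by rewrite lt0n size_poly_eq0.
  case: (size q) => // n _; rewrite !addnS /=; by rewrite leq_add2r.
- have [N [D [D0 e H1 H2]]] := pu_rep f; exists N, D; split=> // b b1.
  have [->|b0] := eqVneq b 0.
    have [|/H/=//] := boolP (analytic_at f None).
    by move/H2 => [].
  rewrite -[b]invrK; apply: H1; first by rewrite invr_eq0.
  apply: contraT => nr; have /= := H (Some b^-1) nr.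
  have sb : 0 < sqabs b by rewrite lt_neqAle eq_sym sqabs_eq0 b0 sqabs_ge0.
  by rewrite norm_lt1 sqabsV invf_lt1 // ltNge b1.
Qed.
Lemma stableP m n (M : 'M[F]_(m, n)) : stable M <-> forall i j, stab (M i j).
Proof.
split=> [H i j|H a [i [j]]].
  by apply/stabP => a na; apply: H; exists i, j.
by move/stabP: (H i j); apply.
Qed.

Lemma stab_pu p : stab (pu p).
Proof.
exists p, 1; split=> [b _|]; first by rewrite hornerC oner_eq0.
by rewrite rmorph1 divr1.
Qed.
Lemma stabD f g : stab f -> stab g -> stab (f + g).
Proof.
move=> [N [D [H e]]] [N' [D' [H' e']]].
exists (N * D' + N' * D), (D * D'); split=> [b b1|].
  by rewrite hornerM mulf_neq0 ?H ?H'.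
by rewrite e e' rmorphD !rmorphM addf_div ?pu_neq0_disc.
Qed.
Lemma stabM f g : stab f -> stab g -> stab (f * g).
Proof.
move=> [N [D [H e]]] [N' [D' [H' e']]].
exists (N * N'), (D * D'); split=> [b b1|].
  by rewrite hornerM mulf_neq0 ?H ?H'.
by rewrite e e' !rmorphM mulf_div.
Qed.
Lemma stabC (a : C) : stab (ratC a).
Proof. by rewrite -puC; exact: stab_pu. Qed.
Lemma stab0 : stab 0. Proof. by rewrite -(rmorph0 (@ratC R)); exact: stabC. Qed.
Lemma stabXV : stab ratX^-1. Proof. by rewrite -puX; exact: stab_pu. Qed.
Lemma stabN f : stab f -> stab (- f).
Proof. by move=> sf; rewrite -mulN1r -(rmorphN1 (@ratC R)); apply: stabM => //; exact: stabC. Qed.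
Lemma stabB f g : stab f -> stab g -> stab (f - g).
Proof. by move=> sf sg; apply: stabD => //; exact: stabN. Qed.
Lemma stab_sum (I : Type) (s : seq I) (G : I -> F) : (forall i, stab (G i)) ->
  stab (\sum_(i <- s) G i).
Proof.
move=> sG; elim: s => [|i s IH]; first by rewrite big_nil; exact: stab0.
by rewrite big_cons; exact: stabD.
Qed.
Lemma stab_mulmx m n k (A : 'M[F]_(m, n)) (B : 'M[F]_(n, k)) :
  (forall i j, stab (A i j)) -> (forall i j, stab (B i j)) ->
  forall i j, stab ((A *m B) i j).
Proof. by move=> sA sB i j; rewrite mxE; apply: stab_sum => l; exact: stabM. Qed.

Lemma circleV c : sqabs c = 1 -> c^-1 = conjc c.
Proof.
move=> c1; have c0 : c != 0 by rewrite -sqabs_eq0 c1 oner_eq0.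
by apply: (mulfI c0); rewrite mulfV // mulcJ c1.
Qed.
Lemma reg_pu_circle p c : sqabs c = 1 -> reg (pu p) c /\ ev (pu p) c = p.[conjc c].
Proof.
move=> c1; rewrite -circleV //; apply: reg_pu.
by rewrite -sqabs_eq0 c1 oner_eq0.
Qed.

Lemma stab_bdreg f : stab f -> bdreg f.
Proof.
move=> [N [D [H ->]]] c c1.
have [r1 e1] := reg_pu_circle N c1; have [r2 e2] := reg_pu_circle D c1.
have [|r3 e3] := regV r2; first by rewrite e2 H // sqabsJ c1.
by case: (regM r1 r3).
Qed.

Local Notation pJ := (map_poly (@conjc R)).
Lemma pJ_eq0 p : (pJ p == 0) = (p == 0).
Proof. exact: map_poly_eq0. Qed.
Lemma horner_pJ p c : (pJ p).[conjc c] = conjc p.[c].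
Proof. exact: horner_map. Qed.

Lemma rstarE f : rstar f = pu (pJ (rnum f)) / pu (pJ (rden f)).
Proof. by rewrite /rstar /pu -!map_poly_comp. Qed.
(** A common factor of N and D contributes the same factor to both
    sides of the quotient, so f^* can be computed without reducing f; this is
    what makes it a morphism. *)
Lemma rstar_rep f N D : D != 0 -> f = tofrac N / tofrac D ->
  rstar f = pu (pJ N) / pu (pJ D).
Proof.
move=> D0 e; have [q -> eD] := rfrac_uniq D0 e; rewrite eD !rmorphM /= rstarE.
have q0 : q != 0 by apply: contraNneq D0 => q0; rewrite eD q0 mulr0.
by rewrite -mulf_div divff ?mulr1 // pu_eq0 pJ_eq0.
Qed.
Lemma rstarM f g : rstar (f * g) = rstar f * rstar g.
Proof.
rewrite (@rstar_rep (f * g) (rnum f * rnum g) (rden f * rden g)).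
- by rewrite !rmorphM /= !rstarE mulf_div.
- by rewrite mulf_neq0 ?rden_neq0.
- by rewrite {1}[f]rfracE {1}[g]rfracE !tofracM mulf_div.
Qed.
Lemma rstarD f g : rstar (f + g) = rstar f + rstar g.
Proof.
rewrite (@rstar_rep (f + g) (rnum f * rden g + rnum g * rden f) (rden f * rden g)).
- by rewrite !(rmorphD, rmorphM) /= !rstarE addf_div ?pu_eq0 ?pJ_eq0 ?rden_neq0.
- by rewrite mulf_neq0 ?rden_neq0.
- by rewrite {1}[f]rfracE {1}[g]rfracE tofracD !tofracM addf_div ?tofrac_eq0 ?rden_neq0.
Qed.
Lemma rstar0 : rstar (0 : F) = 0.
Proof.
by apply: (addrI (rstar 0)); rewrite -rstarD !addr0.
Qed.
Lemma rstar1 : rstar (1 : F) = 1.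
Proof.
have e : (1 : F) = tofrac 1 / tofrac 1 by rewrite tofrac1 divr1.
by rewrite (rstar_rep (oner_neq0 _) e) !rmorph1 divr1.
Qed.
Lemma rstar_sum (I : Type) (s : seq I) (G : I -> F) :
  rstar (\sum_(i <- s) G i) = \sum_(i <- s) rstar (G i).
Proof.
elim: s => [|i s IH]; first by rewrite !big_nil rstar0.
by rewrite !big_cons rstarD IH.
Qed.
Lemma mxstarM m n k (A : 'M[F]_(m, n)) (B : 'M[F]_(n, k)) :
  mxstar (A *m B) = mxstar B *m mxstar A.
Proof.
apply/matrixP => i j; rewrite !mxE rstar_sum; apply: eq_bigr => l _.
by rewrite !mxE rstarM mulrC.
Qed.
Lemma mxstar1 n : mxstar (1%:M : 'M[F]_n) = 1%:M.
Proof.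
apply/matrixP => i j; rewrite !mxE eq_sym.
by case: (i == j); rewrite ?rstar1 ?rstar0.
Qed.
Lemma reg_rstar f c : sqabs c = 1 -> reg f c -> reg (rstar f) c /\
  ev (rstar f) c = conjc (ev f c).
Proof.
move=> c1 rf; rewrite rstarE.
have [r1 e1] := reg_pu_circle (pJ (rnum f)) c1.
have [r2 e2] := reg_pu_circle (pJ (rden f)) c1.
have [|r3 e3] := regV r2; first by rewrite e2 horner_pJ conjc_eq0.
have [r4 e4] := regM r1 r3; split=> //.
by rewrite e4 e3 e1 e2 !horner_pJ /ev /= -conjc_inv -rmorphM.
Qed.

Lemma cmeasV (D : set R) (f : R -> C) : cmeas D f -> cmeas D (fun x => (f x)^-1).
Proof.
move=> mf; have mi : measurable_fun D (fun x => (sqabs (f x))^-1).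
  have -> : (fun x => (sqabs (f x))^-1) = (fun x => sqabs (f x) `^ (-1)).
    by apply/funext => x; rewrite powR_inv1 // sqabs_ge0.
  apply: (measurableT_comp (measurable_powR (-1))); exact: cmeas_sq.
have e x : (f x)^-1 = conjc (f x) * ((sqabs (f x))^-1)%:C.
  have [->|f0] := eqVneq (f x) 0; first by rewrite invr0 conjc0 mul0r.
  apply: (mulIf f0); rewrite mulVf // mulrAC [conjc _ * _]mulrC mulcJ -rmorphM /=.
  by rewrite divff ?sqabs_eq0.
apply: (@cmeas_ext _ _ _ _ (fun x => conjc (f x) * ((sqabs (f x))^-1)%:C)).
  by move=> x _; rewrite e.
apply: cmeasM; first exact: cmeasJ.
by split => //=; exact: measurable_cst.
Qed.
Lemma cmeas_poly (D : set R) p : cmeas D (fun th => p.[expi th]).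
Proof.
have m1 : cmeas D (fun th : R => expi th).
  by apply: cmeas_ext (@cmeas_expi _ 1 D) => th _; rewrite mul1r.
elim/poly_ind: p => [|p a IH].
  by apply: (@cmeas_ext _ _ _ _ (fun=> 0)); [move=> x _; rewrite horner0|exact: cmeas_cst].
apply: (@cmeas_ext _ _ _ _ (fun th => p.[expi th] * expi th + a)).
  by move=> x _; rewrite hornerMXaddC.
by apply: cmeasD; [exact: cmeasM|exact: cmeas_cst].
Qed.
Lemma cmeas_boundary (D : set R) f : cmeas D (boundary f).
Proof. by apply: cmeasM; [exact: cmeas_poly|apply: cmeasV; exact: cmeas_poly]. Qed.

Lemma poly_roots_seq p : p != 0 -> exists s : seq C, forall c, p.[c] = 0 -> c \in s.
Proof.
move=> p0; have [s e] := closed_field_poly_normal p; exists s => c.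
rewrite e hornerZ => /eqP; rewrite mulf_eq0 lead_coef_eq0 (negbTE p0) /=.
by rewrite -/(root _ c) root_prod_XsubC.
Qed.
Lemma ae_poly p : p != 0 -> ae_circle (fun th => p.[expi th] != 0).
Proof.
move=> p0; have [s H] := poly_roots_seq p0.
apply: ae_onS (ae_expi_notin s) => th _; apply: contraNneq; exact: H.
Qed.
Lemma ae_reg f : ae_circle (fun th => reg f (expi th)).
Proof. exact: ae_poly (rden_neq0 f). Qed.

(** A nonzero rational function has finitely many zeros and poles,
    and finitely many angles form a null set. *)
Lemma boundary_eq0 f : sqnorm mu circle (boundary f) = 0%E -> f = 0.
Proof.
move=> H; apply/eqP; apply: contraT => f0.
have n0 : rnum f != 0 by apply: contraNneq f0 => n0; rewrite [f]rfracE n0 rmorph0 mul0r.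
have a1 := ae_poly n0; have a2 := ae_reg f.
have ms : measurable_fun circle (fun x => (sqabs (boundary f x))%:E).
  by apply: cmeas_sqe; exact: cmeas_boundary.
have [+ _] := ae_eq_integral_abs mu measurable_circle ms.
have -> : (\int[mu]_(x in circle) `|(sqabs (boundary f x))%:E|)%E = 0%E.
  by rewrite -H; apply: eq_integral => x _; rewrite gee0_abs // lee_fin sqabs_ge0.
move=> /(_ erefl) a3; exfalso; apply: (@ae_circle_false R).
have a4 : ae_circle (fun th => (sqabs (boundary f th))%:E = 0%E) by exact: a3.
apply: ae_onS (ae_onI (ae_onI a1 a2) a4) => th _ [[h1 h2]] [] /eqP.
by rewrite sqabs_eq0 mulf_eq0 invr_eq0 (negbTE h1) (negbTE h2).
Qed.

Lemma bdregD f g : bdreg f -> bdreg g -> bdreg (f + g).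
Proof. by move=> rf rg c c1; case: (regD (rf c c1) (rg c c1)). Qed.
Lemma bdregM f g : bdreg f -> bdreg g -> bdreg (f * g).
Proof. by move=> rf rg c c1; case: (regM (rf c c1) (rg c c1)). Qed.
Lemma bdregN f : bdreg f -> bdreg (- f).
Proof. by move=> rf c c1; case: (regN (rf c c1)). Qed.
Lemma bdregB f g : bdreg f -> bdreg g -> bdreg (f - g).
Proof. by move=> rf rg; apply: bdregD => //; exact: bdregN. Qed.
Lemma bdreg_sum (I : Type) (s : seq I) (G : I -> F) : (forall i, bdreg (G i)) ->
  bdreg (\sum_(i <- s) G i).
Proof. by move=> rG c c1; case: (reg_sum s (fun i => rG i c c1)). Qed.
Lemma bdregX : bdreg ratX. Proof. by move=> c _; case: (regX c). Qed.
Lemma bdregC (a : C) : bdreg (ratC a).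
Proof. by move=> c _; case: (regC a c). Qed.
Lemma bdreg1 : bdreg 1.
Proof. by rewrite -(rmorph1 (@ratC R)); exact: bdregC. Qed.
Lemma bdreg_rstar f : bdreg f -> bdreg (rstar f).
Proof. by move=> rf c c1; case: (reg_rstar c1 (rf c c1)). Qed.
Lemma bdD f g (th : R) : bdreg f -> bdreg g ->
  boundary (f + g) th = boundary f th + boundary g th.
Proof. by move=> rf rg; case: (regD (rf _ (sqabs_expi th)) (rg _ (sqabs_expi th))). Qed.
Lemma bdM f g (th : R) : bdreg f -> bdreg g ->
  boundary (f * g) th = boundary f th * boundary g th.
Proof. by move=> rf rg; case: (regM (rf _ (sqabs_expi th)) (rg _ (sqabs_expi th))). Qed.
Lemma bdB f g (th : R) : bdreg f -> bdreg g ->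
  boundary (f - g) th = boundary f th - boundary g th.
Proof. by move=> rf rg; case: (regB (rf _ (sqabs_expi th)) (rg _ (sqabs_expi th))). Qed.
Lemma bd_sum (I : Type) (s : seq I) (G : I -> F) (th : R) : (forall i, bdreg (G i)) ->
  boundary (\sum_(i <- s) G i) th = \sum_(i <- s) boundary (G i) th.
Proof. by move=> rG; case: (reg_sum s (fun i => rG i _ (sqabs_expi th))). Qed.
Lemma bdX (th : R) : boundary ratX th = expi th.
Proof. by case: (regX (expi th)). Qed.
Lemma bdC (a : C) (th : R) : boundary (ratC a) th = a.
Proof. by case: (regC a (expi th)). Qed.
Lemma bd_rstar f (th : R) : bdreg f -> boundary (rstar f) th = conjc (boundary f th).
Proof. by move=> rf; case: (reg_rstar (sqabs_expi th) (rf _ (sqabs_expi th))). Qed.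

Definition bounded_circle (h : C -> C) :=
  exists2 B : R, 0 < B & forall c, sqabs c = 1 -> sqabs (h c) <= B.
Lemma poly_bounded p : bounded_circle (fun c => p.[c]).
Proof.
elim/poly_ind: p => [|p a [B B0 H]].
  by exists 1 => // c _; rewrite horner0 sqabs0.
exists (2 * B + 2 * sqabs a); first by have := sqabs_ge0 a; lra.
move=> c c1; rewrite hornerMXaddC; apply: le_trans (sqabsD_le _ _) _.
by rewrite sqabsM c1 mulr1; have := H c c1; lra.
Qed.
(** For |c| = 1 one has 1 - |a|^2 = Re ((c - a) conj(c + a)), so
    that the Cauchy-Schwarz inequality bounds |c - a| from below without any
    compactness argument. *)
Lemma sqabsB_lower (a c : C) : sqabs c = 1 ->
  (1 - sqabs a) ^+ 2 <= 4 * (1 + sqabs a) * sqabs (c - a).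
Proof.
case: c a => [x y] [s t]; rewrite /sqabs /= => c1.
have := sqr_ge0 (x * t - y * s).
have := sqr_ge0 ((x - s) * (x + s) + (y - t) * (y + t)).
have := sqr_ge0 ((x - s) * (y + t) - (y - t) * (x + s)).
have e : 1 - (s ^+ 2 + t ^+ 2) = (x - s) * (x + s) + (y - t) * (y + t).
  by rewrite -c1; ring.
rewrite e => h1 h2 h3.
have h4 : ((x - s) * (x + s) + (y - t) * (y + t)) ^+ 2 <=
   ((x - s) ^+ 2 + (y - t) ^+ 2) * ((x + s) ^+ 2 + (y + t) ^+ 2) by nra.
apply: le_trans h4 _; rewrite mulrC; apply: ler_wpM2r.
  by rewrite addr_ge0 // sqr_ge0.
have := sqr_ge0 (x - s); have := sqr_ge0 (y - t); nra.
Qed.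
(** The bound is the product of the bounds for the linear factors. *)
Lemma poly_lower p : (forall c, sqabs c = 1 -> p.[c] != 0) ->
  exists2 b : R, 0 < b & forall c, sqabs c = 1 -> b <= sqabs p.[c].
Proof.
have [s ->] := closed_field_poly_normal p; move: (lead_coef p) => l H.
have l0 : l != 0.
  apply: contraTneq isT => l0; have := H 1; rewrite sqabs1 l0 scale0r horner0 eqxx.
  by move=> /(_ erefl).
have {H} : forall a, a \in s -> sqabs a != 1.
  move=> a ina; apply: contraTneq isT => a1; have := H a a1.
  have : root (\prod_(z <- s) ('X - z%:P)) a by rewrite root_prod_XsubC.
  by rewrite hornerZ => /rootP ->; rewrite mulr0 eqxx.
elim: s => [_|a s IH H].
  exists (sqabs l); first by rewrite lt_neqAle eq_sym sqabs_eq0 l0 sqabs_ge0.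
  by move=> c _; rewrite big_nil hornerZ hornerC mulr1.
have [b b0 Hb] := IH (fun x xs => H x (mem_behead (s := a :: s) xs)).
have a1 : sqabs a != 1 by apply: H; rewrite mem_head.
have d0 : 0 < (1 - sqabs a) ^+ 2.
  by rewrite exprn_even_gt0 //= subr_eq0 eq_sym.
have k0 : 0 < 4 * (1 + sqabs a) by have := sqabs_ge0 a; lra.
exists (b * ((1 - sqabs a) ^+ 2 / (4 * (1 + sqabs a)))).
  by rewrite mulr_gt0 // divr_gt0.
move=> c c1; rewrite big_cons.
have -> : (l *: (('X - a%:P) * \prod_(z <- s) ('X - z%:P))).[c] =
    (l *: \prod_(z <- s) ('X - z%:P)).[c] * (c - a).
  by rewrite !hornerZ hornerM hornerXsubC; ring.
rewrite sqabsM; apply: ler_pM.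
- exact: ltW.
- by rewrite ltW // divr_gt0.
- exact: Hb.
- by rewrite ler_pdivrMr // mulrC sqabsB_lower.
Qed.
Lemma bdreg_bounded f : bdreg f ->
  exists2 B : R, 0 < B & forall th : R, sqabs (boundary f th) <= B.
Proof.
move=> rf; have [B B0 HB] := poly_bounded (rnum f); have [b b0 Hb] := poly_lower rf.
exists (B / b); first by rewrite divr_gt0.
move=> th; rewrite /boundary /= sqabsM sqabsV.
apply: ler_pM; rewrite ?sqabs_ge0 ?invr_ge0 ?sqabs_ge0 ?HB ?sqabs_expi //.
rewrite lef_pV2 ?Hb ?sqabs_expi // posrE //.
by apply: lt_le_trans b0 (Hb _ (sqabs_expi th)).
Qed.
Lemma bdreg_l2 f : bdreg f -> l2 mu circle (boundary f).
Proof.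
move=> /bdreg_bounded [B B0 H]; apply: l2_bounded (cmeas_boundary _ _) _ => th _.
exact: H.
Qed.
End Stab.

(** * Laurent polynomials and Fejer means *)

Section Laurent.
Context {R : realType}.
Local Notation C := R[i].
Local Notation P := {poly R[i]}.
Local Notation F := (ratfun R).
Implicit Types (f g : F) (p q : P) (c b : C) (s : seq (int * C)).

Definition laurent_poly s : F := \sum_(a <- s) ratC a.2 * ratX ^ (- a.1).
Definition laurent_val s (th : R) : C := \sum_(a <- s) a.2 * expi ((- a.1)%:~R * th).

Lemma regXz (k : int) c : c != 0 -> reg (ratX ^ k) c /\ ev (ratX ^ k) c = c ^ k.
Proof.
move=> c0; case: k => n.
  by have [r e] := regX c; have [r1 e1] := regXn n r; rewrite -!exprnP e1 e.
have [r e] := regX c; have [r1 e1] := regXn n.+1 r.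
rewrite NegzE -!exprnN; have [|r2 e2] := regV r1; last by rewrite e2 e1 e.
by rewrite e1 e expf_neq0.
Qed.
Lemma circle_neq0 c : sqabs c = 1 -> c != 0.
Proof. by move=> c1; rewrite -sqabs_eq0 c1 oner_eq0. Qed.
Lemma bdregXz (k : int) : bdreg (ratX ^ k : F).
Proof. by move=> c /circle_neq0 c0; case: (regXz k c0). Qed.
Lemma bdXz (k : int) (th : R) : boundary (ratX ^ k) th = expi (k%:~R * th).
Proof. by case: (regXz k (expi_neq0 th)) => _ e; rewrite -expi_intX -e. Qed.
Lemma bdreg_laurent_poly s : bdreg (laurent_poly s).
Proof.
by apply: bdreg_sum => a; apply: bdregM; [exact: bdregC|exact: bdregXz].
Qed.
Lemma bd_laurent_poly s (th : R) : boundary (laurent_poly s) th = laurent_val s th.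
Proof.
rewrite bd_sum => [|a]; last by apply: bdregM; [exact: bdregC|exact: bdregXz].
apply: eq_bigr => a _; rewrite bdM ?bdC ?bdXz //; [exact: bdregC|exact: bdregXz].
Qed.
Lemma l2_mono (a : int * C) : l2 mu circle (fun th : R => a.2 * expi ((- a.1)%:~R * th)).
Proof. exact: (l2Z (@measurable_circle R) a.2 (@l2_expi R (- a.1)%:~R)). Qed.

Lemma cintegrable_expi (c : R) : cintegrable mu circle (fun th : R => expi (c * th)).
Proof.
have := l2M_cintegrable measurable_circle (@l2_expi R c) (@l2_expi R 0).
by apply: eq_cintegrable => // th _; rewrite mul0r expi0 conjc1 mulr1.
Qed.
(** Parseval for Laurent polynomials. *)
Lemma cintegral_lpv s s' : cintegral mu (@circle R) (fun th => laurent_val s th * conjc (laurent_val s' th)) =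
  (pi *+ 2)%:C * \sum_(a <- s) \sum_(b <- s') (a.1 == b.1)%:R * (a.2 * conjc b.2).
Proof.
have i1 (a b : int * C) : cintegrable mu circle
    (fun th : R => a.2 * expi ((- a.1)%:~R * th) * conjc (b.2 * expi ((- b.1)%:~R * th))).
  exact: l2M_cintegrable (l2_mono _) (l2_mono _).
rewrite mulr_sumr.
transitivity (\sum_(a <- s) cintegral mu (@circle R) (fun th =>
    \sum_(b <- s') a.2 * expi ((- a.1)%:~R * th) * conjc (b.2 * expi ((- b.1)%:~R * th)))).
  rewrite -cintegral_sum //; last by move=> a; exact: cintegrable_sum.
  apply: cintegral_eq => th _; rewrite /laurent_val mulr_suml; apply: eq_bigr => a _.
  by rewrite conjc_sum mulr_sumr.
apply: eq_bigr => a _; rewrite cintegral_sum // mulr_sumr; apply: eq_bigr => b _.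
rewrite (_ : cintegral _ _ _ = cintegral mu (@circle R)
    (fun th => a.2 * conjc b.2 * expi ((b.1 - a.1)%:~R * th))); last first.
  apply: cintegral_eq => th _; rewrite conjc_mul expiJ mulrACA -expiD -mulNr -mulrDl.
  by rewrite -intrN -intrD opprK addrC.
rewrite cintegralZ //; last exact: cintegrable_expi.
rewrite cintegral_expi subr_eq0 eq_sym; case: eqP => _; last by rewrite !(mulr0, mul0r).
by rewrite mul1r mulrC.
Qed.

Variable Q : pred int.
Hypothesis Q0 : Q 0.
Hypothesis QD : forall a b : int, Q a -> Q b -> Q (a + b).

(** Laurent polynomials whose delays lie in a submonoid Q of the integers:
    the nonnegative delays give the causal ones, the nonpositive delays the
    anticausal ones, all integers the two-sided ones.  The three cases share
    one density argument. *)
Definition lp f := exists2 s, all (fun a => Q a.1) s & f = laurent_poly s.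
Lemma lp_mono (k : int) : Q k -> lp (ratX ^ (- k)).
Proof.
by move=> Qk; exists [:: (k, 1)]; rewrite /= ?Qk // /laurent_poly big_seq1 rmorph1 mul1r.
Qed.
Lemma lpC c : lp (ratC c).
Proof.
by exists [:: (0, c)]; rewrite /= ?Q0 // /laurent_poly big_seq1 oppr0 expr0z mulr1.
Qed.
Lemma lpD f g : lp f -> lp g -> lp (f + g).
Proof.
move=> [s Qs ->] [s' Qs' ->]; exists (s ++ s'); first by rewrite all_cat Qs.
by rewrite /laurent_poly big_cat.
Qed.
Lemma lp0 : lp 0. Proof. by rewrite -(rmorph0 (@ratC R)); exact: lpC. Qed.
Lemma lp1 : lp 1. Proof. by rewrite -(rmorph1 (@ratC R)); exact: lpC. Qed.
Lemma lp_sum (I : Type) (r : seq I) (G : I -> F) : (forall i, lp (G i)) ->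
  lp (\sum_(i <- r) G i).
Proof.
move=> H; elim: r => [|i r IH]; first by rewrite big_nil; exact: lp0.
by rewrite big_cons; exact: lpD.
Qed.
Lemma lpM f g : lp f -> lp g -> lp (f * g).
Proof.
move=> [s Qs ->] [s' Qs' ->].
exists [seq (x.1 + y.1, x.2 * y.2) | x <- s, y <- s'].
  apply/allP => x /allpairsP [[a b] /= [ia ib ->]] /=.
  by apply: QD; [exact: (allP Qs)|exact: (allP Qs')].
rewrite /laurent_poly big_allpairs_dep mulr_suml; apply: eq_bigr => a _.
rewrite mulr_sumr; apply: eq_bigr => b _ /=.
by rewrite rmorphM opprD expfzDr ?ratX_neq0 // mulrACA.
Qed.
Lemma lpX f n : lp f -> lp (f ^+ n).
Proof.
move=> lf; elim: n => [|n IH]; rewrite ?expr0 ?exprS; [exact: lp1|exact: lpM].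
Qed.
Lemma lp_bdreg f : lp f -> bdreg f.
Proof. by move=> [s _ ->]; exact: bdreg_laurent_poly. Qed.
Lemma lpN f : lp f -> lp (- f).
Proof. by move=> lf; rewrite -mulN1r -(rmorphN1 (@ratC R)); apply: lpM => //; exact: lpC. Qed.
Lemma lpB f g : lp f -> lp g -> lp (f - g).
Proof. by move=> lf lg; apply: lpD => //; exact: lpN. Qed.

Lemma bdsqnormM_le f g (B : R) : 0 <= B -> bdreg f -> bdreg g ->
  (forall th : R, sqabs (boundary f th) <= B) -> (bdsqnorm (f * g)%R <= B%:E * bdsqnorm g)%E.
Proof.
move=> B0 rf rg H; apply: sqnorm_le => //; do ?exact: cmeas_boundary.
move=> th _; rewrite bdM // sqabsM ler_wpM2r ?sqabs_ge0 //.
Qed.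
Lemma bdsqnormD_le f g : bdreg f -> bdreg g ->
  (bdsqnorm (f + g)%R <= 2%:E * bdsqnorm f + 2%:E * bdsqnorm g)%E.
Proof.
move=> rf rg; rewrite (@sqnorm_eq _ _ _ mu circle _ (fun th => boundary f th + boundary g th)).
  by apply: sqnormD_le => //; exact: cmeas_boundary.
by move=> th _; rewrite bdD.
Qed.

(** f has approximate inverses in L2 among the Laurent polynomials over Q.
    For the nonnegative delays this says that f is outer. *)
Definition approx_inv f := lp f /\ forall eps : R, 0 < eps -> exists2 g, lp g &
  (bdsqnorm (1 - f * g)%R < eps%:E)%E.

Lemma bdsqnorm0 : bdsqnorm (0 : F) = 0%E.
Proof.
rewrite /sqnorm integral0_eq // => th _; rewrite -(rmorph0 (@ratC R)) bdC sqabs0 //.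
Qed.
Lemma approx_inv_unit f : lp f -> lp f^-1 -> f != 0 -> approx_inv f.
Proof.
move=> lf lg f0; split=> // eps e0; exists f^-1 => //.
by rewrite mulfV // subrr bdsqnorm0 lte_fin.
Qed.
Lemma approx_inv_const c : c != 0 -> approx_inv (ratC c).
Proof.
move=> c0; apply: approx_inv_unit; rewrite ?fmorph_eq0 //; first exact: lpC.
by rewrite -fmorphV; exact: lpC.
Qed.
(** The error 1 - f1 f2 g1 g2 is (1 - f1 g1) + f1 g1 (1 - f2 g2), so g2 is
    chosen after g1, relative to a bound for f1 g1 on the circle. *)
Lemma approx_invM f1 f2 : approx_inv f1 -> approx_inv f2 -> approx_inv (f1 * f2).
Proof.
move=> [l1 H1] [l2 H2]; split=> [|eps e0]; first exact: lpM.
have e4 : 0 < eps / 4 by lra.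
have [g1 lg1 h1] := H1 _ e4.
have r1 : bdreg (f1 * g1) by apply: lp_bdreg; exact: lpM.
have [B B0 HB] := bdreg_bounded r1.
have e4B : 0 < eps / (4 * B) by rewrite divr_gt0 // mulr_gt0.
have [g2 lg2 h2] := H2 _ e4B.
have r2 : bdreg (1 - f2 * g2) by apply: lp_bdreg; apply: lpB; [exact: lp1|exact: lpM].
exists (g1 * g2); first exact: lpM.
have -> : 1 - f1 * f2 * (g1 * g2) = (1 - f1 * g1) + f1 * g1 * (1 - f2 * g2) by ring.
apply: le_lt_trans (bdsqnormD_le _ _) _.
- by apply: lp_bdreg; apply: lpB; [exact: lp1|exact: lpM].
- exact: bdregM.
have h3 := bdsqnormM_le (ltW B0) r1 r2 HB.
have f1' := l2_fin (bdreg_l2 r2).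
have h4 : (bdsqnorm ((f1 * g1) * (1 - f2 * g2))%R < (eps / 4)%:E)%E.
  apply: le_lt_trans h3 _; rewrite -(fineK f1') -EFinM lte_fin.
  have h5 : fine (bdsqnorm (1 - f2 * g2)) < eps / (4 * B) by rewrite -lte_fin fineK.
  have -> : eps / 4 = B * (eps / (4 * B)) by field; rewrite gt_eqF.
  by rewrite ltr_pM2l.
have r3 : bdreg (1 - f1 * g1) by apply: lp_bdreg; apply: lpB; [exact: lp1|exact: lpM].
have r4 := bdregM r1 r2.
move: h1 h4; rewrite -(fineK (l2_fin (bdreg_l2 r3))).
rewrite -(fineK (l2_fin (bdreg_l2 r4))).
by rewrite -!EFinM -EFinD !lte_fin; lra.
Qed.

(** Let w = c z^-k, and let g be the mean of the first n + 1 partial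
    sums of 1 + w + w^2 + ...  Then 1 - (1 - w) g is the mean of
    w, ..., w^(n+1), and these are orthogonal because k <> 0, so its squared
    norm is at most 2 pi / (n + 1).  The partial sums themselves would not
    converge when |c| = 1, which is a zero on the circle. *)
Lemma approx_inv_fejer c k : sqabs c <= 1 -> k != 0 -> Q k ->
  approx_inv (1 - ratC c * ratX ^ (- k)).
Proof.
move=> c1 k0 Qk; set w := ratC c * _.
have lw : lp w by apply: lpM; [exact: lpC|exact: lp_mono].
split=> [|eps e0]; first by apply: lpB => //; exact: lp1.
have p0 := @pi_gt0 R.
pose n := Num.truncn (pi *+ 2 / eps).
pose N : C := n.+1%:R.
have N0 : N != 0 by rewrite pnatr_eq0.
pose g := ratC N^-1 * \sum_(j < n.+1) \sum_(i < j.+1) w ^+ i.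
exists g.
  apply: lpM; first exact: lpC.
  by apply: lp_sum => j; apply: lp_sum => i; exact: lpX.
pose s := [seq (k * j.+1%:Z, N^-1 * c ^+ j.+1) | j : 'I_n.+1 <- enum 'I_n.+1].
have NV : ratC N^-1 * n.+1%:R = 1 :> F.
  by rewrite -(rmorph_nat (@ratC R)) -rmorphM mulVf ?rmorph1.
have E : 1 - (1 - w) * g = laurent_poly s.
  have -> : (1 - w) * g = 1 - ratC N^-1 * \sum_(j < n.+1) w ^+ j.+1.
    transitivity (ratC N^-1 * (n.+1%:R - \sum_(j < n.+1) w ^+ j.+1)); last first.
      by rewrite mulrBr NV.
    rewrite /g mulrCA mulr_sumr; congr (_ * _).
    have -> : n.+1%:R = \sum_(j < n.+1) 1 :> F by rewrite sumr_const card_ord.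
    rewrite -sumrB; apply: eq_bigr => j _.
    by rewrite -[LHS]opprK -mulNr opprB -subrX1 opprB.
  rewrite opprB addrC subrK /laurent_poly big_map big_enum mulr_sumr /=.
  apply: eq_bigr => j _; rewrite rmorphM -mulrA; congr (_ * _).
  have -> : ratX ^ (- (k * j.+1%:Z)) = (ratX ^ (- k)) ^+ j.+1 :> F.
    by rewrite exprnP exprz_exp mulNr.
  by rewrite /w exprMn rmorphXn.
rewrite E.
have lE : l2 mu circle (boundary (laurent_poly s)) by exact: bdreg_l2 (bdreg_laurent_poly s).
rewrite -(fineK (l2_fin lE)) lte_fin.
have e2 := cintegral_sqE lE.
rewrite (_ : cintegral _ _ _ = cintegral mu (@circle R) (fun th =>
  laurent_val s th * conjc (laurent_val s th))) in e2;
  last by apply: cintegral_eq => th _; rewrite bd_laurent_poly.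
rewrite cintegral_lpv in e2.
have e3 : \sum_(a <- s) \sum_(b <- s) (a.1 == b.1)%:R * (a.2 * conjc b.2) =
   (\sum_(j < n.+1) sqabs (N^-1 * c ^+ j.+1))%:C.
  rewrite rmorph_sum /s big_map big_enum /=; apply: eq_bigr => j _.
  rewrite big_map big_enum (bigD1 j) //= eqxx mul1r mulcJ big1 ?addr0 // => i ij.
  rewrite (inj_eq (mulfI k0)) eqz_nat eqSS eq_sym.
  by rewrite (inj_eq val_inj) (negbTE ij) mul0r.
rewrite e3 -rmorphM in e2; rewrite -(complexI e2).
apply: (@le_lt_trans _ _ (pi *+ 2 * \sum_(j < n.+1) (n.+1%:R^-1 ^+ 2))).
  apply: ler_wpM2l; first by rewrite mulrn_wge0 // ltW.
  apply: ler_sum => j _.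
  rewrite sqabsM sqabsV sqabsX -[X in _ <= X]mulr1; apply: ler_pM.
  - by rewrite invr_ge0 sqabs_ge0.
  - by rewrite exprn_ge0 // sqabs_ge0.
  - by rewrite /N -(rmorph_nat (real_complex R)) sqabsC exprVn.
  - by rewrite exprn_ile1 // sqabs_ge0.
rewrite sumr_const card_ord -[_ *+ n.+1]mulr_natr.
have n1 : 0 < n.+1%:R :> R by rewrite ltr0n.
rewrite (_ : pi *+ 2 * _ = pi *+ 2 / n.+1%:R); last first.
  by field; rewrite gt_eqF.
rewrite ltr_pdivrMr // mulrC -ltr_pdivrMr //.
exact: truncnS_gt.
Qed.
End Laurent.

(** * Density of Laurent polynomials *)

Section Density.
Context {R : realType}.
Local Notation C := R[i].
Local Notation P := {poly R[i]}.
Local Notation F := (ratfun R).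
Implicit Types (f g : F) (p q : P) (c b : C).

Variable Q : pred int.
Hypothesis Q0 : Q 0.
Hypothesis QD : forall a b : int, Q a -> Q b -> Q (a + b).

(** For |c| >= 1 factor out -c.  For |c| < 1 factor out the monomial,
    which is invertible when the opposite delay is admissible. *)
Lemma approx_inv_root (m : int) c : m != 0 -> Q m -> 1 <= sqabs c \/ Q (- m) ->
  approx_inv Q (ratX ^ (- m) - ratC c).
Proof.
move=> m0 Qm; have [c1 _|c1 [|Qm']] := leP 1 (sqabs c).
- have c0 : c != 0 by rewrite -sqabs_eq0 gt_eqF // (lt_le_trans ltr01).
  have -> : ratX ^ (- m) - ratC c = ratC (- c) * (1 - ratC c^-1 * ratX ^ (- m)).
    by rewrite mulrBr mulr1 mulrA -rmorphM mulNr mulfV // rmorphN1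
      rmorphN mulN1r opprK addrC.
  apply: (approx_invM Q0 QD); first by apply: (approx_inv_const Q0); rewrite oppr_eq0.
  by apply: (approx_inv_fejer Q0 QD) => //; rewrite sqabsV invf_le1 // (lt_le_trans ltr01).
- by [].
have -> : ratX ^ (- m) - ratC c = ratX ^ (- m) * (1 - ratC c * ratX ^ (- - m)).
  by rewrite mulrBr mulr1 mulrCA -expfzDr ?ratX_neq0 // subrr expr0z mulr1.
apply: (approx_invM Q0 QD).
  apply: approx_inv_unit; first exact: lp_mono.
    by rewrite invr_expz; exact: lp_mono.
  by rewrite expfz_neq0 // ratX_neq0.
by apply: (approx_inv_fejer Q0 QD) => //; [exact: ltW|rewrite oppr_eq0].
Qed.
Lemma approx_inv_prod (m : int) (s : seq C) : m != 0 -> Q m ->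
  (forall c, c \in s -> 1 <= sqabs c \/ Q (- m)) ->
  approx_inv Q (\prod_(c <- s) (ratX ^ (- m) - ratC c)).
Proof.
move=> m0 Qm; elim: s => [_|c s IH H].
  by rewrite big_nil -(rmorph1 (@ratC R)); apply: (approx_inv_const Q0); exact: oner_neq0.
rewrite big_cons; apply: (approx_invM Q0 QD).
  by apply: approx_inv_root => //; apply: H; rewrite mem_head.
by apply: IH => x xs; apply: H; rewrite inE xs orbT.
Qed.
Lemma approx_inv_horner (m : int) p : m != 0 -> Q m -> p != 0 ->
  (forall c, root p c -> 1 <= sqabs c \/ Q (- m)) ->
  approx_inv Q (map_poly ratC p).[ratX ^ (- m)].
Proof.
move=> m0 Qm p0 H; have [s e] := closed_field_poly_normal p.
rewrite e linearZ /= hornerZ rmorph_prod horner_prod.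
apply: (approx_invM Q0 QD); first by apply: (approx_inv_const Q0); rewrite lead_coef_eq0.
rewrite (eq_bigr (fun c => ratX ^ (- m) - ratC c)); last first.
  by move=> c _; rewrite rmorphB /= map_polyX map_polyC hornerXsubC.
apply: approx_inv_prod => // c cs; apply: H.
by rewrite e rootZ ?lead_coef_eq0 // root_prod_XsubC.
Qed.
Lemma lp_horner (m : int) p : Q m -> lp Q (map_poly ratC p).[ratX ^ (- m)].
Proof.
move=> Qm; elim/poly_ind: p => [|p c IH].
  by rewrite rmorph0 horner0; exact: lp0.
rewrite rmorphD rmorphM /= map_polyX map_polyC hornerMXaddC.
by apply: lpD => //; [apply: lpM => //; exact: lp_mono|exact: lpC].
Qed.
Lemma puE p : pu p = (map_poly ratC p).[ratX ^ (- 1)].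
Proof. by rewrite /pu exprN1. Qed.
Lemma tofracE p : tofrac p = (map_poly ratC p).[ratX ^ (- - 1)].
Proof.
rewrite opprK expr1z; elim/poly_ind: p => [|p c IH].
  by rewrite !rmorph0 horner0.
by rewrite !rmorphD !rmorphM /= map_polyX map_polyC hornerMXaddC IH.
Qed.

(** If f D = N, then f - N g = f (1 - D g), where f is bounded on the
    circle and g is an approximate inverse of D. *)
Lemma lp_dense f (N D : F) (eps : R) : lp Q N -> approx_inv Q D -> D != 0 -> f = N / D ->
  bdreg f -> 0 < eps -> exists2 x, lp Q x & (bdsqnorm (f - x)%R < eps%:E)%E.
Proof.
move=> lN [lD HD] D0 e rf e0; have [B B0 HB] := bdreg_bounded rf.
have e1 : 0 < eps / B by rewrite divr_gt0.
have [g lg h] := HD _ e1.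
exists (N * g); first exact: lpM.
have eN : N = f * D by rewrite e -mulrA (mulVf D0) mulr1.
have -> : f - N * g = f * (1 - D * g) by rewrite mulrBr mulr1 mulrA -eN.
have r1 : bdreg (1 - D * g).
  by apply: (@lp_bdreg _ Q); apply: lpB => //; [exact: lp1|exact: lpM].
apply: le_lt_trans (bdsqnormM_le (ltW B0) rf r1 HB) _.
move: h; rewrite -(fineK (l2_fin (bdreg_l2 r1))) -EFinM !lte_fin => h.
by rewrite mulrC -ltr_pdivlMr.
Qed.

Hypothesis Q1 : Q 1.
Lemma lp_pu p : lp Q (pu p).
Proof. by rewrite puE; exact: lp_horner. Qed.
Lemma stab_dense f (eps : R) : stab f -> 0 < eps ->
  exists2 x, lp Q x & (bdsqnorm (f - x)%R < eps%:E)%E.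
Proof.
move=> sf; have rf := stab_bdreg sf; move: sf => [N [D [H e]]].
apply: (lp_dense (lp_pu N) _ (pu_neq0_disc H) e rf).
rewrite puE; apply: approx_inv_horner => //.
  by rewrite -pu_eq0 pu_neq0_disc.
move=> c rc; left; rewrite leNgt; apply/negP => c1.
by have := H c (ltW c1); rewrite (rootP rc) eqxx.
Qed.
End Density.

(** * Left inverses of polynomial matrices *)

Section LeftInverse.
Context {K : fieldType}.
Implicit Types (b : K).
(** Descent on the degree of d0.  At a root b where N(b) has
    independent columns, a constant left inverse C of N(b) satisfies
    C N = 1 + (X - b) M, and d1 C - M L0 is a left inverse of N up to the factor
    d1 = d0 / (X - b). *)
Lemma poly_left_inverse (p r : nat) (N : 'M[{poly K}]_(p, r)) (d0 : {poly K})
    (L0 : 'M[{poly K}]_(r, p)) : d0 != 0 -> L0 *m N = d0%:M ->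
  exists d L, [/\ d != 0, L *m N = d%:M & forall b,
    (forall v : 'cV[K]_r, map_mx (horner_eval b) N *m v = 0 -> v = 0) -> d.[b] != 0].
Proof.
have [n] := ubnP (size d0); elim: n d0 L0 => // n IH d0 L0 sn d00 e.
have [H|] := pselect (forall b,
    (forall v : 'cV[K]_r, map_mx (horner_eval b) N *m v = 0 -> v = 0) -> d0.[b] != 0).
  by exists d0, L0.
move=> /existsNP [b /not_implyP [inj /negP]]; rewrite negbK => rb.
have /row_freeP [B HB] : row_free (map_mx (horner_eval b) N)^T.
  rewrite -kermx_eq0; apply/eqP/row_matrixP => i; rewrite row0.
  apply: trmx_inj; rewrite trmx0; apply: inj.
  by rewrite -[X in X *m _]trmxK -trmx_mul -row_mul mulmx_ker row0 trmx0.
have {HB} HB : B^T *m map_mx (horner_eval b) N = 1%:M.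
  by rewrite -[map_mx _ _]trmxK -trmx_mul HB trmx1.
have /factor_theorem [d1 ed] : root d0 b by [].
have d10 : d1 != 0 by apply: contraNneq d00 => h; rewrite ed h mul0r.
have X0 : 'X - b%:P != 0 :> {poly K} by rewrite polyXsubC_eq0.
pose Cp := map_mx polyC B^T.
pose M := map_mx (fun q => q %/ ('X - b%:P)) (Cp *m N - 1%:M).
have eM : Cp *m N - 1%:M = ('X - b%:P) *: M.
  apply/matrixP => i j; rewrite [RHS]mxE [M i j]mxE mulrC divpK //.
  rewrite dvdp_XsubCl; apply/rootP.
  have := congr1 (fun A => fun_of_matrix A i j) HB.
  rewrite -[_.[b]]/(horner_eval b _) !mxE rmorphB rmorph_sum /= => hB.
  rewrite [X in X - _](_ : _ = (i == j)%:R); last first.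
    rewrite -hB; apply: eq_bigr => k _; rewrite !mxE rmorphM /=.
    by rewrite /horner_eval hornerC.
  by rewrite rmorph_nat subrr.
have sd1 : (size d1 < n)%N.
  move: sn; rewrite ed size_mul // size_XsubC addn2 /= ltnS; exact.
apply: (IH d1 (d1 *: Cp - M *m L0) sd1 d10).
rewrite mulmxBl -scalemxAl -mulmxA e.
rewrite mul_mx_scalar ed [d1 * _]mulrC mulrC -scalerA -eM scalerBr.
by rewrite opprB addrC subrK scalemx1.
Qed.
End LeftInverse.

(** * Beurling theorem for rational matrices *)

Lemma mul_cross_div (K : fieldType) (n e q : K) : e != 0 -> n * q = (e * q) * (n / e).
Proof. by move=> e0; field. Qed.

Section Matrices.
Context {R : realType}.
Local Notation C := R[i].
Local Notation P := {poly R[i]}.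
Local Notation F := (ratfun R).
Implicit Types (f g : F) (b c : C).

Definition mxsqnorm (q n : nat) (V : 'M[F]_(q, n)) : \bar R := (\sum_i \sum_j bdsqnorm (V i j))%E.

Lemma mxsqnorm_ge0 q n (V : 'M[F]_(q, n)) : (0 <= mxsqnorm V)%E.
Proof. by apply: sume_ge0 => i _; apply: sume_ge0 => j _; exact: sqnorm_ge0. Qed.
Lemma mxsqnorm_lt q n (V : 'M[F]_(q, n)) (eps : R) : 0 < eps ->
  (forall i j, (bdsqnorm (V i j) <= (eps / (q * n).+1%:R)%:E)%E) -> (mxsqnorm V < eps%:E)%E.
Proof.
move=> e0 H; apply: (@le_lt_trans _ _ (\sum_(i < q) \sum_(j < n) (eps / (q * n).+1%:R)%:E)%E).
  by apply: lee_sum => i _; apply: lee_sum => j _; exact: H.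
have -> : (\sum_(i < q) \sum_(j < n) (eps / (q * n).+1%:R)%:E =
    ((q * n)%:R * (eps / (q * n).+1%:R))%:E)%E.
  under eq_bigr do rewrite sumEFin.
  by rewrite sumEFin !sumr_const !card_ord -mulrnA mulr_natl mulnC.
rewrite lte_fin mulrCA -[ltRHS]mulr1 ltr_pM2l // ltr_pdivrMr ?ltr0n //.
by rewrite mul1r ltr_nat.
Qed.

Lemma laurent_entry (q n : nat) (s : seq (int * 'M[C]_(q, n))) i j :
  laurent s i j = laurent_poly [seq (a.1, fun_of_matrix a.2 i j) | a <- s].
Proof.
rewrite /laurent /laurent_poly big_map summxE; apply: eq_bigr => a _.
by rewrite !mxE mulrC.
Qed.
Lemma laurent_cat (q n : nat) (s s' : seq (int * 'M[C]_(q, n))) :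
  laurent (s ++ s') = laurent s + laurent s'.
Proof. by rewrite /laurent big_cat. Qed.

Variable Q : pred int.
Hypothesis Q0 : Q 0.
Hypothesis QD : forall a b : int, Q a -> Q b -> Q (a + b).

Lemma lp_laurent (q n : nat) (M : 'M[F]_(q, n)) : (forall i j, lp Q (M i j)) ->
  exists2 s, all (fun a => Q a.1) s & M = laurent s.
Proof.
move=> H; pose lm (M : 'M[F]_(q, n)) := exists2 s, all (fun a => Q a.1) s & M = laurent s.
have lm0 : lm 0 by exists [::] => //; rewrite /laurent big_nil.
have lmD M1 M2 : lm M1 -> lm M2 -> lm (M1 + M2).
  move=> [s1 h1 ->] [s2 h2 ->]; exists (s1 ++ s2); first by rewrite all_cat h1.
  by rewrite laurent_cat.
suff : lm M by [].
rewrite [X in lm X]matrix_sum_delta.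
elim/big_ind: _ => // i _; elim/big_ind: _ => // j _.
have [s Qs ->] := H i j; exists [seq (a.1, a.2 *: delta_mx i j) | a <- s].
  by rewrite all_map.
rewrite /laurent big_map /laurent_poly scaler_suml; apply: eq_bigr => a _ /=.
apply/matrixP => k l; rewrite !mxE rmorphM [in RHS]mulrA [ratC _ * _]mulrC.
by congr (_ * _); case: (_ && _); rewrite ?rmorph1 ?rmorph0.
Qed.

(** The point z = 1/b of the Riemann sphere. *)
Definition delay_point b : option C := if b == 0 then None else Some b^-1.

(** A common denominator d in the variable u = 1/z that vanishes only at
    poles of M, so that N(b) and M have the same null vectors at every point
    where M is analytic. *)
Lemma common_denominator (p r : nat) (M : 'M[F]_(p, r)) : exists N d, [/\ d != 0,
  map_mx pu N = pu d *: M & forall b, (forall i j, analytic_at (M i j) (delay_point b)) ->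
   d.[b] != 0 /\ map_mx (horner_eval b) N = d.[b] *: map_mx (fun f =>
     value_at f (delay_point b)) M].
Proof.
have H (ij : 'I_p * 'I_r) : exists ND : P * P, [/\ ND.2 != 0,
   M ij.1 ij.2 = pu ND.1 / pu ND.2 & forall b, analytic_at (M ij.1 ij.2) (delay_point b) ->
   ND.2.[b] != 0 /\ value_at (M ij.1 ij.2) (delay_point b) = ND.1.[b] / ND.2.[b]].
  have [N [D [D0 e H1 H2]]] := pu_rep (M ij.1 ij.2); exists (N, D); split=> //= b.
  rewrite /delay_point; case: eqP => [-> /H2 //|/eqP b0 an].
  have b0' : b^-1 != 0 by rewrite invr_eq0.
  have Db : D.[b] != 0 by have := H1 _ b0' an; rewrite invrK.
  have [r1 e1] := reg_pu N b0'; have [r2 e2] := reg_pu D b0'.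
  rewrite invrK in e1 e2; split=> //.
  have [|r3 e3] := regV r2; first by rewrite e2.
  by rewrite -[LHS]/(ev _ _) e; have [_ ->] := regM r1 r3; rewrite e3 e1 e2.
have /fin_all_exists [ND HND] := H.
pose d := \prod_ij (ND ij).2.
pose N := \matrix_(i, j) ((ND (i, j)).1 * \prod_(kl | kl != (i, j)) (ND kl).2).
have dE i j : d = (ND (i, j)).2 * \prod_(kl | kl != (i, j)) (ND kl).2.
  by rewrite /d (bigD1 (i, j)).
exists N, d; split.
- by apply/prodf_neq0 => ij _; have [] := HND ij.
- apply/matrixP => i j; rewrite !mxE (dE i j).
  have [D0 /= -> _] := HND (i, j); rewrite !rmorphM /=.
  have D0' : pu (ND (i, j)).2 != 0 by rewrite pu_eq0.
  exact: mul_cross_div.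
- move=> b an; split.
    rewrite horner_prod; apply/prodf_neq0 => ij _.
    by have [_ _ /(_ b (an _ _)) []] := HND ij.
  apply/matrixP => i j; rewrite !mxE (dE i j).
  have [_ _ /(_ b (an _ _)) [/= Db ->]] := HND (i, j).
  rewrite /horner_eval !hornerM; field; exact: Db.
Qed.

Hypothesis Q1 : Q 1.

(** A root c of dl with |c| < 1 would be a point 1/c outside the
    closed disc at which G is analytic with dependent columns, which minimum
    phase excludes.  If -1 is an admissible delay, roots inside the disc are
    harmless. *)
Lemma lp_left_inverse (p r : nat) (G : 'M[F]_(p, r)) : \rank G = r ->
  (minimum_phase G \/ Q (- 1)) ->
  exists dl (L : 'M[F]_(r, p)), [/\ dl != 0, approx_inv Q dl, forall i j, lp Q (L i j) &
    L *m G = dl%:M].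
Proof.
move=> rG mp.
have /row_fullP [L LG] : row_full G by apply/eqP.
have [N [d [d0 eN Nb]]] := common_denominator G; have [L' [d' [d'0 eL _]]] := common_denominator L.
have e0 : L' *m N = (d' * d)%:M.
  apply/matrixP => i j; apply/eqP; rewrite -subr_eq0 -pu_eq0 rmorphB subr_eq0; apply/eqP.
  have : map_mx pu L' *m map_mx pu N = (pu d' * pu d)%:M.
    rewrite eN eL -scalemxAl -scalemxAr LG scalerA.
    by rewrite -[RHS]scalemx1.
  move=> /(congr1 (fun A => fun_of_matrix A i j)).
  rewrite -map_mxM [LHS]mxE => ->; rewrite !mxE.
  by case: (i == j); rewrite ?mulr1n ?mulr0n ?rmorphM ?rmorph0.
have [dl [L1 [dl0 eL1 H]]] := poly_left_inverse (mulf_neq0 d'0 d0) e0.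
exists (pu dl), (pu d *: map_mx pu L1); split.
- by rewrite pu_eq0.
- rewrite puE; apply: (approx_inv_horner Q0 QD) => // c rc.
  case: mp => [[sG zG]|Qm]; last by right.
  left; rewrite leNgt; apply/negP => c1.
  suff : dl.[c] != 0 by rewrite (rootP rc) eqxx.
  apply: H.
  have nd a : in_closed_disc (delay_point c) -> a.
    rewrite /delay_point; case: eqP => // /eqP c0 /=; rewrite norm_le1 sqabsV.
    rewrite invf_le1 ?leNgt ?c1 // lt_neqAle eq_sym sqabs_eq0 c0 sqabs_ge0 //.
  have nd' a : in_open_disc (delay_point c) -> a.
    move=> h; apply: nd; move: h; case: (delay_point c) => //= x; exact: ltW.
  have an i j : analytic_at (G i j) (delay_point c).
    apply/negPn/negP => na; apply: (nd' False); apply: sG; by exists i, j.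
  have [dc eNc] := Nb c an.
  move=> v; rewrite eNc -scalemxAl => /eqP; rewrite scaler_eq0 (negbTE dc) /= => /eqP v0.
  apply/eqP/negPn/negP => vn0; apply: (nd False); apply: zG; split.
    by move=> [i [j]]; rewrite an.
  by exists v.
- move=> i j; rewrite !mxE; apply: lpM => //; exact: lp_pu.
- rewrite -scalemxAl scalemxAr -eN -map_mxM eL1.
  by apply/matrixP => i j; rewrite !mxE; case: (i == j); rewrite ?mulr1n ?mulr0n ?rmorph0.
Qed.

(** With L G = dl I and g an approximate inverse of dl, the product
    x g L G = x dl g is close to x for every Laurent polynomial x, and these
    approximate the stable X.  The two-sided variant, for G without any
    condition on its zeros, serves for the relation from y_1 to y_2. *)
Lemma beurling (p r q : nat) (G : 'M[F]_(p, r)) (X : 'M[F]_(q, r)) (eps : R) :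
  \rank G = r -> (minimum_phase G \/ Q (- 1)) -> (forall i j, bdreg (G i j)) ->
  (forall i j, stab (X i j)) -> 0 < eps ->
  exists2 s : seq (int * 'M[C]_(q, p)), all (fun a => Q a.1) s &
    (mxsqnorm (X - laurent s *m G)%R < eps%:E)%E.
Proof.
move=> rG mp bG sX e0.
have [dl [L [dl0 [ldl Hdl] lL LG]]] := lp_left_inverse rG mp.
set K : R := (q * r).+1%:R; have K0 : 0 < K by rewrite ltr0n.
have e1 : 0 < eps / K / 4 by rewrite !divr_gt0.
have /fin_all_exists2 [x lx hx] : forall ij : 'I_q * 'I_r, exists2 x, lp Q x &
    (bdsqnorm (X ij.1 ij.2 - x)%R < (eps / K / 4)%:E)%E.
  by move=> ij; apply: stab_dense.
have /fin_all_exists2 [B B0 HB] : forall ij : 'I_q * 'I_r, exists2 B : R, 0 < B &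
    forall th : R, sqabs (boundary (x ij) th) <= B.
  by move=> ij; apply: bdreg_bounded; exact: lp_bdreg (lx ij).
(* one g must serve for all entries, so it is chosen for the largest bound *)
pose BB := 1 + \sum_ij B ij.
have BB0 : 0 < BB.
  by apply: ltr_pwDl => //; apply: sumr_ge0 => ij _; exact: ltW.
have BBB ij : B ij <= BB.
  rewrite /BB (bigD1 ij) //= addrCA lerDl addr_ge0 //.
  by apply: sumr_ge0 => kl _; exact: ltW.
have e2 : 0 < eps / K / 4 / BB by rewrite divr_gt0.
have [g lg hg] := Hdl _ e2.
pose S := (\matrix_(i, j) x (i, j)) *m (g *: L).
have lS i j : lp Q (S i j).
  rewrite mxE; apply: lp_sum => // k; rewrite !mxE; apply: lpM => //; exact: lpM.
have [s Qs eS] := lp_laurent lS; exists s => //; rewrite -eS.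
apply: mxsqnorm_lt => // i j; rewrite -/K.
have -> : (X - S *m G) i j = (X i j - x (i, j)) + x (i, j) * (1 - dl * g).
  rewrite /S -mulmxA -scalemxAl LG !mxE (bigD1 j) //= big1 => [|k kj]; last first.
    by rewrite !mxE (negbTE kj) mulr0n !mulr0.
  rewrite !mxE eqxx mulr1n addr0; ring.
have r1 : bdreg (1 - dl * g) by apply: (@lp_bdreg _ Q); apply: lpB => //; [exact: lp1|exact: lpM].
have r2 : bdreg (X i j - x (i, j)).
  by apply: bdregB; [exact: stab_bdreg|exact: lp_bdreg (lx _)].
have r3 : bdreg (x (i, j)) by exact: lp_bdreg (lx _).
have r4 := bdregM r3 r1.
apply: le_trans (bdsqnormD_le r2 r4) _.
have h1 := hx (i, j); rewrite /= in h1.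
have h2 := bdsqnormM_le (ltW (B0 (i, j))) r3 r1 (HB (i, j)).
move: hg h1 h2; rewrite -(fineK (l2_fin (bdreg_l2 r1))) -(fineK (l2_fin (bdreg_l2 r2))).
rewrite -(fineK (l2_fin (bdreg_l2 r4))) -!EFinM -EFinD !lte_fin !lee_fin.
set a := fine _; set b := fine _; set c := fine _ => ha hb hc.
have h3 : B (i, j) * a <= eps / K / 4.
  apply: (@le_trans _ _ (BB * a)).
    by rewrite ler_wpM2r // /a fine_ge0 // sqnorm_ge0.
  by rewrite mulrC -ler_pdivlMr // ltW.
by move: h3 hb hc; set e := eps / K; lra.
Qed.
End Matrices.

(** * Causal and anticausal parts of a rational function *)

Lemma hardy_field (K : fieldType) (l r c0 x m d1 d2 : K) : d1 != 0 -> d2 != 0 -> l != 0 ->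
  (r * d2 + c0 * (d1 * d2) + x * m * d1) / (l * (d1 * d2)) =
  l^-1 * (r / d1) + l^-1 * c0 + x * (l^-1 * m / d2).
Proof. by move=> h1 h2 h3; field; rewrite h1 h2 h3. Qed.

Section Hardy.
Context {R : realType}.
Local Notation C := R[i].
Local Notation P := {poly R[i]}.
Local Notation F := (ratfun R).
Implicit Types (f g : F) (b c : C).

Lemma hardy2_l2 (h : R -> C) : hardy2 h -> l2 mu circle h.
Proof. by case. Qed.
Lemma twopi_neq0 : (pi *+ 2 : R) != 0.
Proof. by rewrite mulrn_eq0 /= gt_eqF // pi_gt0. Qed.
Lemma inv2pi_neq0 : ((pi *+ 2 : R)^-1)%:C != 0.
Proof. by rewrite -sqabs_eq0 sqabsC expf_neq0 // invr_neq0 // twopi_neq0. Qed.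
Lemma circle_integral_eq0 (h : R -> C) :
  circle_integral h = 0 <-> cintegral mu (@circle R) h = 0.
Proof.
rewrite circle_integralE; split=> [/eqP|->]; last by rewrite mulr0.
by rewrite mulf_eq0 (negbTE inv2pi_neq0) => /eqP.
Qed.
Lemma hardy2_coef (h : R -> C) (k : int) : hardy2 h -> 0 < k ->
  cintegral mu (@circle R) (fun th => h th * conjc (expi (k%:~R * th))) = 0.
Proof.
by case=> _ _ _ H; case: k => // n n0; apply/circle_integral_eq0; exact: H.
Qed.
Lemma hardy2B (h1 h2 : R -> C) : hardy2 h1 -> hardy2 h2 -> hardy2 (fun th => h1 th - h2 th).
Proof.
move=> H1 H2; have l := l2B measurable_circle (hardy2_l2 H1) (hardy2_l2 H2).
case: (l) => -[m1 m2] m3; split=> // k k0; apply/circle_integral_eq0.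
have le : l2 mu circle (fun th : R => expi (k%:~R * th)) by exact: l2_expi.
have c1 := hardy2_coef H1 (k := k) k0; have c2 := hardy2_coef H2 (k := k) k0.
have i1 := l2M_cintegrable measurable_circle (hardy2_l2 H1) le.
have i2 := l2M_cintegrable measurable_circle (hardy2_l2 H2) le.
transitivity (cintegral mu (@circle R) (fun th => h1 th * conjc (expi (k%:~R * th)) +
    (-1) * (h2 th * conjc (expi (k%:~R * th))))).
  by apply: cintegral_eq => th _; rewrite mulN1r mulrBl.
rewrite cintegralD // ?cintegralZ //; last exact: cintegrableZ.
by rewrite c1 c2 mulr0 addr0.
Qed.

Local Notation Qp := (fun k : int => 0 <= k).
Local Notation Qn := (fun k : int => k <= 0).
Lemma Qp_add (a b : int) : Qp a -> Qp b -> Qp (a + b). Proof. exact: addr_ge0. Qed.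
Lemma Qn_add (a b : int) : Qn a -> Qn b -> Qn (a + b). Proof. by move=> /= ha hb; lra. Qed.

(** Positive powers of z are orthogonal to the causal Laurent
    polynomials, which approximate g. *)
Lemma stab_hardy2 g : stab g -> hardy2 (boundary g).
Proof.
move=> sg; have lg := bdreg_l2 (stab_bdreg sg).
case: (lg) => -[m1 m2] m3; split=> // k k0; apply/circle_integral_eq0.
have le : l2 mu circle (fun th : R => expi (k%:~R * th)) by exact: l2_expi.
suff e : cintegral mu (@circle R) (fun th => expi (k%:~R * th) * conjc (boundary g th)) = 0.
  transitivity (cintegral mu (@circle R) (fun th =>
      conjc (expi (k%:~R * th) * conjc (boundary g th)))).
    by apply: cintegral_eq => th _; rewrite conjc_mul conjcK mulrC.
  by rewrite cintegralJ ?e ?conjc0 //; exact: l2M_cintegrable.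
apply: orth_closed => // eps e0.
have [x [s Qs ex] hx] := stab_dense (Q := Qp) (lexx 0) Qp_add ler01 sg e0.
have rx : bdreg x by rewrite ex; exact: bdreg_laurent_poly.
exists (boundary x); split; first exact: bdreg_l2.
  rewrite (_ : sqnorm _ _ _ = bdsqnorm (g - x)) //; apply: sqnorm_eq => th _.
  by rewrite bdB //; exact: stab_bdreg.
transitivity (cintegral mu (@circle R) (fun th =>
  laurent_val [:: (- k%:Z, 1)] th * conjc (laurent_val s th))).
  by apply: cintegral_eq => th _; rewrite ex bd_laurent_poly /laurent_val big_seq1 mul1r opprK.
rewrite cintegral_lpv big_seq1 big_seq big1 ?mulr0 // => a /(allP Qs) /= a0.
case: eqP => [e|]; last by rewrite mul0r.
by move: a0; rewrite -e oppr_ge0 lez_nat leqNgt k0.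
Qed.

(** N / D is analytic on the closed disc, hence a limit of polynomials
    in z; the factor z leaves only positive powers. *)
Lemma anticausal_orth (N D : P) (h : R -> C) : (forall b, sqabs b <= 1 -> D.[b] != 0) ->
  hardy2 h -> cintegral mu (@circle R)
    (fun th => boundary (ratX * (tofrac N / tofrac D)) th * conjc (h th)) = 0.
Proof.
move=> HD Hh; have lh := hardy2_l2 Hh.
have D0 : D != 0 by apply: contraTneq isT => e; have := HD 0;
   rewrite sqabs0 ler01 e horner0 eqxx => /(_ isT).
set g := tofrac N / tofrac D.
have rg : bdreg g.
  move=> c c1; have dc : D.[c] != 0 by apply: HD; rewrite c1.
  by case: (regP dc (erefl g)).
have rXg : bdreg (ratX * g) by apply: bdregM => //; exact: bdregX.
have lg := bdreg_l2 rXg.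
suff e : cintegral mu (@circle R) (fun th => h th * conjc (boundary (ratX * g) th)) = 0.
  transitivity (cintegral mu (@circle R) (fun th =>
      conjc (h th * conjc (boundary (ratX * g) th)))).
    by apply: cintegral_eq => th _; rewrite conjc_mul conjcK mulrC.
  by rewrite cintegralJ ?e ?conjc0 //; exact: l2M_cintegrable.
apply: orth_closed => // eps e0.
have [x [s Qs ex] hx] : exists2 x, lp Qn x & (bdsqnorm (g - x)%R < eps%:E)%E.
  apply: (@lp_dense _ Qn (lexx 0) Qn_add _ (tofrac N) (tofrac D)) => //.
  - by rewrite tofracE; apply: lp_horner => //; exact: Qn_add.
  - rewrite tofracE; apply: approx_inv_horner => //; first exact: Qn_add.
    move=> c rc; left; rewrite leNgt; apply/negP => c1.
    by have := HD c (ltW c1); rewrite (rootP rc) eqxx.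
  - by rewrite tofrac_eq0.
have rx : bdreg x by rewrite ex; exact: bdreg_laurent_poly.
have rXx : bdreg (ratX * x) by apply: bdregM => //; exact: bdregX.
exists (boundary (ratX * x)); split; first exact: bdreg_l2.
  rewrite (_ : sqnorm _ _ _ = bdsqnorm (ratX * (g - x))); last first.
    by apply: sqnorm_eq => th _; rewrite mulrBr bdB.
  apply: le_lt_trans hx; rewrite -[leRHS]mul1e; apply: bdsqnormM_le => //.
  - exact: bdregX.
  - exact: bdregB.
  - by move=> th; rewrite bdX sqabs_expi.
transitivity (cintegral mu (@circle R) (fun th =>
    \sum_(a <- s) conjc a.2 * (h th * conjc (expi ((1 - a.1)%:~R * th))))).
  apply: cintegral_eq => th _; rewrite bdM ?bdX ?ex ?bd_laurent_poly /laurent_val;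
    do ?[exact: bdregX|exact: bdreg_laurent_poly].
  rewrite conjc_mul conjc_sum !mulr_sumr; apply: eq_bigr => a _.
  by rewrite conjc_mul intrD mulrDl mul1r expiD conjc_mul; ring.
have i1 (a : int * C) : cintegrable mu circle
    (fun th => h th * conjc (expi ((1 - a.1)%:~R * th))).
  by apply: l2M_cintegrable => //; exact: l2_expi.
rewrite cintegral_sum // => [|a]; last exact: cintegrableZ.
rewrite big_seq big1 // => a ina; have a0 : a.1 <= 0 := allP Qs _ ina.
have k0 : 0 < 1 - a.1 by rewrite subr_gt0 (le_lt_trans a0 ltr01).
by rewrite cintegralZ // (hardy2_coef Hh k0) mulr0.
Qed.

Lemma stab_frac (N D : P) : (size N <= size D)%N -> D != 0 ->
  (forall c, root D c -> sqabs c < 1) -> stab (tofrac N / tofrac D).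
Proof.
move=> sND D0 H; pose k := (size D).-1.
have sk : size D = k.+1 by rewrite /k prednK // lt0n size_poly_eq0.
have s1 : (size N <= k.+1)%N by rewrite -sk.
have s2 : (size D <= k.+1)%N by rewrite -sk.
exists (revp k N), (revp k D); split.
  move=> b b1; have [->|b0] := eqVneq b 0.
    by rewrite horner_coef0 coef_poly /= subn0 /k -lead_coefE lead_coef_eq0.
  apply: contraTneq b1 => rb; rewrite -ltNge.
  have b0' : b^-1 != 0 by rewrite invr_eq0.
  have := H b^-1; rewrite /root (horner_rev s2 b0') invrK rb mul0r eqxx.
  rewrite sqabsV => /(_ isT); rewrite invf_lt1 //.
  by rewrite lt_neqAle eq_sym sqabs_eq0 b0 sqabs_ge0.
rewrite (tofrac_rev s1) (tofrac_rev s2) -mulf_div divff ?mulr1 //.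
by rewrite expf_neq0 ?ratX_neq0.
Qed.

(** Partial fractions.  The denominator splits into D1, with
    roots in the open disc, and D2, with roots outside the closed disc, and a
    Bezout relation separates them.  The value at 0 of the second part is then
    moved to the first, so that a factor z remains: [.]_+ keeps the constant
    term. *)
Lemma hardy_decomposition f : bdreg f -> exists g N D,
  [/\ stab g, forall b, sqabs b <= 1 -> D.[b] != 0 &
      f = g + ratX * (tofrac N / tofrac D)].
Proof.
move=> rf.
have [s es] := closed_field_poly_normal (rden f).
set l := lead_coef _ in es.
have l0 : l != 0 by rewrite lead_coef_eq0 rden_neq0.
pose D1 := \prod_(z <- s | sqabs z < 1) ('X - z%:P).
pose D2 := \prod_(z <- s | ~~ (sqabs z < 1)) ('X - z%:P).
have eD : rden f = l%:P * (D1 * D2).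
  by rewrite es -mul_polyC (bigID (fun z => sqabs z < 1)).
have r1 c : root D1 c -> sqabs c < 1.
  rewrite /D1 -big_filter root_prod_XsubC mem_filter; by case/andP.
have r2 c : root D2 c -> 1 < sqabs c.
  rewrite /D2 -big_filter root_prod_XsubC mem_filter -leNgt => /andP[c1 cs].
  rewrite lt_neqAle c1 andbT; apply/eqP => e.
  have := rf c (esym e); rewrite /reg es hornerZ.
  have : root (\prod_(z <- s) ('X - z%:P)) c by rewrite root_prod_XsubC.
  by move=> /rootP ->; rewrite mulr0 eqxx.
have D10 : D1 != 0 by rewrite /D1 -big_filter; apply/monic_neq0/monic_prod_XsubC.
have D20 : D2 != 0 by rewrite /D2 -big_filter; apply/monic_neq0/monic_prod_XsubC.
have cop : coprimep D1 D2.
  apply/Pdiv.ClosedField.coprimepP => c /r1 c1; apply/negP => /r2.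
  by move/lt_trans => /(_ _ c1); rewrite ltxx.
have /Bezout_eq1_coprimepP [[u v] /= uv] := cop.
pose A := rnum f * v; pose q := A %/ D1; pose r := A %% D1.
pose M := q * D2 + rnum f * u.
have D200 : D2.[0] != 0.
  by apply/negP => /r2; rewrite sqabs0 ltr10.
(* M / D2 - c0 vanishes at 0, which gives the factor 'X of the second part *)
pose c0 := M.[0] / D2.[0].
have /factor_theorem [M' eM] : root (M - c0 *: D2) 0.
  by rewrite /root hornerD hornerN hornerZ /c0 mulfVK // subrr.
rewrite subr0 in eM.
exists (ratC l^-1 * (tofrac r / tofrac D1) + ratC (l^-1 * c0)), (l^-1 *: M'), D2; split.
- apply: stabD; last exact: stabC.
  apply: stabM; first exact: stabC.
  by apply: stab_frac => //; rewrite ltnW // ltn_modp.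
- move=> b b1; apply/negP => /r2; rewrite ltNge b1 //.
have key : rnum f = r * D2 + c0 *: (D1 * D2) + 'X * M' * D1.
  have eA : A = q * D1 + r by exact: divp_eq.
  have e1 : rnum f = rnum f * u * D1 + A * D2.
    by rewrite /A -[LHS]mulr1 -uv; ring.
  rewrite [LHS]e1 eA mulrC ['X * M']mulrC -eM /M -mul_polyC -[c0 *: D2]mul_polyC; ring.
have n1 : tofrac D1 != 0 :> F by rewrite tofrac_eq0.
have n2 : tofrac D2 != 0 :> F by rewrite tofrac_eq0.
have n3 : ratC l != 0 :> F by rewrite fmorph_eq0.
rewrite {1}[f]rfracE eD key -!mul_polyC !tofracD !tofracM -!/(ratC _) -/ratX.
rewrite !rmorphM /= !fmorphV /=.
by move: n1 n2 n3; apply: hardy_field.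
Qed.
End Hardy.

(** * The orthogonal projection onto the Hardy space *)

Section HardyProj.
Context {R : realType}.
Local Notation C := R[i].
Local Notation F := (ratfun R).
Implicit Types (f g : F) (b c : C).

Lemma hardy_proj_exists f : bdreg f -> exists2 g, stab g & is_hardy_proj f g.
Proof.
move=> rf; have [g [N [D [sg HD e]]]] := hardy_decomposition rf.
exists g => //; split; first exact: stab_hardy2.
move=> h Hh; apply/circle_integral_eq0; rewrite -(anticausal_orth N HD Hh).
have rg := stab_bdreg sg.
have eh : ratX * (tofrac N / tofrac D) = f - g by rewrite e addrAC subrr add0r.
by apply: cintegral_eq => th _; rewrite eh bdB.
Qed.
(** The difference of two projections belongs to the Hardy
    space and is orthogonal to it. *)
Lemma hardy_proj_unique f g1 g2 : bdreg f -> is_hardy_proj f g1 -> is_hardy_proj f g2 ->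
  g1 = g2.
Proof.
move=> rf [H1 O1] [H2 O2].
have lf := bdreg_l2 rf.
have l1 := hardy2_l2 H1; have l2' := hardy2_l2 H2.
have Hd := hardy2B H1 H2; have ld := hardy2_l2 Hd.
set d := (fun th : R => boundary g1 th - boundary g2 th) in Hd ld.
have /circle_integral_eq0 o1 := O1 _ Hd; have /circle_integral_eq0 o2 := O2 _ Hd.
have mc := @measurable_circle R.
have i1 := l2M_cintegrable mc (l2B mc lf l1) ld.
have i2 := l2M_cintegrable mc (l2B mc lf l2') ld.
have e : cintegral mu (@circle R) (fun th => d th * conjc (d th)) = 0.
  transitivity (cintegral mu (@circle R) (fun th =>
     (boundary f th - boundary g2 th) * conjc (d th) +
     (-1) * ((boundary f th - boundary g1 th) * conjc (d th)))).
    by apply: cintegral_eq => th _; rewrite /d; ring.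
  by rewrite cintegralD // ?cintegralZ ?o1 ?o2 ?mulr0 ?addr0 //; exact: cintegrableZ.
rewrite (cintegral_sqE ld) in e.
apply/eqP; rewrite -subr_eq0; apply/eqP; apply: boundary_eq0.
transitivity (sqnorm mu circle d); last first.
  by rewrite -(fineK (l2_fin ld)); case: e => ->.
apply: ae_eq_integral => //.
- by apply: cmeas_sqe; exact: cmeas_boundary.
- by apply: cmeas_sqe; case: ld.
- have := ae_onI (ae_reg g1) (ae_reg g2); apply: ae_onS => th _ [r1 r2].
  congr (sqabs _)%:E; rewrite /d; have [_ <-] := regB r1 r2; by [].
Qed.
Lemma hardy_projP m n (M : 'M[F]_(m, n)) i j : bdreg (M i j) ->
  stab (hardy_proj M i j) /\ is_hardy_proj (M i j) (hardy_proj M i j).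
Proof.
move=> r; have [g sg Hg] := hardy_proj_exists r.
have H : is_hardy_proj (M i j) (hardy_proj M i j).
  by rewrite /hardy_proj mxE; apply: xgetPex; exists g.
by split=> //; rewrite (hardy_proj_unique r H Hg).
Qed.
End HardyProj.

(** * The norm of a filter in L2(Phi) *)

Section SpectralNorm.
Context {R : realType}.
Local Notation C := R[i].
Local Notation F := (ratfun R).

Lemma mxsqnorm_eq0 q n (V : 'M[F]_(q, n)) : mxsqnorm V = 0%E -> V = 0.
Proof.
move=> /eqP; rewrite /mxsqnorm.
have h i : (0 <= \sum_j bdsqnorm (V i j))%E by apply: sume_ge0 => j _; exact: sqnorm_ge0.
move=> H; apply/matrixP => i j; rewrite mxE; apply: boundary_eq0.
apply/eqP; rewrite eq_le sqnorm_ge0 andbT -(eqP H).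
rewrite (bigD1 i) //= (bigD1 j) //= -addeA leeDl //.
by apply: adde_ge0; apply: sume_ge0 => k _ //; exact: sqnorm_ge0.
Qed.

(** The integrand is the sum of the |(A G)_ij|^2 away from the
    poles of A G, which form a null set on the circle.  The matrix A itself may
    have poles there, as left inverses do. *)
Lemma spectral_norm2E (q n k : nat) (Phi : 'M[F]_n) (G : 'M[F]_(n, k)) (A : 'M[F]_(q, n)) :
  Phi = G *m mxstar G ->
  spectral_norm2 Phi A = (((pi *+ 2)^-1)%:E * mxsqnorm (A *m G))%E.
Proof.
move=> ->; rewrite /spectral_norm2; congr (_ * _)%E.
have -> : A *m (G *m mxstar G) *m mxstar A = (A *m G) *m mxstar (A *m G).
  by rewrite mxstarM !mulmxA.
set V := A *m G.
have mb f : measurable_fun (@circle R : set (measurableTypeR R))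
    (fun th => (sqabs (boundary f th))%:E).
  by apply: cmeas_sqe; exact: cmeas_boundary.
transitivity (\int[mu]_(th in @circle R) \sum_i \sum_j (sqabs (boundary (V i j) th))%:E)%E.
  apply: ae_eq_integral => //.
  - by apply/measurable_EFinP; case: (@cmeas_boundary R circle (\tr (V *m mxstar V))).
  - by apply: emeasurable_sum => i; apply: emeasurable_sum => j; exact: mb.
  have := ae_on_forall (fun ij : 'I_q * 'I_k => ae_reg (V ij.1 ij.2)).
  apply: ae_onS => th _ r.
  have rr i j : reg (V i j) (expi th) := r (i, j).
  have rs i j := reg_rstar (sqabs_expi th) (rr i j).
  have rm i j := regM (rr i j) (rs i j).1.
  under eq_bigr do rewrite sumEFin.
  rewrite sumEFin; congr (_%:E).
  have -> : \tr (V *m mxstar V) = \sum_i \sum_j V i j * rstar (V i j).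
    by apply: eq_bigr => i _; rewrite mxE; apply: eq_bigr => j _; rewrite !mxE.
  have rsum i := reg_sum (index_enum 'I_k) (fun j => (rm i j).1).
  have [_] := reg_sum (index_enum 'I_q) (fun i => (rsum i).1).
  rewrite /ev -/(boundary _ _) => ->; rewrite Re_sum; apply: eq_bigr => i _.
  have [_] := rsum i; rewrite /ev => ->; rewrite Re_sum; apply: eq_bigr => j _.
  have [_] := rm i j; rewrite /ev => ->; have [_] := rs i j; rewrite /ev => ->.
  by rewrite mulcJ.
rewrite ge0_integral_sum //; last first.
- by move=> i th _; apply: sume_ge0 => j _; rewrite lee_fin sqabs_ge0.
- by move=> i; apply: emeasurable_sum => j; exact: mb.
apply: eq_bigr => i _; rewrite ge0_integral_sum //.
by move=> j th _; rewrite lee_fin sqabs_ge0.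
Qed.
Lemma mxsqnormD_le (q n : nat) (V U : 'M[F]_(q, n)) :
  (mxsqnorm (V + U)%R <= 2%:E * mxsqnorm V + 2%:E * mxsqnorm U)%E.
Proof.
rewrite /mxsqnorm !ge0_sume_distrr; do ?[by move=> i _; apply: sume_ge0 => j _; exact: sqnorm_ge0].
rewrite -big_split /=; apply: lee_sum => i _.
rewrite !ge0_sume_distrr; do ?[by move=> j _; exact: sqnorm_ge0].
rewrite -big_split /=; apply: lee_sum => j _.
have mc := @measurable_circle R.
have -> : bdsqnorm ((V + U) i j) =
    sqnorm mu circle (fun th => boundary (V i j) th + boundary (U i j) th).
  apply: ae_eq_integral => //.
  - by apply: cmeas_sqe; exact: cmeas_boundary.
  - by apply: cmeas_sqe; apply: cmeasD; exact: cmeas_boundary.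
  - have := ae_onI (ae_reg (V i j)) (ae_reg (U i j)); apply: ae_onS => th _ [r1 r2].
    by rewrite mxE; congr (sqabs _)%:E; have [_ ] := regD r1 r2.
by apply: sqnormD_le => //; exact: cmeas_boundary.
Qed.
End SpectralNorm.

(** * Random vectors with finite second moments *)

Lemma sqabs_sum_le (R : realType) (I : Type) (s : seq I) (z : I -> R[i]) :
  sqabs (\sum_(i <- s) z i) <= 2 ^+ size s * \sum_(i <- s) sqabs (z i).
Proof.
elim: s => [|i s IH]; first by rewrite !big_nil sqabs0 mulr0.
rewrite !big_cons /= exprS; apply: le_trans (sqabsD_le _ _) _.
have h1 : 1 <= 2 ^+ size s :> R by rewrite exprn_ege1 // ler1n.
have h2 := sqabs_ge0 (z i).
have : 2 * sqabs (z i) <= 2 * 2 ^+ size s * sqabs (z i) by nra.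
by rewrite mulrDr -!mulrA in IH *; lra.
Qed.

Section Lincomb.
Context d (T : measurableType d) (R : realType).
Variables (mu : {measure set T -> \bar R}) (D : set T).
Hypothesis mD : measurable D.
Lemma sqnorm_lincomb_le n (a : 'I_n -> R[i]) (f : 'I_n -> T -> R[i]) (b : R) :
  (forall l, sqabs (a l) <= b) -> (forall l, cmeas D (f l)) ->
  (sqnorm mu D (fun x => \sum_l a l * f l x)%R <=
     (2 ^+ size (index_enum 'I_n) * b)%:E * \sum_l sqnorm mu D (f l))%E.
Proof.
move=> ab mf.
case: n a f ab mf => [|n] a f ab mf.
  rewrite [X in (_ * X)%E]big_ord0 mule0 /sqnorm integral0_eq // => x _.
  by rewrite big_ord0 sqabs0.
have b0 : 0 <= b := le_trans (sqabs_ge0 _) (ab ord0).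
have K0 : 0 <= 2 ^+ size (index_enum 'I_n.+1) * b by rewrite mulr_ge0 // exprn_ge0.
rewrite /sqnorm -ge0_integral_sum //; last 2 first.
- by move=> j; exact: cmeas_sqe.
- by move=> j w _; rewrite lee_fin sqabs_ge0.
rewrite -ge0_integralZl //; last 2 first.
- by apply: emeasurable_sum => j; exact: cmeas_sqe.
- by move=> w _; apply: sume_ge0 => j _; rewrite lee_fin sqabs_ge0.
apply: ge0_le_integral => //.
- by move=> w _; rewrite lee_fin sqabs_ge0.
- apply: cmeas_sqe; apply: cmeas_sum => // l; apply: cmeasM => //; exact: cmeas_cst.
- by apply: measurable_funeM; apply: emeasurable_sum => j; exact: cmeas_sqe.
move=> w _; rewrite sumEFin -EFinM lee_fin.
apply: le_trans (sqabs_sum_le _ _) _; rewrite -mulrA ler_wpM2l ?exprn_ge0 //.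
by rewrite mulr_sumr; apply: ler_sum => j _; rewrite sqabsM ler_wpM2r ?sqabs_ge0.
Qed.
End Lincomb.

Lemma mx_sqabs_bound (R : realType) q n (A : 'M[R[i]]_(q, n)) :
  exists2 b : R, 0 <= b & forall i j, sqabs (A i j) <= b.
Proof.
exists (\sum_i \sum_j sqabs (A i j)) => [|i j].
  by apply: sumr_ge0 => i _; apply: sumr_ge0 => j _; exact: sqabs_ge0.
rewrite (bigD1 i) //= (bigD1 j) //= -addrA lerDl addr_ge0 //.
  by apply: sumr_ge0 => k _; exact: sqabs_ge0.
by apply: sumr_ge0 => k _; apply: sumr_ge0 => l _; exact: sqabs_ge0.
Qed.

Section RandomL2.
Context {d : measure_display} {T : measurableType d} {R : realType} (P : probability T R).
Local Notation C := R[i].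

Lemma L2_l2 (X : T -> C) : L2 P X <-> l2 P setT X.
Proof.
split.
  move=> [LR LI].
  have mR : measurable_fun setT (fun w => complex.Re (X w)).
    by move: LR; rewrite inE => /andP[]; rewrite inE.
  have mI : measurable_fun setT (fun w => complex.Im (X w)).
    by move: LI; rewrite inE => /andP[]; rewrite inE.
  split=> //.
  have iR := Lfun2_integrable_sqr LR; have iI := Lfun2_integrable_sqr LI.
  have /integrableP [_] := integrableD measurableT iR iI.
  congr (_ < _)%E; apply: eq_integral => w _.
  rewrite gee0_abs //; apply: adde_ge0; rewrite lee_fin; exact: sqr_ge0.
move=> [[mR mI] fin].
have H (u : T -> R) : measurable_fun setT u -> (forall w, u w ^+ 2 <= sqabs (X w)) ->
    u \in Lfun P 2%:E.
  move=> mu_ le; rewrite inE; apply/andP; split; rewrite inE //=.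
  rewrite /finite_norm unlock /=; apply: poweR_lty.
  apply: le_lt_trans fin; apply: ge0_le_integral => //.
  - apply/measurable_EFinP.
    apply: (measurableT_comp (measurable_powR 2)); exact: measurableT_comp.
  - exact: cmeas_sqe.
  - by move=> w _; rewrite /= lee_fin -[2]/(2%:R) powR_mulrn // -normrX ger0_norm ?sqr_ge0 // le.
split; apply: H => // w; rewrite /sqabs; [rewrite lerDl|rewrite lerDr]; exact: sqr_ge0.
Qed.
Lemma cE_cintegral (X : T -> C) : Defs.cE P X = cintegral P setT X.
Proof. by rewrite /Defs.cE /cintegral /Rintegral unlock. Qed.

Definition mean_sq q (x : T -> 'cV[C]_q) : \bar R := (\sum_i sqnorm P setT (fun w => x w i 0%R))%E.
Definition vecl2 q (x : T -> 'cV[C]_q) := forall i, l2 P setT (fun w => x w i 0).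

Lemma L2vecP q (x : T -> 'cV[C]_q) : L2vec P x <-> vecl2 x.
Proof. by split=> H i; apply/L2_l2; exact: H. Qed.
Lemma mean_squareE q (x : T -> 'cV[C]_q) : vecl2 x -> mean_square P x = mean_sq x.
Proof.
move=> lx; rewrite /mean_square /mean_sq.
under eq_integral do rewrite -sumEFin.
rewrite ge0_integral_sum //.
- by move=> i; apply: cmeas_sqe; case: (lx i).
- by move=> i w _; rewrite lee_fin sqabs_ge0.
Qed.
Lemma mean_sq_ge0 q (x : T -> 'cV[C]_q) : (0 <= mean_sq x)%E.
Proof. by apply: sume_ge0 => i _; exact: sqnorm_ge0. Qed.
Lemma mean_sq_ext q (x u : T -> 'cV[C]_q) : x =1 u -> mean_sq x = mean_sq u.
Proof. by move=> /funext ->. Qed.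
Lemma vecl2D q (x u : T -> 'cV[C]_q) : vecl2 x -> vecl2 u -> vecl2 (fun w => x w + u w).
Proof.
by move=> lx lu i; apply: l2_ext (l2D measurableT (lx i) (lu i)) => w _; rewrite mxE.
Qed.
Lemma vecl2N q (x : T -> 'cV[C]_q) : vecl2 x -> vecl2 (fun w => - x w).
Proof. by move=> lx i; apply: l2_ext (l2N measurableT (lx i)) => w _; rewrite mxE. Qed.
Lemma vecl2B q (x u : T -> 'cV[C]_q) : vecl2 x -> vecl2 u -> vecl2 (fun w => x w - u w).
Proof. by move=> lx lu; apply: vecl2D => //; exact: vecl2N. Qed.
Lemma vecl2M q n (A : 'M[C]_(q, n)) (x : T -> 'cV[C]_n) : vecl2 x -> vecl2 (fun w => A *m x w).
Proof.
move=> lx i; apply: l2_ext (l2_sum measurableT (index_enum 'I_n)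
   (fun j => l2Z measurableT (A i j) (lx j))) => w _.
by rewrite mxE.
Qed.
Lemma vecl2_sum (I : Type) (s : seq I) q (x : I -> T -> 'cV[C]_q) :
  (forall i, vecl2 (x i)) -> vecl2 (fun w => \sum_(i <- s) x i w).
Proof.
move=> lx j; apply: l2_ext (l2_sum measurableT s (fun i => lx i j)) => w _.
by rewrite summxE.
Qed.
Lemma mean_sqD_le q (x u : T -> 'cV[C]_q) : vecl2 x -> vecl2 u ->
  (mean_sq (fun w => x w + u w)%R <= 2%:E * mean_sq x + 2%:E * mean_sq u)%E.
Proof.
move=> lx lu; rewrite /mean_sq !ge0_sume_distrr; do ?[by move=> i _; exact: sqnorm_ge0].
rewrite -big_split /=; apply: lee_sum => i _.
rewrite (_ : sqnorm P setT _ = sqnorm P setT (fun w => x w i 0 + u w i 0)); last first.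
  by apply: sqnorm_eq => w _; rewrite mxE.
by apply: sqnormD_le => //; [case: (lx i)|case: (lu i)].
Qed.
Lemma mean_sqN q (x : T -> 'cV[C]_q) : mean_sq (fun w => - x w) = mean_sq x.
Proof. by apply: eq_bigr => i _; apply: eq_integral => w _; rewrite mxE sqabsN. Qed.
Lemma mean_sq_fin q (x : T -> 'cV[C]_q) : vecl2 x -> mean_sq x \is a fin_num.
Proof. by move=> lx; apply/sum_fin_numP => i _ _; exact: l2_fin. Qed.

Lemma mean_sqM_le q n (A : 'M[C]_(q, n)) : exists2 B : R, 0 < B & 
  forall x : T -> 'cV[C]_n, vecl2 x -> (mean_sq (fun w => A *m x w) <= B%:E * mean_sq x)%E.
Proof.
have [b b0 Ab] := mx_sqabs_bound A.
pose K := 2 ^+ size (index_enum 'I_n) * b.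
have K0 : 0 <= K by rewrite mulr_ge0 // exprn_ge0.
exists (q%:R * K + 1); first by rewrite ltr_wpDl // mulr_ge0.
move=> x lx.
have key i : (sqnorm P setT (fun w => (A *m x w) i 0%R) <= K%:E * mean_sq x)%E.
  rewrite (_ : sqnorm _ _ _ = sqnorm P setT (fun w => \sum_l A i l * x w l 0)); last first.
    by apply: sqnorm_eq => w _; rewrite mxE.
  by apply: sqnorm_lincomb_le => // l; case: (lx l).
apply: (@le_trans _ _ (\sum_(i < q) K%:E * mean_sq x)%E); first exact: lee_sum.
rewrite -(fineK (mean_sq_fin lx)) -!EFinM sumEFin sumr_const card_ord lee_fin.
rewrite -[(K * _) *+ q]mulr_natl mulrA.
by rewrite ler_wpM2r ?fine_ge0 ?mean_sq_ge0 // lerDl.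
Qed.
End RandomL2.

(** * Filters driven by white noise *)

Section BdregMatrix.
Context {R : realType}.
Local Notation C := R[i].
Local Notation F := (ratfun R).

Definition mxbdreg q n (V : 'M[F]_(q, n)) := forall i j, bdreg (V i j).
Lemma mxbdregD q n (V U : 'M[F]_(q, n)) : mxbdreg V -> mxbdreg U -> mxbdreg (V + U).
Proof. by move=> bV bU i j; rewrite mxE; exact: bdregD. Qed.
Lemma mxbdregN q n (V : 'M[F]_(q, n)) : mxbdreg V -> mxbdreg (- V).
Proof. by move=> bV i j; rewrite mxE; exact: bdregN. Qed.
Lemma mxbdregB q n (V U : 'M[F]_(q, n)) : mxbdreg V -> mxbdreg U -> mxbdreg (V - U).
Proof. by move=> bV bU; apply: mxbdregD => //; exact: mxbdregN. Qed.
Lemma mxbdregM q n k (V : 'M[F]_(q, n)) (U : 'M[F]_(n, k)) :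
  mxbdreg V -> mxbdreg U -> mxbdreg (V *m U).
Proof. by move=> bV bU i j; rewrite mxE; apply: bdreg_sum => l; exact: bdregM. Qed.
Lemma mxbdreg_ratC q n (A : 'M[C]_(q, n)) : mxbdreg (map_mx ratC A).
Proof. by move=> i j; rewrite mxE; exact: bdregC. Qed.
Lemma mxbdreg_laurent q n (s : seq (int * 'M[C]_(q, n))) : mxbdreg (laurent s).
Proof. by move=> i j; rewrite laurent_entry; exact: bdreg_laurent_poly. Qed.
Lemma mxbdregZ q n f (V : 'M[F]_(q, n)) : bdreg f -> mxbdreg V -> mxbdreg (f *: V).
Proof. by move=> bf bV i j; rewrite mxE; exact: bdregM. Qed.
Lemma mxbdreg_fin q n (V : 'M[F]_(q, n)) : mxbdreg V -> mxsqnorm V \is a fin_num.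
Proof.
move=> bV; apply/sum_fin_numP => i _ _; apply/sum_fin_numP => j _ _.
by apply: l2_fin; exact: bdreg_l2.
Qed.
Lemma mxsqnormM_le q n k (A : 'M[C]_(q, n)) : exists2 B : R, 0 < B &
  forall V : 'M[F]_(n, k), mxbdreg V -> (mxsqnorm (map_mx ratC A *m V)%R <= B%:E * mxsqnorm V)%E.
Proof.
have [b b0 Ab] := mx_sqabs_bound A.
pose K := 2 ^+ size (index_enum 'I_n) * b.
have K0 : 0 <= K by rewrite mulr_ge0 // exprn_ge0.
exists (q%:R * K + 1); first by rewrite ltr_wpDl // mulr_ge0.
move=> V bV.
have key i : (\sum_j bdsqnorm ((map_mx ratC A *m V) i j) <= K%:E * mxsqnorm V)%E.
  rewrite /mxsqnorm exchange_big ge0_sume_distrr; last first.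
    by move=> j _; apply: sume_ge0 => l _; exact: sqnorm_ge0.
  apply: lee_sum => j _.
  rewrite (_ : bdsqnorm _ = sqnorm mu circle (fun th => \sum_l A i l * boundary (V l j) th)).
    by apply: sqnorm_lincomb_le => // l; exact: cmeas_boundary.
  apply: sqnorm_eq => th _; rewrite mxE bd_sum => [|l]; last first.
    by apply: bdregM; [rewrite ?mxE; exact: bdregC|exact: bV].
  apply: eq_bigr => l _; rewrite ?mxE bdM ?bdC //; [exact: bdregC|exact: bV].
apply: (@le_trans _ _ (\sum_(i < q) K%:E * mxsqnorm V)%E).
  by rewrite [leLHS]/mxsqnorm; apply: lee_sum => i _; exact: key.
rewrite -(fineK (mxbdreg_fin bV)) -!EFinM sumEFin sumr_const card_ord lee_fin.
rewrite -[(K * _) *+ q]mulr_natl mulrA.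
by rewrite ler_wpM2r ?fine_ge0 ?mxsqnorm_ge0 // lerDl.
Qed.
End BdregMatrix.

Section Transport.
Context {R : realType} {d : measure_display} {T : measurableType d} (P : probability T R).
Local Notation C := R[i].
Local Notation F := (ratfun R).
Variables (m : nat) (e : int -> T -> 'cV[C]_m).
Hypothesis el2 : forall t, vecl2 P (e t).
Hypothesis ecov : forall s t, cov P (e s) (e t) = if s == t then 1%:M else 0.

Lemma vecl2_laurent_apply q n (s : seq (int * 'M[C]_(q, n))) (v : int -> T -> 'cV[C]_n) t :
  (forall t, vecl2 P (v t)) -> vecl2 P (laurent_apply s v t).
Proof. by move=> lv; apply: vecl2_sum => a; exact: vecl2M. Qed.

Lemma cintegral_noise (s t : int) (i j : 'I_m) :
  cintegral P setT (fun w => e s w i 0 * conjc (e t w j 0)) = ((s == t) && (i == j))%:R.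
Proof.
have := congr1 (fun A => fun_of_matrix A i j) (ecov s t).
rewrite mxE cE_cintegral => ->; case: eqP => _; last by rewrite mxE.
by rewrite mxE.
Qed.

Lemma twopiK (z : C) : ((pi *+ 2)^-1)%:C * ((pi *+ 2)%:C * z) = z.
Proof. by rewrite mulrA -rmorphM mulVf ?twopi_neq0 // mul1r. Qed.

(** Both sides are the sum over equal delays of products of
    coefficients, by whiteness of e on the left and by orthogonality of the
    exponentials on the right. *)
Lemma laurent_isometry q1 q2 (s : seq (int * 'M[C]_(q1, m))) (s' : seq (int * 'M[C]_(q2, m)))
    (t : int) i j :
  cintegral P setT (fun w => laurent_apply s e t w i 0 * conjc (laurent_apply s' e t w j 0)) =
  ((pi *+ 2)^-1)%:C * \sum_l cintegral mu (@circle R)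
    (fun th => boundary (laurent s i l) th * conjc (boundary (laurent s' j l) th)).
Proof.
pose S := \sum_(a <- s) \sum_(b <- s') \sum_l (a.1 == b.1)%:R * (a.2 i l * conjc (b.2 j l)).
transitivity S.
  have ie (x y : int) k l : cintegrable P setT (fun w => e x w k 0 * conjc (e y w l 0)).
    by apply: l2M_cintegrable => //; exact: el2.
  transitivity (cintegral P setT (fun w => \sum_(a <- s) \sum_(b <- s') \sum_k \sum_l
      a.2 i k * conjc (b.2 j l) * (e (t - a.1) w k 0 * conjc (e (t - b.1) w l 0)))).
    apply: cintegral_eq => w _; rewrite /laurent_apply !summxE mulr_suml.
    apply: eq_bigr => a _; rewrite conjc_sum mulr_sumr; apply: eq_bigr => b _.
    rewrite !mxE mulr_suml; apply: eq_bigr => k _.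
    by rewrite conjc_sum mulr_sumr; apply: eq_bigr => l _; rewrite conjc_mul mulrACA.
  have i1 a b k l : cintegrable P setT (fun w : T =>
      a * conjc b * (e k.1 w k.2 0 * conjc (e l.1 w l.2 0))).
    exact: cintegrableZ.
  rewrite cintegral_sum // => [|a]; last first.
    apply: cintegrable_sum => // b; apply: cintegrable_sum => // k.
    apply: cintegrable_sum => // l; exact: (i1 _ _ (_, _) (_, _)).
  apply: eq_bigr => a _; rewrite cintegral_sum // => [|b]; last first.
    apply: cintegrable_sum => // k.
    apply: cintegrable_sum => // l; exact: (i1 _ _ (_, _) (_, _)).
  apply: eq_bigr => b _; rewrite cintegral_sum // => [|k]; last first.
    apply: cintegrable_sum => // l; exact: (i1 _ _ (_, _) (_, _)).
  apply: eq_bigr => k _; rewrite cintegral_sum // => [|l]; last exact: (i1 _ _ (_, _) (_, _)).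
  rewrite (bigD1 k) //= cintegralZ // cintegral_noise big1 => [|l lk]; last first.
    by rewrite cintegralZ // cintegral_noise [k == l]eq_sym (negbTE lk) andbF mulr0.
  rewrite addr0 eqxx andbT mulrC; congr (_ %:R * _).
  by rewrite (inj_eq (addrI _)) eqr_opp.
transitivity (((pi *+ 2)^-1)%:C * \sum_l cintegral mu (@circle R) (fun th =>
    laurent_val [seq (a.1, fun_of_matrix a.2 i l) | a <- s] th *
    conjc (laurent_val [seq (a.1, fun_of_matrix a.2 j l) | a <- s'] th))); last first.
  congr (_ * _); apply: eq_bigr => l _; apply: cintegral_eq => th _.
  by rewrite !laurent_entry !bd_laurent_poly.
under [in RHS]eq_bigr do rewrite cintegral_lpv big_map.
rewrite -mulr_sumr twopiK [RHS]exchange_big /=; apply: eq_bigr => a _.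
rewrite [LHS]exchange_big /=; apply: eq_bigr => l _.
by rewrite big_map.
Qed.

(** The output V(z) e(t), as a simultaneous limit of Laurent polynomials in
    mean square and on the circle.  The absence of poles on the circle makes
    boundary values additive and multiplicative at every angle. *)
Definition noise_output q (V : 'M[F]_(q, m)) (t : int) (x : T -> 'cV[C]_q) :=
  [/\ mxbdreg V, vecl2 P x & forall eps : R, 0 < eps ->
    exists s : seq (int * 'M[C]_(q, m)),
      (mean_sq P (fun w => x w - laurent_apply s e t w)%R < eps%:E)%E /\
      (mxsqnorm (V - laurent s)%R < eps%:E)%E].

Lemma noise_output_laurent q (s : seq (int * 'M[C]_(q, m))) t :
  noise_output (laurent s) t (laurent_apply s e t).
Proof.
split; [exact: mxbdreg_laurent|exact: vecl2_laurent_apply|move=> eps e0; exists s].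
split; rewrite ?subrr.
  rewrite /mean_sq big1 ?lte_fin // => i _; rewrite /sqnorm integral0_eq // => w _.
  by rewrite subrr mxE sqabs0.
rewrite /mxsqnorm big1 ?lte_fin // => i _; rewrite big1 // => j _.
by rewrite mxE bdsqnorm0.
Qed.

Lemma noise_outputD q (V U : 'M[F]_(q, m)) t x u : noise_output V t x -> noise_output U t u ->
  noise_output (V + U) t (fun w => x w + u w).
Proof.
move=> [bV lx Hx] [bU lu Hu]; split; [exact: mxbdregD|exact: vecl2D|].
move=> eps e0; have e4 : 0 < eps / 4 by lra.
have [s [s1 s2]] := Hx _ e4; have [s' [s1' s2']] := Hu _ e4.
have ls := vecl2B lx (vecl2_laurent_apply (q:=q) s t el2).
have ls' := vecl2B lu (vecl2_laurent_apply (q:=q) s' t el2).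
have e5 : 2 * (eps / 4) + 2 * (eps / 4) <= eps by lra.
exists (s ++ s'); split.
  apply: lt_double_sum _ (mean_sq_ge0 _ _) (mean_sq_ge0 _ _) s1 s1' e5.
  apply: le_trans (mean_sqD_le ls ls'); rewrite le_eqVlt; apply/orP; left; apply/eqP.
  by apply: mean_sq_ext => w; rewrite /laurent_apply big_cat /= opprD addrACA.
apply: lt_double_sum _ (mxsqnorm_ge0 _) (mxsqnorm_ge0 _) s2 s2' e5.
apply: le_trans (mxsqnormD_le _ _); rewrite le_eqVlt; apply/orP; left; apply/eqP.
by rewrite laurent_cat opprD addrACA.
Qed.

Lemma noise_outputM q n (A : 'M[C]_(n, q)) (V : 'M[F]_(q, m)) t x : noise_output V t x ->
  noise_output (map_mx ratC A *m V) t (fun w => A *m x w).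
Proof.
move=> [bV lx Hx]; split.
- by apply: mxbdregM => //; exact: mxbdreg_ratC.
- exact: vecl2M.
move=> eps e0; have [B B0 HB] := mxsqnormM_le m A; have [B' B0' HB'] := mean_sqM_le P A.
pose M := B + B'; have M0 : 0 < M by rewrite addr_gt0.
have e1 : 0 < eps / M by rewrite divr_gt0.
have [s [s1 s2]] := Hx _ e1.
have ls := vecl2B lx (vecl2_laurent_apply (q:=q) s t el2).
have fin2 (a c : \bar R) (b : R) : (c <= b%:E * a)%E -> b <= M -> (0 <= a)%E ->
    (a < (eps / M)%:E)%E -> (c < eps%:E)%E.
  move=> h bM a0 ha; apply: le_lt_trans h _.
  have fa : a \is a fin_num by rewrite ge0_fin_numE // (lt_trans ha) ?ltry.
  move: ha; rewrite -(fineK fa) -EFinM !lte_fin ltr_pdivlMr // mulrC.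
  by apply: le_lt_trans; rewrite ler_wpM2r // fine_ge0.
exists [seq (a.1, A *m a.2) | a <- s]; split.
  have -> : (fun w => A *m x w - laurent_apply [seq (a.1, A *m a.2) | a <- s] e t w) =
      (fun w => A *m (x w - laurent_apply s e t w)).
    apply/funext => w; rewrite mulmxBr; congr (_ - _).
    rewrite /laurent_apply big_map mulmx_sumr; apply: eq_bigr => a _.
    by rewrite mulmxA.
  by apply: fin2 (HB' _ ls) _ (mean_sq_ge0 _ _) s1; rewrite /M lerDr ltW.
have -> : map_mx ratC A *m V - laurent [seq (a.1, A *m a.2) | a <- s] =
    map_mx ratC A *m (V - laurent s).
  rewrite mulmxBr; congr (_ - _).
  rewrite /laurent big_map mulmx_sumr; apply: eq_bigr => a _.
  by rewrite map_mxM -scalemxAr.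
apply: fin2 (HB _ (mxbdregB bV (mxbdreg_laurent s))) _ (mxsqnorm_ge0 _) s2.
by rewrite /M lerDl ltW.
Qed.

Lemma noise_outputN q (V : 'M[F]_(q, m)) t x : noise_output V t x ->
  noise_output (- V) t (fun w => - x w).
Proof.
move=> /(noise_outputM (- 1%:M)).
have -> : map_mx ratC (- 1%:M : 'M[C]_q) = - 1%:M by rewrite map_mxN map_mx1.
rewrite mulNmx mul1mx (_ : (fun w => - 1%:M *m x w) = (fun w => - x w)) //.
by apply/funext => w; rewrite mulNmx mul1mx.
Qed.
Lemma noise_outputB q (V U : 'M[F]_(q, m)) t x u : noise_output V t x -> noise_output U t u ->
  noise_output (V - U) t (fun w => x w - u w).
Proof. by move=> eV /noise_outputN eU; exact: noise_outputD. Qed.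

Lemma bd_shift (k : int) (f : F) (th : R) : bdreg f ->
  sqabs (boundary (ratX ^ k * f) th) = sqabs (boundary f th).
Proof. by move=> bf; rewrite bdM ?bdXz ?sqabsM ?sqabs_expi ?mul1r //; exact: bdregXz. Qed.
Lemma mxsqnorm_shift q (k : int) (V : 'M[F]_(q, m)) : mxbdreg V ->
  mxsqnorm (ratX ^ k *: V) = mxsqnorm V.
Proof.
move=> bV; apply: eq_bigr => i _; apply: eq_bigr => j _; apply: eq_integral => th _.
by rewrite mxE bd_shift //; exact: bV.
Qed.

Lemma noise_output_shift q (V : 'M[F]_(q, m)) (k t : int) x : noise_output V (t - k) x ->
  noise_output (ratX ^ (- k) *: V) t x.
Proof.
move=> [bV lx Hx]; split; [|exact: lx|].
  by apply: mxbdregZ => //; exact: bdregXz.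
move=> eps e0; have [s [s1 s2]] := Hx _ e0.
exists [seq (a.1 + k, a.2) | a <- s]; split.
  rewrite (_ : laurent_apply _ e t = laurent_apply s e (t - k)) //.
  apply/funext => w; rewrite /laurent_apply big_map; apply: eq_bigr => a _ /=.
  by congr (_ *m e _ w); rewrite opprD addrA addrAC.
rewrite (_ : laurent _ = ratX ^ (- k) *: laurent s).
  by rewrite -scalerBr mxsqnorm_shift //; apply: mxbdregB => //; exact: mxbdreg_laurent.
rewrite /laurent big_map scaler_sumr; apply: eq_bigr => a _ /=.
by rewrite scalerA -expfzDr ?ratX_neq0 // opprD addrC.
Qed.

Lemma noise_output_sum (I : Type) (s : seq I) q (V : I -> 'M[F]_(q, m)) t x :
  (forall i, noise_output (V i) t (x i)) ->
  noise_output (\sum_(i <- s) V i) t (fun w => \sum_(i <- s) x i w).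
Proof.
move=> H; elim: s => [|i s IH].
  have := noise_output_laurent (q := q) [::] t; rewrite /laurent !big_nil.
  rewrite (_ : laurent_apply _ _ _ = fun w => \sum_(i <- [::]) x i w) //.
  by apply/funext => w; rewrite /laurent_apply !big_nil.
rewrite big_cons (_ : (fun w => _) = (fun w => x i w + \sum_(i <- s) x i w)).
  exact: (noise_outputD (H i) IH).
by apply/funext => w; rewrite big_cons.
Qed.

Lemma noise_output_apply q n (W : 'M[F]_(n, m)) (v : int -> T -> 'cV[C]_n)
    (s : seq (int * 'M[C]_(q, n))) t : (forall t, noise_output W t (v t)) ->
  noise_output (laurent s *m W) t (laurent_apply s v t).
Proof.
move=> H; rewrite /laurent mulmx_suml.
apply: (@noise_output_sum _ s q (fun a => ratX ^ (- a.1) *: map_mx ratC a.2 *m W) t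
  (fun a w => a.2 *m v (t - a.1) w)) => a.
by rewrite -scalemxAl; apply: noise_output_shift; apply: noise_outputM.
Qed.

(** The case of Laurent polynomials extends by continuity of the
    inner products. *)
Lemma noise_output_isometry q1 q2 (V : 'M[F]_(q1, m)) (U : 'M[F]_(q2, m)) t x u i j :
  noise_output V t x -> noise_output U t u ->
  cintegral P setT (fun w => x w i 0 * conjc (u w j 0)) =
  ((pi *+ 2)^-1)%:C * \sum_l cintegral mu (@circle R)
    (fun th => boundary (V i l) th * conjc (boundary (U j l) th)).
Proof.
move=> [bV lx Hx] [bU lu Hu].
have bu (h : unit -> C) : \sum_l h l = h tt by rewrite (big_pred1 tt) // => -[].
have bu' (h : unit -> R) : \sum_l h l = h tt by rewrite (big_pred1 tt) // => -[].
have mc := @measurable_circle R.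
have lV q (V' : 'M[F]_(q, m)) k : mxbdreg V' -> fam_l2 mu (@circle R) (fun l => boundary (V' k l)).
  by move=> bV' l; exact: bdreg_l2.
have := @fam_inner_transfer R _ _ _ _ P setT mu (@circle R) measurableT mc unit 'I_m
  (pi *+ 2)^-1 (fun=> fun w => x w i 0) (fun=> fun w => u w j 0)
  (fun l => boundary (V i l)) (fun l => boundary (U j l)).
rewrite /fam_inner !bu; apply => //.
- exact: lV.
- exact: lV.
move=> eps e0; have [s [s1 s2]] := Hx _ e0; have [s' [s1' s2']] := Hu _ e0.
exists (fun=> fun w => laurent_apply s e t w i 0), (fun=> fun w => laurent_apply s' e t w j 0).
exists (fun l => boundary (laurent s i l)), (fun l => boundary (laurent s' j l)).
have small q (x' : T -> 'cV[C]_q) k s0 : vecl2 P x' ->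
    (mean_sq P (fun w => x' w - laurent_apply s0 e t w)%R < eps%:E)%E ->
    fam_sqnorm P setT (fun _ : unit => fun w => x' w k 0 - laurent_apply s0 e t w k 0) < eps.
  move=> lx' h; rewrite /fam_sqnorm bu' -lte_fin fineK; last first.
    by apply: l2_fin; apply: l2B => //; exact: vecl2_laurent_apply.
  apply: le_lt_trans h; rewrite /mean_sq (bigD1 k) //=.
  rewrite (_ : sqnorm P setT (fun w => x' w k 0 - _) =
    sqnorm P setT (fun w => (x' w - laurent_apply s0 e t w) k 0)).
    by rewrite leeDl //; apply: sume_ge0 => l _; exact: sqnorm_ge0.
  by apply: sqnorm_eq => w _; rewrite !mxE.
have small' q (V' : 'M[F]_(q, m)) k s0 : mxbdreg V' -> (mxsqnorm (V' - laurent s0)%R < eps%:E)%E ->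
    fam_sqnorm mu (@circle R) (fun l th =>
      boundary (V' k l) th - boundary (laurent s0 k l) th) < eps.
  move=> bV' h; rewrite /fam_sqnorm -lte_fin -sumEFin.
  apply: le_lt_trans h; rewrite /mxsqnorm (bigD1 k) //=.
  apply: (@le_trans _ _ (\sum_j0 bdsqnorm ((V' - laurent s0)%R k j0))%E); last first.
    rewrite leeDl //; apply: sume_ge0 => l _; apply: sume_ge0 => l' _; exact: sqnorm_ge0.
  apply: lee_sum => l _.
  have rl : bdreg (laurent s0 k l) by exact: mxbdreg_laurent.
  rewrite fineK; last by apply: l2_fin; apply: l2B => //; exact: bdreg_l2.
  rewrite le_eqVlt; apply/orP; left; apply/eqP; apply: sqnorm_eq => th _.
  by rewrite !mxE bdB.
split.
- split; first by move=> _; exact: vecl2_laurent_apply.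
  + by move=> _; exact: vecl2_laurent_apply.
  + by apply: lV; exact: mxbdreg_laurent.
  + by apply: lV; exact: mxbdreg_laurent.
- by split; exact: small.
- by split; exact: small'.
- by rewrite !bu laurent_isometry.
Qed.

Lemma noise_output_mean_sq q (V : 'M[F]_(q, m)) t x : noise_output V t x ->
  mean_sq P x = (((pi *+ 2)^-1)%:E * mxsqnorm V)%E.
Proof.
move=> eV; case: (eV) => bV lx _.
rewrite -(fineK (mxbdreg_fin bV)) -(fineK (mean_sq_fin lx)) -EFinM; congr (_%:E).
rewrite -sum_fine; last by move=> i _; exact: l2_fin.
rewrite -sum_fine; last by move=> i _; apply/sum_fin_numP => j _ _; apply: l2_fin; exact: bdreg_l2.
rewrite mulr_sumr; apply: eq_bigr => i _.
have := noise_output_isometry i i eV eV; rewrite cintegral_sqE // => E.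
rewrite -sum_fine; last by move=> j _; apply: l2_fin; exact: bdreg_l2.
apply: complexI; rewrite rmorphM rmorph_sum /= E; congr (_ * _).
by apply: eq_bigr => l _; rewrite cintegral_sqE //; exact: bdreg_l2.
Qed.
End Transport.

(** * Existence of filter outputs *)

Section Small.
Context {R : realType}.
Lemma pow8_small (eps : R) : 0 < eps -> exists n, 8^-1 ^+ n < eps.
Proof.
move=> e0; exists (Num.truncn eps^-1).
have h := truncnS_gt eps^-1; set n := Num.truncn _ in h *.
have h8 : n.+1%:R <= 8 ^+ n :> R by rewrite -natrX ler_nat ltn_expl.
rewrite exprVn -[eps]invrK ltf_pV2 ?posrE ?exprn_gt0 ?invr_gt0 //.
exact: lt_le_trans h h8.
Qed.
Lemma inv2pi_gt0 : 0 < (pi *+ 2)^-1 :> R.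
Proof. by rewrite invr_gt0 mulrn_wgt0 // pi_gt0. Qed.
Lemma inv2pi_le1 : (pi *+ 2)^-1 <= 1 :> R.
Proof.
have p2 := @pi_ge2 R; have p0 : 0 < pi *+ 2 :> R by rewrite mulr2n; lra.
by rewrite invf_le1 // mulr2n; lra.
Qed.
Lemma inv2pi_mul_lt (x : \bar R) (eps : R) : (0 <= x)%E -> (x < eps%:E)%E ->
  (((pi *+ 2)^-1)%:E * x < eps%:E)%E.
Proof.
move=> x0; apply: le_lt_trans; rewrite -[leRHS]mul1e.
by apply: lee_wpmul2r => //; rewrite lee_fin inv2pi_le1.
Qed.
Lemma inv2pi_mul_lt_cancel (x : \bar R) (eps : R) : (0 <= x)%E ->
  (((pi *+ 2)^-1)%:E * x < ((pi *+ 2)^-1 * eps)%:E)%E -> (x < eps%:E)%E.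
Proof. by move=> x0; rewrite EFinM lte_pmul2l // lte_fin inv2pi_gt0. Qed.
Lemma mxsqnormN q n (V : 'M[ratfun R]_(q, n)) : mxbdreg V -> mxsqnorm (- V) = mxsqnorm V.
Proof.
move=> bV; apply: eq_bigr => i _; apply: eq_bigr => j _; apply: eq_integral => th _.
rewrite mxE; have [_ h] := regN (bV i j _ (sqabs_expi th)).
by rewrite -[boundary _ _]/(ev _ _) h sqabsN.
Qed.
End Small.

Section Outputs.
Context {R : realType} {d : measure_display} {T : measurableType d} (P : probability T R).
Local Notation C := R[i].
Local Notation F := (ratfun R).
Variables (m : nat) (e : int -> T -> 'cV[C]_m).
Hypothesis el2 : forall t, vecl2 P (e t).
Hypothesis ecov : forall s t, cov P (e s) (e t) = if s == t then 1%:M else 0.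

Lemma stab_laurent_dense q n (V : 'M[F]_(q, n)) (eps : R) : (forall i j, stab (V i j)) ->
  0 < eps -> exists s : seq (int * 'M[C]_(q, n)), (mxsqnorm (V - laurent s)%R < eps%:E)%E.
Proof.
move=> sV e0.
have b1 i j : bdreg ((1%:M : 'M[F]_n) i j).
  by rewrite mxE; case: (i == j); [exact: bdreg1|rewrite mulr0n -(rmorph0 (@ratC R));
    exact: bdregC].
have [s _ h] := @beurling R xpredT isT (fun _ _ _ _ => isT) isT n n q 1%:M V eps
  (mxrank1 _ _) (or_intror isT) b1 sV e0.
by exists s; rewrite mulmx1 in h.
Qed.

(** By the isometry, Laurent polynomials that approximate V on the
    circle have outputs that form a Cauchy sequence. *)
Lemma noise_output_exists q (V : 'M[F]_(q, m)) t : (forall i j, stab (V i j)) ->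
  exists x, noise_output P e V t x.
Proof.
move=> sV; have bV : mxbdreg V by move=> i j; exact: stab_bdreg.
have p8 n : 0 < 8^-1 ^+ n :> R by rewrite exprn_gt0.
have /choice [s Hs] : forall n : nat, exists s : seq (int * 'M[C]_(q, m)),
    (mxsqnorm (V - laurent s)%R < (8^-1 ^+ n / 4)%:E)%E.
  by move=> n; apply: stab_laurent_dense => //; rewrite divr_gt0.
pose x n := laurent_apply (s n) e t.
have lx n : vecl2 P (x n) by exact: vecl2_laurent_apply.
have cauchy n k : (n <= k)%N -> (mean_sq P (fun w => x k w - x n w)%R <= (8^-1 ^+ n)%:E)%E.
  move=> nk.
  have ee := noise_outputB el2 (noise_output_laurent el2 (s k) t) (noise_output_laurent el2 (s n) t).
  rewrite (noise_output_mean_sq el2 ecov ee).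
  have bn j : mxbdreg (V - laurent (s j)) by apply: mxbdregB => //; exact: mxbdreg_laurent.
  have -> : laurent (s k) - laurent (s n) = (V - laurent (s n)) - (V - laurent (s k)).
    by rewrite opprB addrCA addrAC subrr add0r.
  apply: (@le_trans _ _ (mxsqnorm (V - laurent (s n) - (V - laurent (s k))))).
    rewrite -[leRHS]mul1e; apply: lee_wpmul2r; first exact: mxsqnorm_ge0.
    by rewrite lee_fin inv2pi_le1.
  have hk := Hs k; rewrite -mxsqnormN // in hk.
  apply: ltW; apply: lt_double_sum (mxsqnormD_le _ _) (mxsqnorm_ge0 _) (mxsqnorm_ge0 _) (Hs n) hk _.
  have : 8^-1 ^+ k <= 8^-1 ^+ n :> R by apply: ler_wiXn2l => //; lra.
  move: (8^-1 ^+ k) (8^-1 ^+ n) => u v; lra.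
have comp n k i : (n <= k)%N ->
    (sqnorm P setT (fun w => x k w i 0 - x n w i 0)%R <= (8^-1 ^+ n)%:E)%E.
  move=> nk; apply: le_trans (cauchy n k nk); rewrite /mean_sq (bigD1 i) //=.
  rewrite (_ : sqnorm P setT (fun w => x k w i 0 - _) =
    sqnorm P setT (fun w => (x k w - x n w) i 0)).
    by rewrite leeDl //; apply: sume_ge0 => l _; exact: sqnorm_ge0.
  by apply: sqnorm_eq => w _; rewrite !mxE.
have part (pr : C -> R) i : (forall n, measurable_fun setT (fun w => pr (x n w i 0))) ->
    (forall z1 z2, (pr z1 - pr z2) ^+ 2 <= sqabs (z1 - z2)) ->
    exists2 v : T -> R, measurable_fun setT v & forall n,
    (\int[P]_(w in setT) ((v w - pr (x n w i 0)) ^+ 2)%:E <= (8^-1 ^+ n)%:E)%E.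
  move=> mp hp; apply: (@riesz_fischer_real _ _ _ P setT measurableT
    (fun n w => pr (x n w i 0))) => // n k nk.
  apply: le_trans (comp n k i nk); apply: ge0_le_integral => //.
  - by move=> w _; rewrite lee_fin sqr_ge0.
  - by apply/measurable_EFinP; apply: measurable_funX; exact: measurable_funB.
  - by case: (l2B measurableT (lx k i) (lx n i)) => ? _; exact: cmeas_sqe.
  - by move=> w _; rewrite lee_fin hp.
have /fin_all_exists2 [vr mvr Hr] : forall i, exists2 v : T -> R, measurable_fun setT v &
    forall n, (\int[P]_(w in setT) ((v w - complex.Re (x n w i 0)) ^+ 2)%:E <= (8^-1 ^+ n)%:E)%E.
  move=> i; apply: part => [n|z1 z2]; first by case: (lx n i) => -[].
  by rewrite /sqabs !ReImE lerDl sqr_ge0.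
have /fin_all_exists2 [vi mvi Hi] : forall i, exists2 v : T -> R, measurable_fun setT v &
    forall n, (\int[P]_(w in setT) ((v w - complex.Im (x n w i 0)) ^+ 2)%:E <= (8^-1 ^+ n)%:E)%E.
  move=> i; apply: part => [n|z1 z2]; first by case: (lx n i) => -[].
  by rewrite /sqabs !ReImE lerDr sqr_ge0.
pose xi w := \col_i (vr i w +i* vi i w).
have mxi i : cmeas setT (fun w => xi w i 0).
  apply: (@cmeas_ext _ _ _ _ (fun w => vr i w +i* vi i w)); last by split; [exact: mvr|exact: mvi].
  by move=> w _; rewrite mxE.
have close n i : (sqnorm P setT (fun w => (xi w - x n w)%R i 0%R) <= (2 * 8^-1 ^+ n)%:E)%E.
  have -> : sqnorm P setT (fun w => (xi w - x n w) i 0) =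
     (\int[P]_(w in setT) (((vr i w - complex.Re (x n w i 0)) ^+ 2)%:E +
        ((vi i w - complex.Im (x n w i 0)) ^+ 2)%:E))%E.
    by apply: eq_integral => w _; rewrite /sqabs !mxE !ReImE /= EFinD.
  have [mr mi] : cmeas setT (fun w => x n w i 0) by case: (lx n i).
  rewrite ge0_integralD //; do ?[by move=> w _; rewrite lee_fin sqr_ge0|
    by apply/measurable_EFinP; apply: measurable_funX; exact: measurable_funB].
  by rewrite mulr_natl mulr2n EFinD; apply: leeD; [exact: Hr|exact: Hi].
have lxi : vecl2 P xi.
  move=> i.
  have ld : l2 P setT (fun w => (xi w - x 0%N w) i 0).
    split; last exact: le_lt_trans (close 0%N i) (ltry _).
    apply: (@cmeas_ext _ _ _ _ (fun w => xi w i 0 + (-1) * x 0%N w i 0)).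
      by move=> w _; rewrite !mxE mulN1r.
    apply: cmeasD; first exact: mxi.
    by apply: cmeasM; [exact: cmeas_cst|case: (lx 0%N i)].
  apply: l2_ext (l2D measurableT ld (lx 0%N i)) => w _.
  by rewrite !mxE subrK.
exists xi; split=> // eps e0.
have e1 : 0 < eps / (2 * q%:R + 1) by rewrite divr_gt0 // ltr_wpDl // mulr_ge0.
have [n hn] := pow8_small e1.
exists (s n); split.
  apply: (@le_lt_trans _ _ (\sum_(i < q) (2 * 8^-1 ^+ n)%:E)%E).
    by apply: lee_sum => i _; exact: close.
  rewrite sumEFin sumr_const card_ord -[X in X%:E]mulr_natl lte_fin.
  move: hn; rewrite ltr_pdivlMr; last by rewrite ltr_wpDl // mulr_ge0.
  have := p8 n; lra.
apply: lt_le_trans (Hs n) _; rewrite lee_fin.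
have h2 : eps / (2 * q%:R + 1) <= eps.
  rewrite ler_pdivrMr; last by rewrite ltr_wpDl // mulr_ge0.
  by rewrite mulrDr mulr1 lerDr; apply: mulr_ge0; [exact: ltW|exact: mulr_ge0].
by have := p8 n; lra.
Qed.

Lemma mx1_star n : (1%:M : 'M[F]_n) = 1%:M *m mxstar 1%:M.
Proof. by rewrite mxstar1 mulmx1. Qed.

(** For white noise the density is the identity, and the two
    notions of output differ by the factor 1 / (2 pi) in the norm. *)
Lemma filter_output_noise_output q (V : 'M[F]_(q, m)) t x : mxbdreg V ->
  filter_output P e 1%:M V t x -> noise_output P e V t x.
Proof.
move=> bV [lx Hx]; have lx' : vecl2 P x by exact/L2vecP.
split=> // eps e0.
have e1 : 0 < (pi *+ 2)^-1 * eps by rewrite mulr_gt0 // inv2pi_gt0.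
have [s []] := Hx _ e1.
rewrite mean_squareE; last by apply: vecl2B => //; exact: vecl2_laurent_apply.
rewrite (spectral_norm2E _ (mx1_star m)) mulmx1 => h1 h2; exists s; split.
  apply: lt_le_trans h1 _; rewrite lee_fin -[leRHS]mul1r ler_wpM2r ?inv2pi_le1 //.
  exact: ltW.
exact: inv2pi_mul_lt_cancel (mxsqnorm_ge0 _) h2.
Qed.

Lemma noise_output_filter_output q (V : 'M[F]_(q, m)) t x : noise_output P e V t x ->
  filter_output P e 1%:M V t x.
Proof.
move=> [bV lx Hx]; split; first exact/L2vecP.
move=> eps e0; have [s [h1 h2]] := Hx _ e0; exists s; split.
  by rewrite mean_squareE //; apply: vecl2B => //; exact: vecl2_laurent_apply.
rewrite (spectral_norm2E _ (mx1_star m)) mulmx1.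
by apply: inv2pi_mul_lt => //; exact: mxsqnorm_ge0.
Qed.

Section Process.
Variables (n : nat) (v : int -> T -> 'cV[C]_n) (W : 'M[F]_(n, m)) (Phi : 'M[F]_n).
Hypothesis ev : forall t, noise_output P e W t (v t).
Hypothesis PhiE : Phi = W *m mxstar W.

Lemma process_l2 t : vecl2 P (v t).
Proof. by case: (ev t). Qed.

(** As v is itself an output of e, the isometry turns an
    approximation of A W by products s W into an approximation of A in L2(Phi)
    and of the output in mean square, wherever the poles of A may be. *)
Lemma process_filter_output q (A : 'M[F]_(q, n)) t x : noise_output P e (A *m W) t x ->
  (forall eps : R, 0 < eps -> exists s : seq (int * 'M[C]_(q, n)),
    (mxsqnorm (A *m W - laurent s *m W)%R < eps%:E)%E) ->
  filter_output P v Phi A t x.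
Proof.
move=> ex H; have [_ lx _] := ex; split; first exact/L2vecP.
move=> eps e0; have [s hs] := H _ e0; exists s.
rewrite mean_squareE; last by apply: vecl2B => //; apply: vecl2_laurent_apply => //;
  exact: process_l2.
rewrite (noise_output_mean_sq el2 ecov (noise_outputB el2 ex (noise_output_apply el2 s t ev))).
rewrite (spectral_norm2E _ PhiE) mulmxBl.
by split; apply: inv2pi_mul_lt => //; exact: mxsqnorm_ge0.
Qed.
End Process.
End Outputs.

(** * The one-step ahead Wiener filter *)

Lemma mul_star_bd (R : realType) a b c (V : 'M[ratfun R]_(a, b)) (U : 'M[ratfun R]_(c, b))
    i j (th : R) : mxbdreg V -> mxbdreg U -> boundary ((V *m mxstar U) i j) th =
  \sum_l boundary (V i l) th * conjc (boundary (U j l) th).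
Proof.
move=> bV bU; have st l : mxstar U l j = rstar (U j l) by rewrite !mxE.
have rs l : bdreg (rstar (U j l)) by apply: bdreg_rstar; exact: bU.
rewrite mxE bd_sum => [|l]; last by rewrite st; apply: bdregM; [exact: bV|exact: rs].
apply: eq_bigr => l _; rewrite st bdM; [|exact: bV|exact: rs].
by rewrite bd_rstar //; exact: bU.
Qed.

Lemma laurent_shift (R : realType) q n (s : seq (int * 'M[R[i]]_(q, n))) :
  laurent [seq (a.1 + 1, a.2) | a <- s] = ratX^-1 *: laurent s.
Proof.
rewrite /laurent big_map scaler_sumr; apply: eq_bigr => a _ /=.
by rewrite scalerA -exprN1 -expfzDr ?ratX_neq0 // opprD addrC.
Qed.

Lemma subr_chain (V : zmodType) (a b c d : V) :
  a - b = (a - c) + ((c - d) + - (b - d)).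
Proof. by rewrite opprB [c - d + _]addrA subrK addrA subrK. Qed.
Lemma subr_detour (V : zmodType) (a b c d : V) :
  c - d = (a - b) + ((b - d) + - (a - c)).
Proof. by rewrite opprB addrA [a - b + _]addrA subrK addrC addrA subrK. Qed.

Section Wiener.
Context {R : realType} {d : measure_display} {T : measurableType d} (P : probability T R).
Local Notation C := R[i].
Local Notation F := (ratfun R).
Variables (m p r : nat) (e : int -> T -> 'cV[C]_m).
Hypothesis el2 : forall t, vecl2 P (e t).
Hypothesis ecov : forall s t, cov P (e s) (e t) = if s == t then 1%:M else 0.
Variables (y1 : int -> T -> 'cV[C]_m) (y2 : int -> T -> 'cV[C]_p).
Variables (W1 : 'M[F]_m) (W2 : 'M[F]_(p, m)) (G : 'M[F]_(p, r)) (Q : 'M[F]_(r, m)).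
Hypothesis sW1 : forall i j, stab (W1 i j).
Hypothesis sW2 : forall i j, stab (W2 i j).
Hypothesis sQ : forall i j, stab (Q i j).
Hypothesis mpG : minimum_phase G.
Hypothesis rG : \rank G = r.
Hypothesis W2E : W2 = G *m Q.
Hypothesis QQ : Q *m mxstar Q = 1%:M.
Hypothesis ey1 : forall t, noise_output P e W1 t (y1 t).
Hypothesis ey2 : forall t, noise_output P e W2 t (y2 t).
Variable Phi22 : 'M[F]_p.
Hypothesis PhiW : Phi22 = W2 *m mxstar W2.

Let M := ratX *: (W1 *m mxstar Q).
Let X := hardy_proj M.
Let K := W1 - ratX^-1 *: (X *m Q).

Lemma stab_mxbdreg a b (V : 'M[F]_(a, b)) : (forall i j, stab (V i j)) -> mxbdreg V.
Proof. by move=> sV i j; exact: stab_bdreg. Qed.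
Lemma mxbdreg_star a b (V : 'M[F]_(a, b)) : mxbdreg V -> mxbdreg (mxstar V).
Proof. by move=> bV i j; rewrite !mxE; exact: bdreg_rstar. Qed.
Let sG : forall i j, stab (G i j).
Proof. by apply/stableP; case: mpG. Qed.
Let bM : mxbdreg M.
Proof.
apply: mxbdregZ; first exact: bdregX.
by apply: mxbdregM; [exact: stab_mxbdreg|apply: mxbdreg_star; exact: stab_mxbdreg].
Qed.
Lemma wiener_stab_X i j : stab (X i j).
Proof. by have [] := hardy_projP (bM i j). Qed.
Let sX := wiener_stab_X.
Let sXQ : forall i j, stab ((X *m Q) i j).
Proof. exact: stab_mulmx. Qed.
Lemma wiener_stab_K i j : stab (K i j).
Proof.
rewrite /K !mxE; apply: stabB; first exact: sW1.
by apply: stabM; [exact: stabXV|have := sXQ i j; rewrite mxE].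
Qed.

(** Both sides are the L2(1) norm of V, since Q Q^* = 1. *)
Lemma mxsqnorm_inner n (V : 'M[F]_(n, r)) : mxsqnorm (V *m Q) = mxsqnorm V.
Proof.
have e1 := spectral_norm2E V (esym QQ); have e2 := spectral_norm2E V (mx1_star r).
rewrite e1 mulmx1 in e2.
have k0 := @inv2pi_gt0 R.
have -> : mxsqnorm (V *m Q) = ((pi *+ 2)%:E * (((pi *+ 2)^-1)%:E * mxsqnorm (V *m Q)))%E.
  by rewrite muleA -EFinM mulfV ?twopi_neq0 // mul1e.
by rewrite e2 muleA -EFinM mulfV ?twopi_neq0 // mul1e.
Qed.

(** This places X Q e(t) in the past of y_2: Q is isometric, so the
    approximation of X by causal multiples of G carries over. *)
Lemma wiener_dense (eps : R) : 0 < eps -> exists2 s : seq (int * 'M[C]_(m, p)),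
  all (fun a => 0 <= a.1) s & (mxsqnorm (X *m Q - laurent s *m W2)%R < eps%:E)%E.
Proof.
move=> e0.
have [s Qs h] := @beurling R (fun k : int => 0 <= k) (lexx 0) Qp_add ler01 _ _ _ G X eps
  rG (or_introl mpG) (fun i j => stab_bdreg (sG i j)) sX e0.
by exists s => //; rewrite W2E mulmxA -mulmxBl mxsqnorm_inner.
Qed.

(** K Q^* = z^-1 (M - X) because Q Q^* = 1; hence K W2^* = K Q^* G^* only
    sees what the projection removes from M. *)
Lemma error_cross_spectrum (k : int) i j (th : R) :
  \sum_l boundary (K i l) th * conjc (boundary ((ratX ^ (- k) *: W2) j l) th) =
  \sum_l (boundary (M i l) th - boundary (X i l) th) *
    conjc (boundary ((ratX ^ (- (k - 1)) *: G) j l) th).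
Proof.
have key : K *m mxstar (ratX ^ (- k) *: W2) = (M - X) *m mxstar (ratX ^ (- (k - 1)) *: G).
  have star_scale a b f (V : 'M[F]_(a, b)) : mxstar (f *: V) = rstar f *: mxstar V.
    by apply/matrixP => i0 j0; rewrite !mxE rstarM.
  have rX : rstar ratX = ratX^-1 :> F.
    have eX : ratX = tofrac 'X / tofrac 1 :> F by rewrite tofrac1 divr1.
    by rewrite (rstar_rep (oner_neq0 _) eX) !map_polyX !rmorph1 puX divr1.
  have rXV : rstar (ratX ^ (- k)) * ratX^-1 = rstar (ratX ^ (- (k - 1))) :> F.
    by rewrite -rX -rstarM -{2}[ratX]expr1z -expfzDr ?ratX_neq0 // opprB addrC.
  rewrite !star_scale W2E mxstarM -!scalemxAr mulmxA.
  have -> : K *m mxstar Q = ratX^-1 *: (M - X).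
    rewrite mulmxBl scalerBr -scalemxAl -mulmxA QQ mulmx1 /M scalerA.
    by rewrite mulVf ?ratX_neq0 // scale1r.
  by rewrite -scalemxAl scalerA rXV.
have bK : mxbdreg K by apply: stab_mxbdreg; exact: wiener_stab_K.
have bX : mxbdreg X by apply: stab_mxbdreg; exact: sX.
have bW : mxbdreg (ratX ^ (- k) *: W2).
  by apply: mxbdregZ; [exact: bdregXz|exact: stab_mxbdreg].
have bG : mxbdreg (ratX ^ (- (k - 1)) *: G).
  by apply: mxbdregZ; [exact: bdregXz|exact: stab_mxbdreg].
rewrite -(mul_star_bd i j th bK bW) key (mul_star_bd i j th (mxbdregB bM bX) bG).
have sub l : (M - X) i l = M i l - X i l by rewrite mxE [(- X) i l]mxE.
by apply: eq_bigr => l _; rewrite sub bdB; [|exact: bM|exact: bX].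
Qed.

(** By density it suffices to test against y_2(t - k) with
    k >= 1.  The covariance is then the inner product of M - X with
    z^-(k-1) G, which is stable. *)
Lemma error_orth_past t x eta i : noise_output P e K t x -> past P y2 (t - 1) eta ->
  cintegral P setT (fun w => x w i 0 * conjc (eta w)) = 0.
Proof.
move=> ex [/L2_l2 leta Heta]; have [_ lx _] := ex.
have ly2 s : vecl2 P (y2 s) by case: (ey2 s).
apply: orth_closed => // eps e0; have [s Hs hs] := Heta _ e0.
have lr (a : int * 'rV[C]_p) : l2 P setT (fun w => (a.2 *m y2 a.1 w) 0 0).
  exact: (vecl2M a.2 (ly2 a.1) 0).
exists (fun w => \sum_(a <- s) (a.2 *m y2 a.1 w) 0 0); split=> //.
  exact: l2_sum.
transitivity (cintegral P setT (fun w => \sum_(a <- s) x w i 0 * conjc ((a.2 *m y2 a.1 w) 0 0))).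
  by apply: cintegral_eq => w _; rewrite conjc_sum mulr_sumr.
rewrite cintegral_sum // => [|a]; last exact: l2M_cintegrable.
rewrite big_seq big1 // => a ina; have a1 : a.1 <= t - 1 := allP Hs _ ina.
have -> : cintegral P setT (fun w => x w i 0 * conjc ((a.2 *m y2 a.1 w) 0 0)) =
   cintegral P setT (fun w => \sum_j conjc (a.2 0 j) * (x w i 0 * conjc (y2 a.1 w j 0))).
  apply: cintegral_eq => w _; rewrite mxE conjc_sum mulr_sumr; apply: eq_bigr => j _.
  by rewrite conjc_mul mulrCA.
have ic j : cintegrable P setT (fun w => x w i 0 * conjc (y2 a.1 w j 0)).
  by apply: l2M_cintegrable => //; exact: ly2.
rewrite cintegral_sum // => [|j]; last exact: cintegrableZ.
rewrite big1 // => j _; rewrite cintegralZ //; apply/eqP; rewrite mulf_eq0; apply/orP; right.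
apply/eqP.
pose k := t - a.1.
have ey : noise_output P e (ratX ^ (- k) *: W2) t (y2 a.1).
  by apply: noise_output_shift; rewrite /k opprB addrC subrK; exact: ey2.
rewrite (noise_output_isometry el2 ecov i j ex ey).
have mc := @measurable_circle R.
have bl a' b' (V : 'M[F]_(a', b')) i' j' : mxbdreg V -> l2 mu circle (boundary (V i' j')).
  by move=> bV; exact: bdreg_l2.
have bK : mxbdreg K by apply: stab_mxbdreg; exact: wiener_stab_K.
have bX : mxbdreg X by apply: stab_mxbdreg; exact: sX.
have bW : mxbdreg (ratX ^ (- k) *: W2).
  by apply: mxbdregZ; [exact: bdregXz|exact: stab_mxbdreg].
(* k - 1 >= 0 because y_2 is only observed up to t - 1 *)
have sGk i' j' : stab ((ratX ^ (- (k - 1)) *: G) i' j').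
  rewrite mxE; apply: stabM; last exact: sG.
  have k1 : 0 <= k - 1 by rewrite /k subr_ge0 lerBrDl -lerBrDr.
  case: (k - 1) k1 => // n _; rewrite -exprnN -exprVn.
  elim: n => [|n IH]; rewrite ?expr0 ?exprS.
    by rewrite -(rmorph1 (@ratC R)); exact: stabC.
  by apply: stabM => //; exact: stabXV.
have bG := stab_mxbdreg sGk.
rewrite -(cintegral_sum mc) => [|l]; last exact: (l2M_cintegrable mc (bl _ _ _ _ _ bK) (bl _ _ _ _ _ bW)).
rewrite (_ : cintegral _ _ _ = cintegral mu circle (fun th =>
  \sum_l (boundary (M i l) th - boundary (X i l) th) *
    conjc (boundary ((ratX ^ (- (k - 1)) *: G) j l) th))); last first.
  by apply: cintegral_eq => th _; rewrite error_cross_spectrum.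
rewrite (cintegral_sum mc) => [|l]; last first.
  exact: (l2M_cintegrable mc (l2B mc (bl _ _ _ _ _ bM) (bl _ _ _ _ _ bX)) (bl _ _ _ _ _ bG)).
rewrite big1 ?mulr0 // => l _.
have [_ [_ H]] := hardy_projP (bM i l).
by apply/circle_integral_eq0; apply: H; exact: stab_hardy2.
Qed.

Lemma past_of_output t xi i : noise_output P e (X *m Q) t xi -> past P y2 t (fun w => xi w i 0).
Proof.
move=> ex; have [_ lx _] := ex; split; first exact/L2_l2.
move=> eps e0; have [s Qs hs] := wiener_dense e0.
exists [seq (t - a.1, row i a.2) | a <- s].
  rewrite all_map; apply/allP => a /(allP Qs) /= a0.
  by rewrite lerBlDr lerDl.
have el := noise_outputB el2 ex (noise_output_apply el2 s t ey2).
have [_ ll _] := el.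
have h := inv2pi_mul_lt (mxsqnorm_ge0 _) hs; rewrite -(noise_output_mean_sq el2 ecov el) in h.
apply: le_lt_trans h; rewrite /mean_sq (bigD1 i) //=.
rewrite (_ : (\int[P]_w _)%E = sqnorm P setT (fun w => (xi w - laurent_apply s y2 t w) i 0)).
  by rewrite leeDl //; apply: sume_ge0 => l _; exact: sqnorm_ge0.
apply: eq_integral => w _; congr (sqabs _)%:E.
have -> : (xi w - laurent_apply s y2 t w) i 0 = xi w i 0 - laurent_apply s y2 t w i 0.
  by rewrite !mxE.
rewrite /laurent_apply summxE big_map; congr (_ - _); apply: eq_bigr => a _ /=.
by rewrite !mxE; apply: eq_bigr => j _; rewrite mxE.
Qed.

Lemma loop_noise t xi : noise_output P e (X *m Q) (t - 1) xi ->
  noise_output P e K t (fun w => y1 t w - xi w).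
Proof.
move=> ex; have h := noise_output_shift (k := 1) ex; rewrite exprN1 in h.
exact (noise_outputB el2 (ey1 t) h).
Qed.

Lemma output_projection t xi i : noise_output P e (X *m Q) (t - 1) xi ->
  is_projection P (past P y2 (t - 1)) (fun w => y1 t w i 0) (fun w => xi w i 0).
Proof.
move=> ex; split; first exact: past_of_output.
move=> eta Heta; rewrite cE_cintegral -(error_orth_past i (loop_noise ex) Heta).
by apply: cintegral_eq => w _; rewrite !mxE.
Qed.

Section Solution.
Variable A : 'M[F]_(m, p).
Hypothesis AW : A *m W2 = X *m Q.

Lemma solution_output t xi : noise_output P e (X *m Q) t xi -> filter_output P y2 Phi22 A t xi.
Proof.
move=> ex; apply: (process_filter_output el2 ecov ey2 PhiW); first by rewrite AW.
by move=> eps e0; have [s _ hs] := wiener_dense e0; exists s; rewrite AW.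
Qed.

Lemma solution_wiener : wiener_filter P y1 y2 Phi22 A.
Proof.
move=> t; have [xi ex] := noise_output_exists el2 ecov (t - 1) sXQ.
by exists xi; [exact: solution_output|move=> i; exact: output_projection].
Qed.

Lemma solution_forward_loop : forward_loop P y1 y2 e Phi22 A K 1.
Proof.
move=> t; have [xi ex] := noise_output_exists el2 ecov (t - 1) sXQ.
exists xi, (fun w => y1 t w - xi w); split.
- exact: solution_output.
- exact: (noise_output_filter_output el2 (loop_noise ex)).
- by apply: aeW => w; rewrite addrC subrK.
Qed.

(** The same output as in the loop with delay 1, the delay
    being absorbed in the filter; the approximating Laurent polynomials are
    shifted accordingly. *)
Lemma solution_forward_loop0 : forward_loop P y1 y2 e Phi22 (ratX^-1 *: A) K 0.
Proof.
move=> t; have [xi ex] := noise_output_exists el2 ecov (t - 1) sXQ.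
exists xi, (fun w => y1 t w - xi w); split.
- rewrite subr0; apply: (process_filter_output el2 ecov ey2 PhiW).
    by rewrite -scalemxAl AW -exprN1; exact: noise_output_shift.
  move=> eps e0; have [s _ hs] := wiener_dense e0.
  exists [seq (a.1 + 1, a.2) | a <- s]; rewrite laurent_shift -!scalemxAl AW -scalerBr.
  rewrite -exprN1 mxsqnorm_shift //; apply: mxbdregB.
    exact: stab_mxbdreg.
  by apply: mxbdregM; [exact: mxbdreg_laurent|exact: stab_mxbdreg].
- exact: (noise_output_filter_output el2 (loop_noise ex)).
- by apply: aeW => w; rewrite addrC subrK.
Qed.
End Solution.

Lemma projection_unique S (x xi xi' : T -> C) : l2 P setT x -> S `<=` L2 P ->
  is_projection P S x xi -> is_projection P S x xi' ->
  sqnorm P setT (fun w => xi w - xi' w) = 0%E.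
Proof.
move=> lx SL [Sxi H] [Sxi' H'].
have /L2_l2 l1 := SL _ Sxi; have /L2_l2 l1' := SL _ Sxi'.
have ld := l2B measurableT l1 l1'.
have orth eta : S eta -> cintegral P setT (fun w => (xi w - xi' w) * conjc (eta w)) = 0.
  move=> Seta; have /L2_l2 le := SL _ Seta.
  transitivity (cintegral P setT (fun w => (x w - xi' w) * conjc (eta w) +
      (-1) * ((x w - xi w) * conjc (eta w)))).
    by apply: cintegral_eq => w _; ring.
  have i1 := l2M_cintegrable measurableT (l2B measurableT lx l1) le.
  have i2 := l2M_cintegrable measurableT (l2B measurableT lx l1') le.
  rewrite cintegralD // ?cintegralZ //; last exact: cintegrableZ.
  by have := H _ Seta; have := H' _ Seta; rewrite !cE_cintegral => -> ->; rewrite mulr0 addr0.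
have z0 : cintegral P setT (fun w => (xi w - xi' w) * conjc (xi w - xi' w)) = 0.
  transitivity (cintegral P setT (fun w => (xi w - xi' w) * conjc (xi w) +
      (-1) * ((xi w - xi' w) * conjc (xi' w)))).
    by apply: cintegral_eq => w _; rewrite conjc_add conjc_opp; ring.
  have i1 := l2M_cintegrable measurableT ld l1.
  have i2 := l2M_cintegrable measurableT ld l1'.
  by rewrite cintegralD // ?cintegralZ ?orth ?mulr0 ?addr0 //; exact: cintegrableZ.
by rewrite (cintegral_sqE ld) in z0; rewrite -(fineK (l2_fin ld)); case: z0 => ->.
Qed.

(** Two filters that produce the same random vector have the
    same product with W2, by the isometry.  A may have poles on the circle, so
    the isometry is applied to the Laurent polynomials that approximate it. *)
Lemma wiener_solution A : (exists A0, A0 *m W2 = X *m Q) ->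
  wiener_filter P y1 y2 Phi22 A -> A *m W2 = X *m Q.
Proof.
move=> [A0 A0W] /(_ 0) [xi' [/L2vecP lx' Hx'] pr'].
have [xi ex] := noise_output_exists el2 ecov (0 - 1) sXQ.
have [/L2vecP lx Hx] := solution_output A0W ex.
have pr i := output_projection i ex.
have ly1 : vecl2 P (y1 0) by case: (ey1 0).
have ly2 t : vecl2 P (y2 t) by case: (ey2 t).
have z : mean_sq P (fun w => xi' w - xi w) = 0%E.
  rewrite /mean_sq big1 // => i _.
  rewrite -(@projection_unique (past P y2 (0 - 1)) _ _ _ (ly1 i) _ (pr' i) (pr i)).
    by apply: sqnorm_eq => w _; rewrite !mxE.
  by move=> eta [].
apply/eqP; rewrite -A0W -subr_eq0 -mulmxBl; apply/eqP/mxsqnorm_eq0/eqP.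
rewrite eq_le mxsqnorm_ge0 andbT; apply/lee_addgt0Pr => eps e0; rewrite add0e; apply: ltW.
(* 46 = 2 + 2 * 22, 22 = 2 * 10 + 2, 10 = 2 + 2 * 4, 4 = 2 + 2: each level
   is one use of the doubled triangle inequality *)
pose e1 := eps / 46; have e10 : 0 < e1 by rewrite divr_gt0.
have ke : 0 < (pi *+ 2)^-1 * e1 by rewrite mulr_gt0 // inv2pi_gt0.
have [s [s1 s2]] := Hx _ ke; have [s' [s1' s2']] := Hx' _ ke.
have ls := vecl2_laurent_apply s (0 - 1) ly2.
have ls' := vecl2_laurent_apply s' (0 - 1) ly2.
rewrite mean_squareE in s1; last exact: vecl2B.
rewrite mean_squareE in s1'; last exact: vecl2B.
rewrite (spectral_norm2E _ PhiW) in s2; rewrite (spectral_norm2E _ PhiW) in s2'.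
have {}s2 := inv2pi_mul_lt_cancel (mxsqnorm_ge0 _) s2;
  have {}s2' := inv2pi_mul_lt_cancel (mxsqnorm_ge0 _) s2'.
set k := (pi *+ 2)^-1 in ke s1 s1'.
have bs : mxbdreg ((A0 - laurent s) *m W2).
  rewrite mulmxBl A0W; apply: mxbdregB; first exact: stab_mxbdreg.
  by apply: mxbdregM; [exact: mxbdreg_laurent|exact: stab_mxbdreg].
rewrite -mxsqnormN // in s2.
have es : noise_output P e (laurent s' *m W2 - laurent s *m W2) (0 - 1)
    (fun w => laurent_apply s' y2 (0 - 1) w - laurent_apply s y2 (0 - 1) w).
  exact (noise_outputB el2 (noise_output_apply el2 s' (0 - 1) ey2) (noise_output_apply el2 s (0
    - 1) ey2)).
have s3 : (mxsqnorm (laurent s' *m W2 - laurent s *m W2)%R < (10 * e1)%:E)%E.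
  apply: inv2pi_mul_lt_cancel; first exact: mxsqnorm_ge0.
  rewrite -(noise_output_mean_sq el2 ecov es).
  rewrite (_ : (fun w => _) = (fun w => (xi' w - xi w) +
    ((xi w - laurent_apply s y2 (0 - 1) w) + - (xi' w - laurent_apply s' y2 (0 - 1) w)))).
    rewrite -mean_sqN in s1'.
    have lA := vecl2B lx ls; have lB := vecl2N (vecl2B lx' ls').
    have t1 : (mean_sq P (fun w => (xi w - laurent_apply s y2 (0 - 1) w) +
        - (xi' w - laurent_apply s' y2 (0 - 1) w))%R < (4 * (k * e1))%:E)%E.
      apply: lt_double_sum (mean_sqD_le lA lB) (mean_sq_ge0 _ _) (mean_sq_ge0 _ _) s1 s1' _; lra.
    have t2 : (mean_sq P (fun w => xi' w - xi w)%R < (k * e1)%:E)%E by rewrite z lte_fin.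
    apply: lt_double_sum (mean_sqD_le (vecl2B lx' lx) (vecl2D lA lB)) (mean_sq_ge0 _ _)
      (mean_sq_ge0 _ _) t2 t1 _.
    by rewrite -/k; lra.
  by apply/funext => w; exact: subr_detour.
have s4 : (mxsqnorm ((laurent s' *m W2 - laurent s *m W2) + - ((A0 - laurent s) *m W2))%R <
    (22 * e1)%:E)%E.
  by apply: lt_double_sum (mxsqnormD_le _ _) (mxsqnorm_ge0 _) (mxsqnorm_ge0 _) s3 s2 _; lra.
rewrite (_ : (A - A0) *m W2 = (A - laurent s') *m W2 +
   ((laurent s' *m W2 - laurent s *m W2) + - ((A0 - laurent s) *m W2))); last first.
  by rewrite !mulmxBl; exact: subr_chain.
by apply: lt_double_sum (mxsqnormD_le _ _) (mxsqnorm_ge0 _) (mxsqnorm_ge0 _) s2' s4 _;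
  rewrite /e1; lra.
Qed.
End Wiener.

(** * Left inverses and the feedback model *)

Section Algebra.
Context {R : realType}.
Local Notation F := (ratfun R).

Lemma mxstar_col a b n (U : 'M[F]_(a, n)) (V : 'M[F]_(b, n)) :
  mxstar (col_mx U V) = row_mx (mxstar U) (mxstar V).
Proof. by rewrite /mxstar map_col_mx tr_col_mx. Qed.

Lemma spectral_blocks a b n (Phi : 'M[F]_(a + b)) (W : 'M[F]_(a + b, n)) :
  spectral_factor Phi W ->
  [/\ ulsubmx Phi = usubmx W *m mxstar (usubmx W),
      dlsubmx Phi = dsubmx W *m mxstar (usubmx W) &
      drsubmx Phi = dsubmx W *m mxstar (dsubmx W)].
Proof.
rewrite /spectral_factor => ->; move: (usubmx W) (dsubmx W) (vsubmxK W) => U V <-.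
by rewrite mxstar_col mul_col_row block_mxKul block_mxKdl block_mxKdr.
Qed.

Lemma rank_left_inverse (n k : nat) (V : 'M[F]_(n, k)) : \rank V = k -> exists L, L *m V = 1%:M.
Proof.
move=> rV; have : row_full V by rewrite /row_full rV.
by move=> /row_fullP.
Qed.

(** V^* is cancelled on the right by L^*, as (L V)^* = 1. *)
Lemma mulmx_star_cancel q n k (A : 'M[F]_(q, n)) (V : 'M[F]_(n, k)) L :
  L *m V = 1%:M -> A *m (V *m mxstar V) = 0 -> A *m V = 0.
Proof.
move=> LV /(congr1 (fun B => B *m mxstar L)).
by rewrite mul0mx -!mulmxA -mxstarM LV mxstar1 mulmx1.
Qed.

(** W1^* is invertible together with W1 and can be
    cancelled from H W1 W1^* = W2 W1^*. *)
Lemma deterministic_relation (m p : nat) (W1 : 'M[F]_m) (W2 : 'M[F]_(p, m)) :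
  \rank W1 = m -> \rank (W1 *m mxstar W1) = m ->
  W2 *m mxstar W1 *m invmx (W1 *m mxstar W1) *m W1 = W2.
Proof.
move=> r1 r11; have [L LW] := rank_left_inverse r1.
have u11 : W1 *m mxstar W1 \in unitmx by rewrite -row_free_unit /row_free r11.
set H := _ *m invmx _.
have HP : H *m (W1 *m mxstar W1) = W2 *m mxstar W1 by rewrite /H mulmxKV.
have : (H *m W1) *m mxstar W1 *m mxstar L = W2 *m mxstar W1 *m mxstar L.
  by rewrite -HP !mulmxA.
by rewrite -!mulmxA -mxstarM LW mxstar1 !mulmx1.
Qed.

Section Factor.
Variables (m p r : nat) (W2 : 'M[F]_(p, m)) (G : 'M[F]_(p, r)) (Q : 'M[F]_(r, m)).
Hypotheses (W2E : W2 = G *m Q) (QQ : Q *m mxstar Q = 1%:M).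
Variable X : 'M[F]_(m, r).

Lemma factor_cancel A : A *m W2 = X *m Q <-> A *m G = X.
Proof.
rewrite W2E mulmxA; split=> [|->] // /(congr1 (fun B => B *m mxstar Q)).
by rewrite -!mulmxA QQ !mulmx1.
Qed.

(** The density of y_2 is G G^*, and G^* can be cancelled, so a
    filter on y_2 is determined by its product with G. *)
Lemma same_filterP A L : L *m G = 1%:M ->
  same_filter (W2 *m mxstar W2) A (X *m L) <-> A *m W2 = X *m Q.
Proof.
move=> LG; have WW : W2 *m mxstar W2 = G *m mxstar G.
  by rewrite W2E mxstarM -!mulmxA [Q *m _]mulmxA QQ mul1mx.
rewrite /same_filter WW factor_cancel; split=> [/(mulmx_star_cancel LG)|AG].
  by rewrite mulmxBl -mulmxA LG mulmx1 => /subr0_eq.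
by rewrite mulmxA mulmxBl AG -mulmxA LG mulmx1 subrr mul0mx.
Qed.

(** If A = X D and A G = X, then X (1 - D G) = 0, so that D
    can be corrected to the left inverse D + (1 - D G) L0 without changing
    X D. *)
Lemma left_inverse_rowspace A L0 : L0 *m G = 1%:M ->
  A *m G = X /\ (A^T <= X^T)%MS <-> exists2 L, L *m G = 1%:M & A = X *m L.
Proof.
move=> LG; split=> [[AG /submxP[D /(congr1 trmx)]]|[L LG1 ->]]; last first.
  by rewrite -mulmxA LG1 mulmx1 trmx_mul submxMl.
rewrite trmx_mul !trmxK => AD.
exists (D^T + (1%:M - D^T *m G) *m L0).
  by rewrite [LHS]mulmxDl -mulmxA LG mulmx1 addrC subrK.
rewrite [RHS]mulmxDr mulmxA mulmxBr mulmx1 mulmxA -AD AG subrr mul0mx addr0.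
by [].
Qed.
End Factor.
End Algebra.

Section Blocks.
Context {R : realType} {d : measure_display} {T : measurableType d} (P : probability T R).
Local Notation C := R[i].
Local Notation F := (ratfun R).
Variables (m p n : nat) (e : int -> T -> 'cV[C]_n).
Hypothesis el2 : forall t, vecl2 P (e t).

Lemma noise_output_usub (W : 'M[F]_(m + p, n)) t y :
  noise_output P e W t y -> noise_output P e (usubmx W) t (fun w => usubmx (y w)).
Proof.
move=> ey; have us (K : pzRingType) k (V : 'M[K]_(m + p, k)) :
    usubmx V = row_mx 1%:M 0 *m V.
  by rewrite -{2}[V]vsubmxK mul_row_col mul1mx mul0mx addr0.
have := noise_outputM el2 (row_mx 1%:M 0 : 'M[C]_(m, m + p)) ey.
rewrite map_row_mx map_mx1 map_mx0 -us.
by congr noise_output; apply/funext => w; rewrite us.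
Qed.

Lemma noise_output_dsub (W : 'M[F]_(m + p, n)) t y :
  noise_output P e W t y -> noise_output P e (dsubmx W) t (fun w => dsubmx (y w)).
Proof.
move=> ey; have ds (K : pzRingType) k (V : 'M[K]_(m + p, k)) :
    dsubmx V = row_mx 0 1%:M *m V.
  by rewrite -{2}[V]vsubmxK mul_row_col mul1mx mul0mx add0r.
have := noise_outputM el2 (row_mx 0 1%:M : 'M[C]_(p, m + p)) ey.
rewrite map_row_mx map_mx1 map_mx0 -ds.
by congr noise_output; apply/funext => w; rewrite ds.
Qed.
End Blocks.

(** H may be unstable and W may have zeros outside the
    disc, so H W = V is approximated by two-sided Laurent multiples of W. *)
Lemma factor_filter_output (R : realType) (d : measure_display) (T : measurableType d)
    (P : probability T R) (m q : nat) (e v : int -> T -> 'cV[R[i]]_m) (x : T -> 'cV[R[i]]_q)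
    (W : 'M[ratfun R]_m) (V H : 'M[ratfun R]_(q, m)) t :
  (forall t, vecl2 P (e t)) ->
  (forall s t, cov P (e s) (e t) = if s == t then 1%:M else 0) ->
  (forall i j, stab (W i j)) -> (forall i j, stab (V i j)) -> \rank W = m ->
  (forall t, noise_output P e W t (v t)) -> noise_output P e V t x -> H *m W = V ->
  filter_output P v (W *m mxstar W) H t x.
Proof.
move=> el2 ecov sW sV rW ev ex HW.
apply: (process_filter_output el2 ecov ev (erefl _)); first by rewrite HW.
move=> eps e0.
have [s _ h] := @beurling R (fun k : int => true) isT (fun _ _ _ _ => isT) isT _ _ _ W V eps
  rW (or_intror isT) (fun i j => stab_bdreg (sW i j)) sV e0.
by exists s; rewrite HW.
Qed.

(** * The theorem *)

Theorem theorem4p1 (R : realType) (d : measure_display) (T : measurableType d)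
    (P : probability T R) (m p r : nat)
    (y : int -> T -> 'cV[R[i]]_(m + p))
    (e : int -> T -> 'cV[R[i]]_m)
    (Phi : 'M[ratfun R]_(m + p)) (W : 'M[ratfun R]_(m + p, m))
    (G2 : 'M[ratfun R]_(p, r)) (Q2 : 'M[ratfun R]_(r, m)) :
  let y1 := fun t w => usubmx (y t w) in
  let y2 := fun t w => dsubmx (y t w) in
  let Phi11 := ulsubmx Phi in
  let Phi21 := dlsubmx Phi in
  let Phi22 := drsubmx Phi in
  let W1 := usubmx W in
  let W2 := dsubmx W in
  (0 < m)%N ->
  stationary P y ->
  has_spectral_density P y Phi ->
  \rank Phi = m ->
  \rank Phi11 = m ->
  spectral_factor Phi W ->
  minimum_phase W ->
  \rank W1 = m ->
  normalized_white_noise P e ->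
  (forall t, filter_output P e 1%:M W t (y t)) ->
  r = \rank W2 ->
  W2 = G2 *m Q2 ->
  spectral_factor Phi22 G2 ->
  minimum_phase G2 ->
  \rank G2 = r ->
  inner Q2 ->
  let X := hardy_proj (ratX *: (W1 *m mxstar Q2)) in
  let K := W1 - ratX^-1 *: (X *m Q2) in
  let H := Phi21 *m invmx Phi11 in
  [/\ stable K,
      forall L, left_inverse G2 L ->
        [/\ wiener_filter P y1 y2 Phi22 (X *m L),
            forward_loop P y1 y2 e Phi22 (X *m L) K 1 &
            feedback_model P y1 y2 e Phi11 Phi22 (ratX^-1 *: (X *m L)) K H],
      forall F, wiener_filter P y1 y2 Phi22 F <->
        exists2 L, left_inverse G2 L & same_filter Phi22 F (X *m L) &
      forall F, (wiener_filter P y1 y2 Phi22 F /\ (F^T <= X^T)%MS) <->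
        exists2 L, left_inverse G2 L & F = X *m L].
Proof.
move=> y1 y2 Phi11 Phi21 Phi22 W1 W2 _ _ _ _ r11 sfW [stW _] rW1 [ze ecov] ye _ W2E _ mpG rG
  [stQ QQ] X K H.
have el2 t : vecl2 P (e t) by case: (ze t) => /L2vecP.
have sW := (stableP W).1 stW; have sQ := (stableP Q2).1 stQ.
have sW1 i j : stab (W1 i j) by rewrite mxE.
have sW2 i j : stab (W2 i j) by rewrite mxE.
have ey t : noise_output P e W t (y t).
  by apply: (filter_output_noise_output el2) (ye t); exact: stab_mxbdreg.
have ey1 t : noise_output P e W1 t (y1 t) by exact: (noise_output_usub el2 (ey t)).
have ey2 t : noise_output P e W2 t (y2 t) by exact: (noise_output_dsub el2 (ey t)).
have [e11 e21 e22] := spectral_blocks sfW.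
have [L0 LG0] := rank_left_inverse rG.
have XLW L : L *m G2 = 1%:M -> (X *m L) *m W2 = X *m Q2.
  by move=> LG; apply/(factor_cancel W2E QQ); rewrite -mulmxA LG mulmx1.
have wienerP A : wiener_filter P y1 y2 Phi22 A <-> A *m W2 = X *m Q2.
  split; last exact: (solution_wiener el2 ecov sW1 sW2 sQ mpG rG W2E QQ ey1 ey2 e22).
  apply: (wiener_solution el2 ecov sW1 sW2 sQ mpG rG W2E QQ ey1 ey2 e22).
  by exists (X *m L0); exact: XLW.
split.
- by apply/stableP; exact: wiener_stab_K sW1 sQ.
- move=> L /XLW LW; split;
    [exact/wienerP|exact: (solution_forward_loop el2 ecov sW1 sQ mpG rG W2E QQ ey1 ey2 e22 LW)|].
  split; first exact: (solution_forward_loop0 el2 ecov sW1 sW2 sQ mpG rG W2E QQ ey1 ey2 e22 LW).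
  move=> t; rewrite /Phi11 e11.
  apply: (factor_filter_output el2 ecov sW1 sW2 rW1 ey1 (ey2 t)).
  by rewrite /H /Phi21 e21 /Phi11 e11; apply: deterministic_relation => //; rewrite -e11.
- move=> F; apply: (iff_trans (wienerP F)); rewrite /Phi22 e22; split=> [FW|[L LG]].
    by exists L0 => //; exact/(same_filterP W2E QQ X F LG0).
  by move/(same_filterP W2E QQ X F LG).
- move=> F; rewrite wienerP (factor_cancel W2E QQ).
  exact: left_inverse_rowspace LG0.
Qed.
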